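(* Let $\mathcal H$ be a nonzero real Hilbert space and let $\pi:\mathrm{Aut}([0,1],\lambda)\to\mathcal O(\mathcal H)$ be an orthogonal representation without invariant vectors. Then the restriction of $\pi$ to the subgroup $\langle T_1,T_2\rangle$ is a multiple of the regular representation of the free group generated by $T_1$ and $T_2$.
   Context: For a probability space $(X,\mathcal B,\mu)$, the measure algebra $\mathrm{MAlg}(X,\mu)$ is the quotient of $\mathcal B$ obtained by identifying $A,B$ when $\mu(A\triangle B)=0$, equipped with the complete metric $d_\mu(A,B)=\mu(A\triangle B)$, the constants $\emptyset$ and $X$, the operations $\cup,\cap,\triangle$, and the function $\mu$. $\mathrm{Aut}(X,\mu)$ is the group of automorphisms of this structure (bijections of $\mathrm{MAlg}(X,\mu)$ preserving the metric, the constants, the operations and $\mu$), endowed with the topology of pointwise convergence on the metric space $(\mathrm{MAlg}(X,\mu),d_\mu)$. $\lambda$ is Lebesgue measure on $[0,1]$ with its Borel $\sigma$-algebra. An orthogonal representation of a topological group $G$ on a nonzero real Hilbert space $\mathcal H$ is a continuous group homomorphism $\pi:G\to\mathcal O(\mathcal H)$, where the orthogonal group $\mathcal O(\mathcal H)$ has the topology of pointwise (strong) convergence. An invariant vector is a nonzero $\xi\in\mathcal H$ with $\pi(g)\xi=\xi$ for all $g\in G$. The elements $T_1,T_2$: let $\mathbb F_2=\langle a,b\rangle$ be the free group on two generators, $X=\{0,1\}^{\mathbb N\times\mathbb F_2}$ and $\mu=(\tfrac12\delta_0+\tfrac12\delta_1)^{\otimes(\mathbb N\times\mathbb F_2)}$.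 The group $\mathbb F_2$ acts on $(X,\mu)$ preserving the measure by $(\gamma\cdot x)(n,g)=x(n,\gamma^{-1}g)$, and hence by automorphisms on $\mathrm{MAlg}(X,\mu)$ via $\gamma A=\{\gamma\cdot x: x\in A\}$. Fix an isomorphism of measure algebras between $\mathrm{MAlg}(X,\mu)$ and $\mathrm{MAlg}([0,1],\lambda)$; $T_1,T_2\in\mathrm{Aut}([0,1],\lambda)$ are the elements corresponding to the action of $a$ and $b$ respectively. The regular representation of a discrete group $\Gamma$ is its orthogonal representation on the real space $\ell^2(\Gamma)$ given by $(\gamma\cdot\xi)(g)=\xi(\gamma^{-1}g)$. A multiple of the regular representation is a tensor product of the regular representation with a trivial representation. *)

(* Defs.v *)
From HB Require Import structures.
From mathcomp Require Import all_boot all_order all_algebra.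
From mathcomp Require Import all_classical all_reals all_analysis.
Import Order.TTheory GRing.Theory Num.Theory.
Import numFieldNormedType.Exports.

Set Implicit Arguments.
Unset Strict Implicit.
Unset Printing Implicit Defensive.

Local Open Scope classical_set_scope.
Local Open Scope ring_scope.

(** * Groups of bijections and the topology of pointwise convergence *)

Section bijections.
Variable X : choiceType.

Definition Sym : Type := set_type [set f : X -> X | bijective f].

HB.instance Definition _ := SubType.copy Sym (set_type [set f : X -> X | bijective f]).
HB.instance Definition _ := [Choice of Sym by <:].

Definition Sym_fun (f : Sym) : X -> X := val f.

Lemma Sym_bij (f : Sym) : bijective (Sym_fun f).
Proof. exact: set_mem (valP f). Qed.

Definition Sym_of (f : X -> X) (bijf : bijective f) : Sym := SigSub (mem_set bijf).

Lemma Sym_ofE f (bijf : bijective f) : Sym_fun (Sym_of bijf) = f.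
Proof. by []. Qed.

Lemma SymP (f g : Sym) : Sym_fun f =1 Sym_fun g -> f = g.
Proof. by move=> fg; apply/val_inj/funext. Qed.

Lemma Sym_inv_subproof (f : Sym) :
  {g : X -> X | cancel (Sym_fun f) g & cancel g (Sym_fun f)}.
Proof. by apply: cid2; case: (Sym_bij f) => g fK gK; exists g. Qed.

Lemma Sym_inv_bij (f : Sym) : bijective (s2val (Sym_inv_subproof f)).
Proof. by case: Sym_inv_subproof => g fK gK /=; exists (Sym_fun f). Qed.

Lemma id_bij : bijective (@id X). Proof. by exists id. Qed.

Definition Sym_one : Sym := Sym_of id_bij.
Definition Sym_mul (f g : Sym) : Sym := Sym_of (bij_comp (Sym_bij f) (Sym_bij g)).
Definition Sym_inv (f : Sym) : Sym := Sym_of (Sym_inv_bij f).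

Lemma Sym_invK f : cancel (Sym_fun f) (Sym_fun (Sym_inv f)).
Proof. by rewrite Sym_ofE; case: Sym_inv_subproof. Qed.

Lemma Sym_invKV f : cancel (Sym_fun (Sym_inv f)) (Sym_fun f).
Proof. by rewrite Sym_ofE; case: Sym_inv_subproof. Qed.

Lemma Sym_mulA : associative Sym_mul. Proof. by move=> f g h; apply: SymP. Qed.
Lemma Sym_mul1 : left_id Sym_one Sym_mul. Proof. by move=> f; apply: SymP. Qed.
Lemma Sym_mulr1 : right_id Sym_one Sym_mul. Proof. by move=> f; apply: SymP. Qed.
Lemma Sym_mulV : left_inverse Sym_one Sym_inv Sym_mul.
Proof. by move=> f; apply: SymP => x; apply: Sym_invK. Qed.
Lemma Sym_mulrV : right_inverse Sym_one Sym_inv Sym_mul.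
Proof. by move=> f; apply: SymP => x; apply: Sym_invKV. Qed.

HB.instance Definition _ :=
  isGroup.Build Sym Sym_mulA Sym_mul1 Sym_mulr1 Sym_mulV Sym_mulrV.

End bijections.

Coercion Sym_fun : Sym >-> Funclass.

HB.instance Definition _ (X : topologicalType) :=
  Topological.copy (Sym X)
    (initial_topology ((fun f => f) : Sym X -> {ptws X -> X})).

(** * Subgroups *)

Definition subgroup {G : groupType} (K : set G) : Prop :=
  [/\ K 1%g, forall x y, K x -> K y -> K (x * y)%g & forall x, K x -> K (x^-1)%g].

Definition subgroup_gen {G : groupType} (S : set G) : Type :=
  set_type (smallest subgroup S).

Section subgroup_gen.
Variables (G : groupType) (S : set G).

Lemma smallest_subgroup : subgroup (smallest subgroup S).
Proof.
split=> [L [[]]//|x y Kx Ky L SL|x Kx L SL].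
- by case: (SL) => -[_ + _] _; apply; [apply: Kx|apply: Ky].
- by case: (SL) => -[_ _ +] _; apply; apply: Kx.
Qed.

Definition gen_pred : pred G := fun x => x \in smallest subgroup S.

Lemma gen_group_closed : group_closed gen_pred.
Proof.
have [K1 KM KV] := smallest_subgroup.
split=> [|x y]; first exact: mem_set.
move=> /set_mem Kx /set_mem Ky; apply: mem_set; apply: KM => //; exact: KV.
Qed.

HB.instance Definition _ := SubType.copy (subgroup_gen S) (set_type (smallest subgroup S)).
HB.instance Definition _ := [Choice of subgroup_gen S by <:].
HB.instance Definition _ := SubChoice_isSubGroup.Build G _ (subgroup_gen S) gen_group_closed.
End subgroup_gen.

(** * Measure algebras *)

Section measurable_sets.
Context d (X : measurableType d).

Definition mset : Type := set_type (@measurable d X).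

HB.instance Definition _ := SubType.copy mset (set_type (@measurable d X)).
HB.instance Definition _ := [Choice of mset by <:].

Definition mset_val (A : mset) : set X := val A.

Lemma measurable_mset (A : mset) : measurable (mset_val A).
Proof. exact: set_mem (valP A). Qed.

Definition mset_of (A : set X) (mA : measurable A) : mset := SigSub (mem_set mA).

End measurable_sets.
Coercion mset_val : mset >-> set.
#[global] Hint Extern 0 (measurable (mset_val _)) => solve [exact: measurable_mset] : core.

Lemma setYU_sub T (A A' B B' : set T) :
  (A `|` B) `+` (A' `|` B') `<=` (A `+` A') `|` (B `+` B').
Proof. by move=> x /=; tauto. Qed.

Lemma setYI_sub T (A A' B B' : set T) :
  (A `&` B) `+` (A' `&` B') `<=` (A `+` A') `|` (B `+` B').
Proof. by move=> x /=; case: (pselect (B x)); case: (pselect (A' x)); tauto. Qed.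

Lemma setYY_sub T (A A' B B' : set T) :
  (A `+` B) `+` (A' `+` B') `<=` (A `+` A') `|` (B `+` B').
Proof.
by move=> x /=; case: (pselect (A x)); case: (pselect (B x));
  case: (pselect (A' x)); case: (pselect (B' x)); tauto.
Qed.

Section MAlg.
Context d (X : measurableType d) (R : realType) (P : probability X R).
Implicit Types A B C : mset X.

Definition mset_equiv A B := `[< P (A `+` B) = 0%E >].

Lemma measurable_setY (A B : mset X) : measurable (A `+` B).
Proof. by apply: measurableU; apply: measurableD. Qed.
Hint Resolve measurable_setY : core.

Lemma PY_triangle A B C : (P (A `+` C) <= P (A `+` B) + P (B `+` C))%E.
Proof.
apply: (@le_trans _ _ (P ((A `+` B) `|` (B `+` C)))).
  apply: le_measure; rewrite ?inE//; first exact: measurableU.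
  by move=> x /= [[Ax nCx]|[Cx nAx]]; case: (pselect ((B : set X) x)) => Bx; tauto.
exact: measureU2.
Qed.

Lemma mset_equiv_refl : reflexive mset_equiv.
Proof. by move=> A; apply/asboolP; rewrite setYK measure0. Qed.

Lemma mset_equiv_sym : symmetric mset_equiv.
Proof. by move=> A B; rewrite /mset_equiv setYC. Qed.

Lemma mset_equiv_trans : transitive mset_equiv.
Proof.
move=> B A C /asboolP AB /asboolP BC; apply/asboolP/eqP.
by rewrite eq_le measure_ge0 andbT (le_trans (PY_triangle A B C))// AB BC adde0.
Qed.

Canonical mset_equiv_canonical :=
  EquivRel mset_equiv mset_equiv_refl mset_equiv_sym mset_equiv_trans.

Local Open Scope quotient_scope.

Definition MAlg : Type := {eq_quot mset_equiv}.
HB.instance Definition _ := Choice.on MAlg.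
HB.instance Definition _ := EqQuotient.on MAlg.

Definition mclass (A : mset X) : MAlg := \pi_MAlg A.

Lemma mclassP A B : mclass A = mclass B <-> P (A `+` B) = 0%E.
Proof.
split; first by move/eqmodP => /= /asboolP.
by move=> AB; apply/eqmodP/asboolP.
Qed.

Lemma mclass_repr (x : MAlg) : mclass (repr x) = x.
Proof. exact: reprK. Qed.

(** The operations are computed on representatives; the lemmas [MAlgUE],
    [MAlgIE], [MAlgYE] and [MAlg_muE] below give their values on arbitrary
    classes. *)
Definition MAlg0 : MAlg := mclass (mset_of measurable0).
Definition MAlgT : MAlg := mclass (mset_of measurableT).
Definition MAlgU (x y : MAlg) : MAlg :=
  mclass (mset_of (measurableU _ _ (measurable_mset (repr x)) (measurable_mset (repr y)))).
Definition MAlgI (x y : MAlg) : MAlg :=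
  mclass (mset_of (measurableI _ _ (measurable_mset (repr x)) (measurable_mset (repr y)))).
Definition MAlgY (x y : MAlg) : MAlg :=
  mclass (mset_of (measurable_setY (repr x) (repr y))).
Definition MAlg_mu (x : MAlg) : R := fine (P (repr x : mset X)).
Definition MAlg_dist (x y : MAlg) : R := MAlg_mu (MAlgY x y).

Lemma mclass_ind (Q : MAlg -> Prop) : (forall A, Q (mclass A)) -> forall x, Q x.
Proof. by move=> QA x; rewrite -(mclass_repr x). Qed.

Lemma repr_mclass A : P ((repr (mclass A) : mset X) `+` A) = 0%E.
Proof. by apply/mclassP; rewrite mclass_repr. Qed.

Lemma mclass_congr A A' B B' C C' :
  C `+` C' `<=` (A `+` A') `|` (B `+` B') ->
  P (A `+` A') = 0%E -> P (B `+` B') = 0%E -> mclass C = mclass C'.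
Proof.
move=> CC AA BB; apply/mclassP/eqP; rewrite eq_le measure_ge0 andbT.
apply: (@le_trans _ _ (P ((A `+` A') `|` (B `+` B')))).
  by apply: le_measure; rewrite ?inE//; exact: measurableU.
apply: (le_trans (measureU2 _ _ _)) => //.
by have -> : (P (A `+` A') + P (B `+` B') = 0)%E by rewrite AA BB adde0.
Qed.

Lemma MAlgUE A B (mAB : measurable (A `|` B)) :
  MAlgU (mclass A) (mclass B) = mclass (mset_of mAB).
Proof.
by apply: (mclass_congr _ (repr_mclass A) (repr_mclass B)); exact: setYU_sub.
Qed.

Lemma MAlgIE A B (mAB : measurable (A `&` B)) :
  MAlgI (mclass A) (mclass B) = mclass (mset_of mAB).
Proof.
by apply: (mclass_congr _ (repr_mclass A) (repr_mclass B)); exact: setYI_sub.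
Qed.

Lemma MAlgYE A B :
  MAlgY (mclass A) (mclass B) = mclass (mset_of (measurable_setY A B)).
Proof.
by apply: (mclass_congr _ (repr_mclass A) (repr_mclass B)); exact: setYY_sub.
Qed.

Lemma MAlg_muE A : MAlg_mu (mclass A) = fine (P A).
Proof.
have H (B C : mset X) : P (B `+` C) = 0%E -> (P B <= P C)%E.
  move=> BC; apply: (@le_trans _ _ (P (C `|` (B `+` C)))).
    apply: le_measure; rewrite ?inE//; first exact: measurableU.
    by move=> x /= Bx; case: (pselect ((C : set X) x)) => Cx; tauto.
  by apply: (le_trans (measureU2 _ _ _)) => //; rewrite -[leRHS]adde0 -BC.
congr fine; apply/eqP; rewrite eq_le !H// ?repr_mclass//.
by rewrite setYC repr_mclass.
Qed.

Lemma MAlg_distE A B : MAlg_dist (mclass A) (mclass B) = fine (P (A `+` B)).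
Proof. by rewrite /MAlg_dist MAlgYE MAlg_muE. Qed.

Lemma MAlg_distxx x : MAlg_dist x x = 0.
Proof. by elim/mclass_ind: x => A; rewrite MAlg_distE setYK measure0. Qed.

Lemma MAlg_dist_eq0 x y : MAlg_dist x y = 0 -> x = y.
Proof.
elim/mclass_ind: x => A; elim/mclass_ind: y => B; rewrite MAlg_distE => AB.
by apply/mclassP; rewrite -[LHS]fineK ?fin_num_measure// AB.
Qed.

Lemma MAlg_dist_sym x y : MAlg_dist x y = MAlg_dist y x.
Proof. by elim/mclass_ind: x => A; elim/mclass_ind: y => B; rewrite !MAlg_distE setYC. Qed.

Lemma MAlg_dist_triangle y x z : MAlg_dist x z <= MAlg_dist x y + MAlg_dist y z.
Proof.
elim/mclass_ind: x => A; elim/mclass_ind: y => B; elim/mclass_ind: z => C.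
rewrite !MAlg_distE -fineD ?fin_num_measure// fine_le ?PY_triangle//.
- exact: fin_num_measure.
- by rewrite fin_numD !fin_num_measure.
Qed.

HB.instance Definition _ := isMetric.Build R MAlg
  MAlg_distxx MAlg_dist_eq0 MAlg_dist_sym MAlg_dist_triangle.

End MAlg.

Arguments MAlg0 {d X R P}.
Arguments MAlgT {d X R P}.

Section MAlg_iso.
Context d1 d2 (X : measurableType d1) (Y : measurableType d2) (R : realType).
Context (P : probability X R) (Q : probability Y R).

Record MAlg_iso (f : MAlg P -> MAlg Q) : Prop := MAlgIso {
  MAlg_iso_bij : bijective f;
  MAlg_iso_dist : forall x y, mdist (f x) (f y) = mdist x y;
  MAlg_iso0 : f MAlg0 = MAlg0;
  MAlg_isoT : f MAlgT = MAlgT;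
  MAlg_isoU : {morph f : x y / MAlgU x y};
  MAlg_isoI : {morph f : x y / MAlgI x y};
  MAlg_isoY : {morph f : x y / MAlgY x y};
  MAlg_iso_mu : forall x, MAlg_mu (f x) = MAlg_mu x }.

End MAlg_iso.

Lemma MAlg_iso_id d (X : measurableType d) (R : realType) (P : probability X R) :
  MAlg_iso (@id (MAlg P)).
Proof. by split=> //; exact: id_bij. Qed.

Lemma MAlg_iso_comp d1 d2 d3 (X : measurableType d1) (Y : measurableType d2)
    (Z : measurableType d3) (R : realType) (P : probability X R)
    (Q : probability Y R) (S : probability Z R)
    (f : MAlg Q -> MAlg S) (g : MAlg P -> MAlg Q) :
  MAlg_iso f -> MAlg_iso g -> MAlg_iso (f \o g).
Proof.
move=> [fb fd f0 fT fU fI fY fm] [gb gd g0 gT gU gI gY gm]; split => /=.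
- exact: bij_comp.
- by move=> x y; rewrite fd gd.
- by rewrite g0 f0.
- by rewrite gT fT.
- by move=> x y /=; rewrite gU fU.
- by move=> x y /=; rewrite gI fI.
- by move=> x y /=; rewrite gY fY.
- by move=> x; rewrite fm gm.
Qed.

Lemma MAlg_iso_inv d1 d2 (X : measurableType d1) (Y : measurableType d2)
    (R : realType) (P : probability X R) (Q : probability Y R)
    (f : MAlg P -> MAlg Q) (g : MAlg Q -> MAlg P) :
  MAlg_iso f -> cancel f g -> cancel g f -> MAlg_iso g.
Proof.
move=> [fb fd f0 fT fU fI fY fm] fK gK; split => /=.
- by exists f.
- by move=> x y; rewrite -fd !gK.
- by rewrite -f0 fK.
- by rewrite -fT fK.
- by move=> x y; rewrite -[in LHS](gK x) -[in LHS](gK y) -fU fK.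
- by move=> x y; rewrite -[in LHS](gK x) -[in LHS](gK y) -fI fK.
- by move=> x y; rewrite -[in LHS](gK x) -[in LHS](gK y) -fY fK.
- by move=> x; rewrite -fm gK.
Qed.

Section AutMAlg.
Context d (X : measurableType d) (R : realType) (P : probability X R).

Definition is_AutMAlg : set (Sym (MAlg P)) := [set f | MAlg_iso f].

Definition AutMAlg : Type := set_type is_AutMAlg.

Lemma AutMAlg_group_closed : group_closed (fun f => f \in is_AutMAlg).
Proof.
split=> [|f g /set_mem fP /set_mem gP]; apply: mem_set; first exact: MAlg_iso_id.
apply: MAlg_iso_comp => //.
by apply: (MAlg_iso_inv gP); [exact: Sym_invK|exact: Sym_invKV].
Qed.

HB.instance Definition _ := SubType.copy AutMAlg (set_type is_AutMAlg).
HB.instance Definition _ := [Choice of AutMAlg by <:].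
HB.instance Definition _ := SubChoice_isSubGroup.Build _ _ AutMAlg AutMAlg_group_closed.
(** [Sym (MAlg P)] carries pointwise convergence for the metric of [MAlg P];
    [AutMAlg] has the induced topology. *)
HB.instance Definition _ := Topological.copy AutMAlg (set_type is_AutMAlg).

Definition AutMAlg_fun (T : AutMAlg) : MAlg P -> MAlg P := val T.

End AutMAlg.

Coercion AutMAlg_fun : AutMAlg >-> Funclass.

(** * Free groups *)

Section free_group.
Variable A : choiceType.

(** The free group as reduced words in the letters [(a, false)], standing for
    the generator [a], and [(a, true)], standing for its inverse. *)
Definition letter : Type := (A * bool)%type.

HB.instance Definition _ := Choice.on letter.

Definition linv (l : letter) : letter := (l.1, ~~ l.2).

Definition reduced (w : seq letter) : bool := sorted (fun l m => m != linv l) w.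

Definition lcons (l : letter) (w : seq letter) : seq letter :=
  if w is m :: w' then if m == linv l then w' else l :: w else [:: l].

Definition wmul (u v : seq letter) : seq letter := foldr lcons v u.

Definition winv (u : seq letter) : seq letter := rev (map linv u).

Lemma linvK : involutive linv.
Proof. by case=> a b; rewrite /linv /= negbK. Qed.

Lemma lcons_reduced l w : reduced w -> reduced (lcons l w).
Proof.
case: w => [//|m w] /= mw; case: ifPn => [_|/= ->//].
by case: w mw => [//|n w] /= /andP[].
Qed.

Lemma wmul_reduced u v : reduced v -> reduced (wmul u v).
Proof. by move=> vr; elim: u => //= l u; exact: lcons_reduced. Qed.

Lemma winv_reduced u : reduced u -> reduced (winv u).
Proof.
rewrite /reduced /winv rev_sorted sorted_map; apply: sub_sorted => l m /=.
by apply: contra => /eqP ->; rewrite linvK.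
Qed.

Lemma lconsK l w : reduced w -> lcons l (lcons (linv l) w) = w.
Proof.
case: w => [_|m w] /=; first by rewrite eqxx.
rewrite linvK; case: eqVneq => [->|ml] mw; last by rewrite /= eqxx.
by case: w mw => [//|n w] /= /andP[/negPf ->].
Qed.

Lemma wmul_lcons l v w : reduced w -> wmul (lcons l v) w = lcons l (wmul v w).
Proof.
move=> wr; case: v => [//|m v] /=; case: eqP => [->|//].
by rewrite lconsK//; exact: wmul_reduced.
Qed.

Definition free_group : Type := {w : seq letter | reduced w}.

HB.instance Definition _ := SubType.copy free_group {w : seq letter | reduced w}.
HB.instance Definition _ := [Choice of free_group by <:].

Definition fg_one : free_group := Sub [::] isT.
Definition fg_mul (x y : free_group) : free_group :=
  Sub (wmul (val x) (val y)) (wmul_reduced (val x) (valP y)).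
Definition fg_inv (x : free_group) : free_group :=
  Sub (winv (val x)) (winv_reduced (valP x)).

Lemma fg_mulA : associative fg_mul.
Proof.
move=> [u ur] [v vr] [w wr]; apply: val_inj => /=.
by elim: u {ur} => //= l u ->; rewrite wmul_lcons.
Qed.

Lemma fg_mul1 : left_id fg_one fg_mul.
Proof. by move=> x; apply: val_inj. Qed.

Lemma fg_mulr1 : right_id fg_one fg_mul.
Proof.
move=> [u ur]; apply: val_inj => /=.
elim: u ur => //= l u IHu lur; rewrite IHu; last by case: u lur {IHu} => //= m u /andP[].
by case: u lur {IHu} => //= m u /andP[/negPf ->].
Qed.

Lemma fg_mulV : left_inverse fg_one fg_inv fg_mul.
Proof.
move=> [u ur]; apply: val_inj => /=.
elim: u {ur} => //= l u; rewrite /winv /= rev_cons /wmul foldr_rcons /=.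
by rewrite linvK eqxx.
Qed.

Lemma fg_invK : involutive fg_inv.
Proof.
move=> [u ur]; apply: val_inj; rewrite /= /winv map_rev revK -map_comp.
by rewrite map_id_in// => l _ /=; rewrite linvK.
Qed.

Lemma fg_mulrV : right_inverse fg_one fg_inv fg_mul.
Proof. by move=> x; rewrite -{1}(fg_invK x) fg_mulV. Qed.

HB.instance Definition _ :=
  isGroup.Build free_group fg_mulA fg_mul1 fg_mulr1 fg_mulV fg_mulrV.

Definition fg_gen (a : A) : free_group := Sub [:: (a, false)] isT.

End free_group.

Notation F2 := (free_group bool).
Definition F2a : F2 := fg_gen true.
Definition F2b : F2 := fg_gen false.

(** * The Bernoulli shift *)

Definition product_space (I : Type) (E : Type) : Type := I -> E.

Section product_space.
Context (I : Type) d (E : measurableType d).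

Definition cylinders : set (set (I -> E)) :=
  [set A | exists i B, measurable B /\ A = (fun x => x i) @^-1` B].

HB.instance Definition _ := Measurable.copy (product_space I E)
  (@g_sigma_algebraType (I -> E) cylinders).

End product_space.

(** [mu] is the product of copies of [P]: its value on every box with finitely
    many constrained coordinates is the product of the values of [P]. Boxes form
    a pi-system generating the sigma-algebra, so this determines [mu]. *)
Definition product_measure (I : choiceType) d (E : measurableType d) (R : realType)
    (P : probability E R) (mu : probability (product_space I E) R) : Prop :=
  forall (J : seq I) (B : I -> set E), uniq J -> (forall i, measurable (B i)) ->
    mu [set x | forall i, i \in J -> B i (x i)] = (\prod_(i <- J) P (B i))%E.

Section bernoulli_shift.
Context (G : groupType).

Notation X := (product_space (nat * G)%type bool).

Definition bshift (g : G) (x : X) : X := fun p => x (p.1, g^-1 * p.2)%g.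

Lemma bshiftK g : cancel (bshift g) (bshift g^-1).
Proof. by move=> x; apply/funext=> -[n h]; rewrite /bshift /= invgK mulKg. Qed.

Lemma bshiftVK g : cancel (bshift g^-1) (bshift g).
Proof. by move=> x; rewrite -{1}(invgK g) bshiftK. Qed.

Lemma measurable_bshift g : measurable_fun setT (bshift g : X -> X).
Proof.
apply: measurability => //.
move=> _ [_ [[n h] [B [mB ->]] <-]].
rewrite setTI; apply: sub_sigma_algebra.
by exists (n, g^-1 * h)%g, B.
Qed.

Lemma bshift_imageE g (A : set X) : bshift g @` A = bshift g^-1 @^-1` A.
Proof.
apply/seteqP; split=> [_ [x Ax <-]|x Ax] /=; first by rewrite bshiftK.
by exists (bshift g^-1 x) => //; rewrite bshiftVK.
Qed.

Lemma measurable_bshift_image g (A : mset X) : measurable (bshift g @` A).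
Proof.
by rewrite bshift_imageE -[X in measurable X]setTI; exact: measurable_bshift.
Qed.

Definition bshift_mset (g : G) (A : mset X) : mset X :=
  mset_of (measurable_bshift_image g A).

End bernoulli_shift.

(** * Lebesgue measure on the unit interval *)

Section lebesgue01.
Variable R : realType.

Definition I01 : Type := set_type (`[0, 1] : set R).

HB.instance Definition _ := Choice.on I01.

Lemma I01_0 : (0 : R) \in (`[0, 1]%classic : set R).
Proof. by rewrite inE /= in_itv /= lexx ler01. Qed.

HB.instance Definition _ := isPointed.Build I01 (SigSub I01_0 : I01).

Definition I01_val (x : I01) : R := val x.

HB.instance Definition _ := Measurable.copy I01
  (g_sigma_algebra_preimageType (I01_val : I01 -> measurableTypeR R)).

Definition lebesgue01 (A : set I01) : \bar R := lebesgue_measure (I01_val @` A).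

Lemma I01_val_inj : injective I01_val. Proof. exact: val_inj. Qed.

Lemma measurable_I01_image (A : set I01) :
  measurable A -> measurable (I01_val @` A : set (measurableTypeR R)).
Proof.
move=> [B mB <-]; rewrite setTI.
suff -> : I01_val @` (I01_val @^-1` B) = B `&` `[0, 1] by exact: measurableI.
apply/seteqP; split=> [_ [x Bx <-]|x [Bx x01]].
  by split=> //; exact: set_mem (valP x).
by exists (SigSub (mem_set x01) : I01).
Qed.

Let lebesgue01_0 : lebesgue01 set0 = 0%E.
Proof. by rewrite /lebesgue01 image_set0 measure0. Qed.

Let lebesgue01_ge0 A : (0 <= lebesgue01 A)%E.
Proof. exact: measure_ge0. Qed.

Let lebesgue01_sigma_additive : semi_sigma_additive lebesgue01.
Proof.
move=> F mF tF mU; rewrite /lebesgue01 image_bigcup.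
apply: measure_semi_sigma_additive.
- by move=> n; exact: measurable_I01_image.
- move=> i j _ _ [_ [[x Fx <-] [y Fy /I01_val_inj yx]]].
  by apply: tF => //; exists x; split=> //; rewrite -yx.
- by apply: bigcup_measurable => n _; exact: measurable_I01_image.
Qed.

HB.instance Definition _ := isMeasure.Build _ _ _ lebesgue01
  lebesgue01_0 lebesgue01_ge0 lebesgue01_sigma_additive.

Let lebesgue01_setT : lebesgue01 setT = 1%E.
Proof.
rewrite /lebesgue01; have -> : I01_val @` setT = `[0, 1]%classic.
  apply/seteqP; split=> [_ [x _ <-]|x x01]; first exact: set_mem (valP x).
  by exists (SigSub (mem_set x01) : I01).
by rewrite lebesgue_measure_itv /= lte_fin ltr01 oppr0 adde0.
Qed.

HB.instance Definition _ :=
  @Measure_isProbability.Build _ _ _ lebesgue01 lebesgue01_setT.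

End lebesgue01.

(** * Real Hilbert spaces *)

HB.mixin Record NormedModule_hasInner (R : realType) H of NormedModule R H := {
  inner : {dot H for idfun};
  innerxx : forall x : H, inner x x = `|x| ^+ 2
}.

#[short(type="hilbertType")]
HB.structure Definition Hilbert (R : realType) :=
  {H of NormedModule_hasInner R H & CompleteNormedModule R H}.

Section OrthogonalGroup.
Context (R : realType) (H : hilbertType R).

Definition is_orthogonal_map : set (Sym H) :=
  [set u | linear u /\ forall x y, inner (u x) (u y) = inner x y :> R].

Definition orthogonal_group : Type := set_type is_orthogonal_map.

Lemma orthogonal_group_closed : group_closed (fun f => f \in is_orthogonal_map).
Proof.
split=> [|f g /set_mem [fl fi] /set_mem [gl gi]]; apply: mem_set; first by [].
have gK := Sym_invKV g; have Kg := Sym_invK g.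
split=> [a x y|x y] /=.
  by rewrite -fl; congr (Sym_fun f _); rewrite -[in LHS](gK x) -[in LHS](gK y) -gl Kg.
by rewrite fi -gi !gK.
Qed.

HB.instance Definition _ := SubType.copy orthogonal_group (set_type is_orthogonal_map).
HB.instance Definition _ := [Choice of orthogonal_group by <:].
HB.instance Definition _ :=
  SubChoice_isSubGroup.Build _ _ orthogonal_group orthogonal_group_closed.
HB.instance Definition _ :=
  Topological.copy orthogonal_group (set_type is_orthogonal_map).

Definition orthogonal_fun (u : orthogonal_group) : H -> H := val u.

End OrthogonalGroup.

Coercion orthogonal_fun : orthogonal_group >-> Funclass.

(** * Square-summable functions on a discrete group *)

(** [G] with the sigma-algebra of all its subsets. *)
Definition discrete (G : Type) : Type := G.

Section discrete.
Variable G : groupType.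

HB.instance Definition _ := Choice.copy (discrete G) G.
HB.instance Definition _ := isPointed.Build (discrete G) (1%g : G).
HB.instance Definition _ :=
  @isMeasurable.Build default_measure_display (discrete G)
    (@discrete_measurable _) discrete_measurable0 discrete_measurableC
    discrete_measurableU.

End discrete.

Section l2.
Context (R : realType) (G : groupType).

(** [l2 R G] consists of functions, not of classes of functions: the counting
    measure has no nonempty null set. *)
Definition l2 : Type :=
  LfunType (@counting (discrete G) R) (@lee1n _ 2 : (1 <= 2%:R%:E :> \bar R)%E).

HB.instance Definition _ :=
  GRing.Lmodule.copy l2 (LfunType (@counting (discrete G) R) (@lee1n _ 2)).

Definition l2_fun (f : l2) : G -> R := f.

Definition l2_norm (f : l2) : R := fine ('N[counting]_2%:R%:E [EFin \o f]).

Definition l2_inner (f g : l2) : R :=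
  \int[@counting (discrete G) R]_x (f x * g x).

Lemma measurable_discrete (A : set (discrete G)) : measurable A.
Proof. by []. Qed.

Lemma measurable_fun_discrete d (T : sigmaRingType d) (D : set (discrete G))
  (f : discrete G -> T) : measurable_fun D f.
Proof. by []. Qed.

Lemma l2_mul_integrable (f g : l2) :
  (@counting (discrete G) R).-integrable setT (EFin \o (fun x => f x * g x)).
Proof. by apply/Lfun1_integrable/Lfun2_mul_Lfun1; exact: LfunP. Qed.

Lemma l2_innerC f g : l2_inner f g = l2_inner g f.
Proof. by apply: eq_Rintegral => x _; rewrite mulrC. Qed.

Lemma l2_inner_linear g : scalar (l2_inner ^~ g).
Proof.
move=> a f h; rewrite /l2_inner.
rewrite (@eq_Rintegral _ _ _ _ _ (fun x => a * (f x * g x) + h x * g x)); last first.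
  by move=> x _; rewrite mulrA -mulrDl.
rewrite RintegralD//; last 2 first.
- by have := l2_mul_integrable (a *: f) g; congr (integrable _ _ _); apply/funext=> x /=; rewrite -mulrA.
- exact: l2_mul_integrable.
by rewrite RintegralZl//; exact: l2_mul_integrable.
Qed.

Lemma l2_norm_ge0 f : 0 <= l2_norm f.
Proof. by rewrite fine_ge0// Lnorm_ge0. Qed.

Lemma l2_norm_sqrE f :
  ((l2_norm f ^+ 2)%:E = \int[@counting (discrete G) R]_x (f x ^+ 2)%:E)%E.
Proof.
rewrite -powR_mulrn ?l2_norm_ge0// -poweR_EFin /l2_norm (finite_norm_fine f).
rewrite poweR_Lnorm ?pnatr_eq0//; apply: eq_integral => x _.
rewrite -[LHS]/((`|f x| `^ 2)%:E) powR_mulrn; [|exact: normr_ge0].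
by rewrite real_normK; [|exact: num_real].
Qed.

Lemma l2_innerxx f : l2_inner f f = l2_norm f ^+ 2.
Proof.
rewrite /l2_inner /Rintegral -[RHS]/(fine (l2_norm f ^+ 2)%:E) l2_norm_sqrE.
by congr fine; apply: eq_integral => x _; rewrite expr2.
Qed.

Lemma l2_normD f g : l2_norm (f + g) <= l2_norm f + l2_norm g.
Proof. exact: ler_LnormD. Qed.

Lemma l2_normZ a f : l2_norm (a *: f) = `|a| * l2_norm f.
Proof.
apply: EFin_inj; rewrite EFinM /l2_norm (finite_norm_fine (a *: f : LfunType _ _)).
by rewrite (finite_norm_fine f) -LnormZ; apply: eq_Lnorm.
Qed.

Lemma l2_val_le (f : l2) (x : G) : `|f x| <= l2_norm f.
Proof.
rewrite -(@ler_pXn2r _ 2)// ?nnegrE ?l2_norm_ge0// -lee_fin l2_norm_sqrE.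
apply: (@le_trans _ _ (\int[@counting (discrete G) R]_(y in [set x : discrete G]) (f y ^+ 2)%:E)%E).
  rewrite (@eq_integral _ _ _ _ _ (cst (f x ^+ 2)%:E)); last first.
    by move=> y; rewrite inE => ->.
  have c1 : @counting (discrete G) R [set x : discrete G] = 1%E.
    rewrite /counting asboolT; last exact: finite_set1.
    by rewrite fset_set1 finmap.cardfs1.
  rewrite integral_cst; [|exact: measurable_discrete].
  rewrite [X in (_ <= _ * X)%E]c1 mule1.
  by rewrite real_normK; [|exact: num_real].
apply: ge0_subset_integral => //= y _; by rewrite lee_fin sqr_ge0.
Qed.

Lemma l2_norm_eq0 f : l2_norm f = 0 -> f = 0.
Proof.
move=> f0; apply/LfuneqP => x; apply/eqP.
by rewrite -normr_le0 (le_trans (l2_val_le f x))// f0.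
Qed.

HB.instance Definition _ := @Lmodule_isNormed.Build R l2 l2_norm l2_normD l2_normZ l2_norm_eq0.

Lemma l2_bounded_lim (u : nat -> l2) (l : G -> R) (g : l2) (m : nat) (c : R) :
  0 <= c -> (forall n, (m <= n)%N -> l2_norm (g - u n) <= c) ->
  (forall x, u n x @[n --> \oo] --> l x) ->
  (\int[@counting (discrete G) R]_x ((g x - l x) ^+ 2)%:E <= (c ^+ 2)%:E)%E.
Proof.
move=> c0 guc ul.
pose h n (x : discrete G) : \bar R := ((g x - u n x) ^+ 2)%:E.
have h0 n x : setT x -> (0 <= h n x)%E by move=> _; rewrite lee_fin sqr_ge0.
have := @fatou _ (discrete G) R (@counting (discrete G) R) setT measurableT h.
move=> /(_ (fun=> measurable_fun_discrete _) h0).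
rewrite (@eq_integral _ _ _ _ setT (fun x => ((g x - l x) ^+ 2)%:E)); last first.
  move=> x _; apply: (@cvg_limn_einf_sup _ _ _ _).1.
  apply: cvg_EFin; first exact: nearW.
  rewrite [X in X @ _ --> _](_ : _ = (fun n => (g x - u n x) ^+ 2)); last exact/funext.
  by apply: cvgM; apply: cvgB => //; exact: cvg_cst.
move=> /le_trans; apply; rewrite limn_einf_lim; apply: lime_le; first exact: is_cvg_einfs.
near=> n; apply: ge_ereal_inf; exists (\int[@counting (discrete G) R]_x h (maxn n m) x)%E.
  by exists (maxn n m) => //=; exact: leq_maxl.
have -> : (\int[@counting (discrete G) R]_x h (maxn n m) x = (l2_norm (g - u (maxn n m)) ^+ 2)%:E)%E.
  by rewrite l2_norm_sqrE.
rewrite lee_fin ler_pXn2r// ?nnegrE ?l2_norm_ge0//.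
by apply: guc; exact: leq_maxr.
Unshelve. all: by end_near. Qed.

Lemma l2_of_bounded (h : G -> R) (c : R) :
  (\int[@counting (discrete G) R]_x (h x ^+ 2)%:E <= (c ^+ 2)%:E)%E -> 0 <= c ->
  exists2 k : l2, l2_fun k =1 h & l2_norm k <= c.
Proof.
move=> hc c0.
have hN : ('N[@counting (discrete G) R]_2%:R%:E [EFin \o h] <= c%:E)%E.
  have -> : c%:E = ((c ^+ 2)%:E `^ 2^-1)%E.
    by rewrite poweR_EFin powR12_sqrt ?sqr_ge0// sqrtr_sqr ger0_norm.
  rewrite unlock gt0_ler_poweR ?invr_ge0//.
  - by rewrite in_itv /= leey andbT integral_ge0// => x _; rewrite poweR_ge0.
  - by rewrite in_itv /= leey andbT lee_fin sqr_ge0.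
  apply: le_trans hc; rewrite le_eqVlt; apply/orP; left; apply/eqP.
  apply: eq_integral => x _.
  rewrite -[LHS]/((`|h x| `^ 2)%:E) powR_mulrn; [|exact: normr_ge0].
  by rewrite real_normK; [|exact: num_real].
have hL : (h : discrete G -> R) \in Lfun (@counting (discrete G) R) 2%:R%:E.
  rewrite inE; apply/andP; split; rewrite inE; first exact: measurable_fun_discrete.
  by rewrite /= /finite_norm (le_lt_trans hN)// ltry.
exists (Lfun_Sub _ hL) => //.
rewrite -lee_fin /l2_norm (finite_norm_fine (Lfun_Sub _ hL)); exact: hN.
Qed.

Lemma l2_complete (F : set_system l2) : ProperFilter F -> cauchy F -> cvg F.
Proof.
move=> FF /cauchyP Fc.
have /choice[a Fa] : forall n, exists b : l2, F (ball b (n.+1%:R^-1 : R)).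
  by move=> n; apply: Fc; rewrite invr_gt0.
pose e n : R := n.+1%:R^-1.
have e0 n : 0 < e n by rewrite invr_gt0.
have aa n m : l2_norm (a n - a m) <= e n + e m.
  have [g []] := @filter_ex _ F FF _ (filterI (Fa n) (Fa m)).
  rewrite -!ball_normE /ball_ /= => ag1 ag2.
  have -> : a n - a m = (a n - g) - (a m - g) by rewrite opprB addrA subrK.
  exact: (le_trans (ler_normB _ _ : `|(_ : l2)| <= _) (lerD (ltW ag1) (ltW ag2))).
have le_e n m : (m <= n)%N -> e n <= e m.
  by move=> mn; rewrite lef_pV2 ?posrE// ler_nat ltnS.
have ax x : cvgn (fun n => a n x).
  apply/cauchy_cvgP/cauchy_exP => eps eps0.
  have [N _ eN] := near_infty_natSinv_lt (PosNum (divr_gt0 eps0 (@ltr0Sn R 1))).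
  exists (a N x); exists N => // n /= Nn.
  have := l2_val_le (a N - a n) x.
  rewrite -ball_normE /ball_ /= => /le_lt_trans; apply.
  apply: (le_lt_trans (aa N n)); rewrite [ltRHS]splitr ltrD//; [exact: (eN N (leqnn N))|exact: (eN n Nn)].
pose l x := lim ((fun n => a n x) @ \oo).
have kP m : exists2 k : l2, l2_fun k =1 (fun x => a m x - l x) & l2_norm k <= e m *+ 2.
  apply: l2_of_bounded; last by rewrite mulrn_wge0// ltW.
  apply: (@l2_bounded_lim a l (a m) m) => [|n mn|x]; last exact: ax.
  - by rewrite mulrn_wge0// ltW.
  - by rewrite (le_trans (aa m n))// mulr2n lerD2l le_e.
have [k kE _] := kP 0%N.
pose L : l2 := a 0%N - k.
have LE x : L x = l x.
  by rewrite -[LHS]/(a 0%N x - l2_fun k x) kE opprB addrC subrK.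
apply/cvg_ex; exists L; apply/cvg_ballP => eps eps0.
have [N _ eN] := near_infty_natSinv_lt (PosNum (divr_gt0 eps0 (@ltr0Sn R 2))).
apply: filterS (Fa N) => g; rewrite -!ball_normE /ball_ /= => aNg.
have LaN : `|L - a N| <= e N *+ 2.
  have [kN kNE] := kP N; rewrite distrC; have -> // : a N - L = kN.
  by apply/LfuneqP => x; rewrite -[LHS]/(a N x - L x) LE -kNE.
have -> : L - g = (L - a N) + (a N - g) by rewrite addrA subrK.
apply: (le_lt_trans (ler_normD _ _)).
have /= := eN N (leqnn N); rewrite ltr_pdivlMr// => eNeps.
apply: lt_trans eNeps; rewrite mulr_natr mulrSr.
exact: ler_ltD.
Qed.

HB.instance Definition _ := Uniform_isComplete.Build l2 l2_complete.

Lemma l2_inner_bilinear :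
  bilinear_for ( *%R : GRing.Scale.law R R) ( *%R : GRing.Scale.law R R) l2_inner.
Proof.
split=> u; first exact: l2_inner_linear.
by move=> a f h; rewrite !(l2_innerC u) l2_inner_linear.
Qed.

HB.instance Definition _ := bilinear_isBilinear.Build R l2 l2 R
  *%R (idfun \; *%R) l2_inner l2_inner_bilinear.

Lemma l2_inner_hermitian f g : l2_inner f g = (-1) ^+ false * idfun (l2_inner g f).
Proof. by rewrite mul1r l2_innerC. Qed.

HB.instance Definition _ := isHermitianSesquilinear.Build R l2 false idfun l2_inner
  l2_inner_hermitian.

Lemma l2_inner_gt0 f : f != 0 -> 0 < l2_inner f f.
Proof.
move=> f0; rewrite l2_innerxx exprn_gt0// lt_neqAle l2_norm_ge0 andbT eq_sym.
by apply: contra f0 => /eqP/l2_norm_eq0 ->.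
Qed.

HB.instance Definition _ := isDotProduct.Build R l2 l2_inner l2_inner_gt0.

HB.instance Definition _ := NormedModule_hasInner.Build R l2 l2_innerxx.

End l2.

Section regular_representation.
Context (R : realType) (G : groupType).

Let mulVg_discrete (g : G) : discrete G -> discrete G := fun x => (g^-1 * x)%g.

Lemma counting_translate (g : G) (A : set (discrete G)) :
  @counting (discrete G) R (mulVg_discrete g @^-1` A) = counting A.
Proof.
have -> : mulVg_discrete g @^-1` A = (fun x => (g * x)%g : discrete G) @` A.
  apply/seteqP; split=> [x Ax|_ [x Ax <-]] /=; last by rewrite /mulVg_discrete mulKg.
  by exists (mulVg_discrete g x) => //; rewrite /mulVg_discrete mulgA mulgV mul1g.
have ginj : injective (fun x => (g * x)%g : discrete G) by exact: mulgI.
have [fA|nfA] := pselect (finite_set A); last first.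
  rewrite /counting !asboolF// => /(finite_image (mulVg_discrete g)).
  rewrite image_comp (_ : _ \o _ = id) ?image_id//.
  by apply/funext => x /=; rewrite /mulVg_discrete mulKg.
rewrite /counting !asboolT//; last exact: finite_image.
congr (_%:R%:E); rewrite fset_set_image//; exact: finmap.card_imfset.
Qed.

Lemma ge0_integral_translate (g : G) (h : discrete G -> \bar R) :
  (forall x, 0 <= h x)%E ->
  (\int[@counting (discrete G) R]_x h (mulVg_discrete g x) =
   \int[@counting (discrete G) R]_x h x)%E.
Proof.
move=> h0.
have mphi : measurable_fun [set: discrete G] (mulVg_discrete g) by [].
rewrite -[LHS]/(\int[_]_(x in mulVg_discrete g @^-1` setT) (h \o mulVg_discrete g) x)%E.
rewrite -(@ge0_integral_pushforward _ _ (discrete G) (discrete G) R _ mphi)//.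
apply: eq_measure_integral => A _ _; exact: counting_translate.
Qed.

Lemma integral_translate (g : G) (h : discrete G -> \bar R) :
  (\int[@counting (discrete G) R]_x h (mulVg_discrete g x) =
   \int[@counting (discrete G) R]_x h x)%E.
Proof.
rewrite [LHS]integralE [RHS]integralE.
rewrite (funepos_comp h (mulVg_discrete g)) (funeneg_comp h (mulVg_discrete g)).
congr (_ - _)%E.
  have := @ge0_integral_translate g (h^\+)%E (@funepos_ge0 _ _ h). exact.
have := @ge0_integral_translate g (h^\-)%E (@funeneg_ge0 _ _ h). exact.
Qed.

Lemma translate_l2 (g : G) (f : l2 R G) :
  exists k : l2 R G, l2_fun k = (fun x => l2_fun f (g^-1 * x)%g).
Proof.
have [|k /funext kE _] := @l2_of_bounded R G (fun x => l2_fun f (g^-1 * x)%g)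
  (l2_norm f) _ (l2_norm_ge0 f); last by exists k.
have := ge0_integral_translate g (h := fun x => (f x ^+ 2)%:E).
by rewrite l2_norm_sqrE => -> // x; rewrite lee_fin sqr_ge0.
Qed.

Definition translate (g : G) (f : l2 R G) : l2 R G := projT1 (cid (translate_l2 g f)).

Lemma translateE g f x : l2_fun (translate g f) x = l2_fun f (g^-1 * x)%g.
Proof. by rewrite /translate; case: cid => k /= ->. Qed.

Lemma l2P (f h : l2 R G) : l2_fun f =1 l2_fun h -> f = h.
Proof. by move=> fh; apply/LfuneqP. Qed.

Lemma translateM g h f : translate (g * h)%g f = translate g (translate h f).
Proof. by apply: l2P => x; rewrite !translateE invgM mulgA. Qed.

Lemma translate1 f : translate 1%g f = f.
Proof. by apply: l2P => x; rewrite translateE invg1 mul1g. Qed.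

Lemma translate_bij g : bijective (translate g).
Proof.
by exists (translate g^-1%g) => f; rewrite -translateM ?mulVg ?mulgV translate1.
Qed.

Lemma translate_orthogonal g : is_orthogonal_map (Sym_of (translate_bij g)).
Proof.
split=> [a f h|f h]; rewrite !Sym_ofE.
  by apply: l2P => x; rewrite -[RHS]/(a * l2_fun (translate g f) x + l2_fun (translate g h) x) !translateE.
congr fine; rewrite -[RHS](integral_translate g).
apply: eq_integral => x _ /=.
by rewrite -[X in (X * _)%:E]/(l2_fun (translate g f) x) -[X in (_ * X)%:E]/(l2_fun (translate g h) x) !translateE.
Qed.

Definition regular_rep (g : G) : orthogonal_group (l2 R G) :=
  SigSub (mem_set (translate_orthogonal g)).

Lemma regular_repE g f x : l2_fun (regular_rep g f) x = l2_fun f (g^-1 * x)%g.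
Proof. exact: translateE. Qed.

Lemma regular_repM : {morph regular_rep : g h / (g * h)%g >-> (g * h)%g}.
Proof. by move=> g h; apply/val_inj/SymP => f; exact: translateM. Qed.

HB.instance Definition _ :=
  isMultiplicative.Build G (orthogonal_group (l2 R G)) regular_rep regular_repM.

End regular_representation.

(** * Tensor products and multiples of a representation *)

Section multiples.
Context (R : realType).

(** [t] presents [T] as the Hilbert space tensor product of [L] and [K], i.e. as
    the completion of the algebraic tensor product for the inner product
    [<x (x) k, x' (x) k'> = <x, x'> <k, k'>]. *)
Definition hilbert_tensor (L K T : hilbertType R) (t : {bilinear L -> K -> T}) : Prop :=
  (forall x x' k k', inner (t x k) (t x' k') = inner x x' * inner k k' :> R) /\
  closure [set y | exists (n : nat) (x : 'I_n -> L) (k : 'I_n -> K),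
                     y = \sum_i t (x i) (k i)] = setT.

(** [rT] is the representation [rL (x) rK] on the tensor product [T]. *)
Definition is_tensor_rep (G : groupType) (L K T : hilbertType R)
    (t : {bilinear L -> K -> T})
    (rL : G -> orthogonal_group L) (rK : G -> orthogonal_group K)
    (rT : G -> orthogonal_group T) : Prop :=
  forall g x k, rT g (t x k) = t (rL g x) (rK g k).

Definition rep_equiv (G : groupType) (H H' : hilbertType R)
    (r : G -> orthogonal_group H) (r' : G -> orthogonal_group H') : Prop :=
  exists u : {linear H -> H'}, [/\ bijective u,
    forall x y, inner (u x) (u y) = inner x y :> R &
    forall g x, u (r g x) = r' g (u x)].

Definition trivial_rep (G : groupType) (K : hilbertType R) (g : G) : orthogonal_group K := 1%g.

Definition is_multiple_of (G : groupType) (H L : hilbertType R)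
    (r : G -> orthogonal_group H) (l : G -> orthogonal_group L) : Prop :=
  exists (K T : hilbertType R) (t : {bilinear L -> K -> T}) (s : G -> orthogonal_group T),
    [/\ hilbert_tensor t, is_tensor_rep t l (@trivial_rep G K) s & rep_equiv r s].

End multiples.

Section statement.
Context (R : realType).

Definition invariant_vector (G : groupType) (H : hilbertType R)
    (r : G -> orthogonal_group H) (xi : H) : Prop :=
  xi != 0 /\ forall g, r g xi = xi.

(** Through the isomorphism [Phi], the automorphism [T] is the action of [g] by
    the Bernoulli shift on the measure algebra of [mu]. *)
Definition corresponds_to_shift (G : groupType)
    (mu : probability (product_space (nat * G) bool) R)
    d (Y : measurableType d) (Q : probability Y R)
    (Phi : MAlg mu -> MAlg Q) (g : G) (T : AutMAlg Q) : Prop :=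
  forall A : mset (product_space (nat * G) bool),
    T (Phi (mclass mu A)) = Phi (mclass mu (bshift_mset g A)).

(** The canonical morphism from the free group on two letters is an isomorphism
    onto the subgroup generated by [x] and [y]. *)
Definition freely_generate (G : groupType) (x y : G) : Prop :=
  exists theta : {multiplicative F2 -> G},
    [/\ theta F2a = x, theta F2b = y & injective theta].

End statement.

(* Main.v *)
Require Import Defs.
From HB Require Import structures.
From mathcomp Require Import all_boot all_order all_algebra perm.
From mathcomp Require Import all_classical all_reals all_analysis.
From mathcomp Require Import ring lra.
Import Order.TTheory GRing.Theory Num.Theory.
Import numFieldNormedType.Exports.

(** Through [Phi], [pi] becomes a representation of the automorphism group of
    [{0,1}^I] with [I = N x F2], and [T1], [T2] become permutations of the
    coordinates.  Restrict it to [Sym I].  A [Sym I]-invariant vector is invariant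
    under the automorphisms that only touch finitely many coordinates (conjugate them
    by permutations moving these coordinates to infinity, which makes them tend to
    the identity), and these are dense, so there is no such vector but 0.

    For finite [S], let [H_S] be the vectors fixed by the pointwise stabilizer of
    [S].  A vector of [H_S] orthogonal to [H_(S `&` T)] is orthogonal to [H_T], its
    translates by permutations moving [S `\` T] to disjoint places being orthogonal.
    Hence the [H'_S = H_S `&` (sum of the H_T, T proper in S)^perp] are pairwise
    orthogonal; they span a dense subspace by continuity.  The free group, being torsion-free,
    acts freely on the nonempty finite subsets of [I], so the [H'_S], for [S] in a
    set of representatives of the orbits, span a subspace [K] whose translates
    are pairwise orthogonal with dense sum, and [H] is [l2 (x) K]. *)

(** The stabilizers in [Sym I] are not compact, so fixed vectors cannot be obtained by averaging
    over them. They arise instead as the points of least norm of closed convex sets that the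
    stabilizer preserves, which only needs the parallelogram identity.

    The obstacle in the density of finitary automorphisms is one of counting. The image under [T] of
    a cube is only close to a union of smaller cubes, and their number may be wrong, so that no
    permutation of the small cubes realizes these unions exactly. It is enough that the permuted
    cubes and the wanted unions be nested: the distance of nested sets is the difference of their
    measures, which automorphisms preserve.

    The vectors fixed by the stabilizer of the empty set are the invariant vectors. Their absence
    removes the only finite set on which no group acts freely.

    The tensor product is realized on [H] itself: [f (x) k] is the sum of the [f g *: r g k], so
    that the equivalence to be exhibited is the identity. *)

Local Notation mset := Defs.mset.
Local Notation Sym := Defs.Sym.
Set Implicit Arguments.
Unset Strict Implicit.
Unset Printing Implicit Defensive.

Local Open Scope classical_set_scope.
Local Open Scope ring_scope.

(** * Real Hilbert spaces *)

Section hilbert.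
Context (R : realType) (H : hilbertType R).
Implicit Types x y z : H.

Definition ip x y : R := inner x y.

Lemma ipDl x y z : ip (x + y) z = ip x z + ip y z.
Proof. by rewrite /ip linearDl. Qed.

Lemma ipDr x y z : ip x (y + z) = ip x y + ip x z.
Proof. by rewrite /ip linearD. Qed.

Lemma ipZl (a : R) x y : ip (a *: x) y = a * ip x y.
Proof. by rewrite /ip linearZl_LR. Qed.

Lemma ipZr (a : R) x y : ip x (a *: y) = a * ip x y.
Proof. by rewrite /ip linearZ. Qed.

Lemma ipC x y : ip x y = ip y x.
Proof. by rewrite /ip hermC /= mul1r. Qed.

Lemma ipNl x y : ip (- x) y = - ip x y.
Proof. by rewrite -scaleN1r ipZl mulN1r. Qed.

Lemma ipNr x y : ip x (- y) = - ip x y.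
Proof. by rewrite ipC ipNl ipC. Qed.

Lemma ipBl x y z : ip (x - y) z = ip x z - ip y z.
Proof. by rewrite ipDl ipNl. Qed.

Lemma ipBr x y z : ip x (y - z) = ip x y - ip x z.
Proof. by rewrite ipDr ipNr. Qed.

Lemma ip0l y : ip 0 y = 0.
Proof. by rewrite -(scale0r y) ipZl mul0r. Qed.

Lemma ip0r y : ip y 0 = 0.
Proof. by rewrite ipC ip0l. Qed.

Lemma ip_suml I (r : seq I) P (F : I -> H) y :
  ip (\sum_(i <- r | P i) F i) y = \sum_(i <- r | P i) ip (F i) y.
Proof.
apply: (big_morph (fun x => ip x y)) => [u v|]; [exact: ipDl|exact: ip0l].
Qed.

Lemma ip_sumr I (r : seq I) P (F : I -> H) y :
  ip y (\sum_(i <- r | P i) F i) = \sum_(i <- r | P i) ip y (F i).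
Proof. by rewrite ipC ip_suml; apply: eq_bigr => i _; rewrite ipC. Qed.

Lemma ipxx x : ip x x = `|x| ^+ 2.
Proof. exact: innerxx. Qed.

Lemma ip_ge0 x : 0 <= ip x x.
Proof. by rewrite ipxx sqr_ge0. Qed.

Lemma ip_eq0 x : ip x x = 0 -> x = 0.
Proof. by rewrite ipxx => /eqP; rewrite sqrf_eq0 normr_eq0 => /eqP. Qed.

Lemma ip_ext x y : (forall z, ip x z = ip y z) -> x = y.
Proof.
move=> xy; apply/eqP; rewrite -subr_eq0; apply/eqP/ip_eq0.
by rewrite ipBl xy subrr.
Qed.

Lemma cauchy_schwarz x y : `|ip x y| <= `|x| * `|y|.
Proof.
have [->|y0] := eqVneq y 0; first by rewrite ip0r normr0 normr0 mulr0.
have yy : 0 < ip y y by rewrite ipxx exprn_gt0// normr_gt0.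
rewrite -(@ler_pXn2r _ 2)// ?nnegrE ?mulr_ge0// exprMn -!ipxx real_normK ?num_real//.
have := ip_ge0 (ip y y *: x - ip x y *: y).
rewrite !(ipBl, ipBr, ipZl, ipZr) (ipC y x) => h.
suff : 0 <= ip y y * (ip x x * ip y y - ip x y ^+ 2) by rewrite pmulr_rge0// subr_ge0.
by move: h; congr (_ <= _); ring.
Qed.

Lemma parallelogram x y :
  `|x + y| ^+ 2 + `|x - y| ^+ 2 = 2 * (`|x| ^+ 2 + `|y| ^+ 2).
Proof. by rewrite -!ipxx !(ipBl, ipBr, ipDl, ipDr); ring. Qed.

Lemma ip_continuous y : continuous (ip ^~ y).
Proof.
move=> x; apply/cvgrPdist_lt => e e0.
have K : 0 < `|y| + 1 by rewrite ltr_wpDl.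
near=> z; rewrite -ipBl.
apply: (le_lt_trans (cauchy_schwarz _ _)).
apply: (@le_lt_trans _ _ (`|x - z| * (`|y| + 1))); first by rewrite ler_wpM2l// lerDl.
rewrite -ltr_pdivlMr//; near: z.
by apply: cvgr_dist_lt => //; exact: divr_gt0.
Unshelve. all: by end_near. Qed.

Lemma cauchy_seq_cvg (u : nat -> H) (e : nat -> R) :
  (forall eps, 0 < eps -> exists N, forall n, (N <= n)%N -> e n <= eps) ->
  (forall n m, (n <= m)%N -> `|u n - u m| <= e n) -> cvgn u.
Proof.
move=> e_small u_e; apply/cauchy_cvgP/cauchy_exP => eps eps0.
have [N eN] := e_small (eps / 2) (divr_gt0 eps0 (ltr0Sn R 1)).
exists (u N); exists N => // n /= Nn; rewrite -ball_normE /ball_ /=.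
apply: (le_lt_trans (u_e _ _ Nn)); apply: (le_lt_trans (eN _ (leqnn _))).
by rewrite ltr_pdivrMr// ltr_pMr// ltr1n.
Qed.

Lemma closed_seq (C : set H) (u : nat -> H) l :
  closed C -> (forall n, C (u n)) -> u @ \oo --> l -> C l.
Proof.
move=> Ccl Cu ul; apply: (@closed_cvg _ _ \oo _ u C Ccl _ l ul).
exact: nearW.
Qed.

Lemma inv_small (c : R) : forall eps, 0 < eps ->
  exists N, forall n, (N <= n)%N -> Num.sqrt (c / n.+1%:R) <= eps.
Proof.
move=> eps eps0.
have [N] := near_infty_natSinv_lt (PosNum (divr_gt0 (exprn_gt0 2 eps0) (ltr_wpDl (normr_ge0 c) ltr01))).
move=> _ hN; exists N => n Nn.
have h := hN n Nn; move: h => /= h.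
rewrite -(ger0_norm (ltW eps0)) -sqrtr_sqr ler_sqrt ?sqr_ge0//.
apply: (@le_trans _ _ ((`|c| + 1) / n.+1%:R)).
  by rewrite ler_pM2r ?invr_gt0// (le_trans (ler_norm c))// lerDl.
by move: h; rewrite ltr_pdivlMr ?ltr_wpDl// mulrC => /ltW.
Qed.

Section min_norm.
Variable C : set H.
Hypothesis C_closed : closed C.
Hypothesis C_mid : forall x y, C x -> C y -> C (2^-1 *: (x + y)).

(** Parallelogram identity, with the midpoint back in [C]. This one estimate makes minimizing
    sequences Cauchy and the minimizer unique. *)
Lemma min_norm_dist (d : R) x y : (forall z, C z -> d <= `|z| ^+ 2) -> C x -> C y ->
  `|x - y| ^+ 2 <= 2 * (`|x| ^+ 2 - d) + 2 * (`|y| ^+ 2 - d).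
Proof.
move=> dC Cx Cy; have := dC _ (C_mid Cx Cy); have := parallelogram x y.
rewrite normrZ exprMn ger0_norm ?invr_ge0// => h1 h2.
have h3 : d <= 4^-1 * `|x + y| ^+ 2.
  by apply: (le_trans h2); rewrite le_eqVlt; apply/orP; left; apply/eqP; field.
lra.
Qed.

Lemma min_norm_exists : C !=set0 -> exists2 m, C m & forall z, C z -> `|m| <= `|z|.
Proof.
move=> [c0 Cc0].
pose D := [set `|z| ^+ 2 | z in C].
have D_inf : has_inf D.
  split; first by exists (`|c0| ^+ 2), c0.
  by exists 0 => _ [z _ <-]; exact: sqr_ge0.
pose d := inf D.
have dC z : C z -> d <= `|z| ^+ 2 by move=> Cz; apply: ge_inf; [exact: D_inf.2|exists z].
have /choice[u uP] : forall n, exists z, C z /\ `|z| ^+ 2 < d + n.+1%:R^-1.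
  move=> n; have n0 : 0 < n.+1%:R^-1 :> R by rewrite invr_gt0.
  by have [_ [z Cz <-] zd] := inf_adherent n0 D_inf; exists z.
have u_cvg : cvgn u.
  (* By [min_norm_dist] the squared distance is at most 2/(n+1) + 2/(m+1), hence at most 4/(n+1)
     when n <= m. *)
  apply: (@cauchy_seq_cvg _ (fun n => Num.sqrt (4 / n.+1%:R))) => [|n m nm].
    exact: inv_small.
  rewrite -(ger0_norm (normr_ge0 (u n - u m))) -sqrtr_sqr ler_wsqrtr//.
  apply: (le_trans (min_norm_dist dC (uP n).1 (uP m).1)).
  have := (uP n).2; have := (uP m).2.
  have : m.+1%:R^-1 <= n.+1%:R^-1 :> R by rewrite lef_pV2 ?posrE// ler_nat.
  move: (m.+1%:R^-1) (n.+1%:R^-1) => b a; lra.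
exists (lim (u @ \oo)).
  exact: (closed_seq C_closed (fun n => (uP n).1) u_cvg).
move=> z Cz; rewrite -(@ler_pXn2r _ 2)// ?nnegrE//.
apply: (le_trans _ (dC _ Cz)).
have n2 : (fun n => `|u n| ^+ 2) @ \oo --> `|lim (u @ \oo)| ^+ 2.
  rewrite expr2; under eq_fun do rewrite expr2.
  by apply: cvgM; apply: cvg_norm.
apply/ler_addgt0Pr => e e0; rewrite -(cvg_lim _ n2)//.
apply: limr_le; first by apply/cvg_ex; exists (`|lim (u @ \oo)| ^+ 2).
have [N _ hN] := near_infty_natSinv_lt (PosNum e0).
exists N => // n /= Nn; rewrite (le_trans (ltW (uP n).2))// lerD2l ltW//.
exact: hN.
Qed.

Lemma min_norm_unique m m' : C m -> C m' ->
  (forall z, C z -> `|m| <= `|z|) -> `|m'| <= `|m| -> m' = m.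
Proof.
move=> Cm Cm' mC m'm; apply/eqP; rewrite -subr_eq0 -normr_eq0 -sqrf_eq0 eq_le sqr_ge0 andbT.
have sq z : C z -> `|m| ^+ 2 <= `|z| ^+ 2.
  by move=> Cz; rewrite ler_pXn2r ?nnegrE//; exact: mC.
have := min_norm_dist sq Cm' Cm.
have : `|m'| ^+ 2 <= `|m| ^+ 2 by rewrite ler_pXn2r ?nnegrE.
lra.
Qed.

End min_norm.

Definition perp (A : set H) : set H := [set x | forall a, A a -> ip x a = 0].

Lemma perp_perp (A : set H) : A `<=` perp (perp A).
Proof. by move=> a Aa x xA; rewrite ipC xA. Qed.

Lemma perp0 (A : set H) : perp A 0.
Proof. by move=> a _; rewrite ip0l. Qed.

Lemma perp_lin (A : set H) (a : R) x y : perp A x -> perp A y -> perp A (a *: x + y).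
Proof. by move=> xA yA b Ab; rewrite ipDl ipZl xA// yA// mulr0 addr0. Qed.

Lemma perp_closed (A : set H) : closed (perp A).
Proof.
rewrite (_ : perp A = \bigcap_(a in A) (ip ^~ a @^-1` [set 0])).
  apply: closed_bigI => a _; apply: closed_comp; last exact: closed_eq.
  by move=> x _; exact: ip_continuous.
by apply/seteqP; split.
Qed.

Lemma hilbert_projection (V : set H) (x : H) : closed V ->
    V !=set0 -> (forall (a : R) u v, V u -> V v -> V (a *: u + v)) ->
  exists2 v, V v & perp V (x - v).
Proof.
move=> Vcl [v0 Vv0] Vlin.
have V0 : V 0 by have := Vlin (-1) _ _ Vv0 Vv0; rewrite scaleN1r addNr.
(* The coset [x - V]; its point of least norm is the component of [x] normal to [V]. *)
pose C := (fun z => x - z) @^-1` V.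
have Ccl : closed C.
  apply: closed_comp => // z _.
  by apply: cvgB; [exact: cvg_cst|exact: cvg_id].
have Cmid y z : C y -> C z -> C (2^-1 *: (y + z)).
  rewrite /C /= => Vy Vz.
  rewrite (_ : x - _ = 2^-1 *: (x - y) + (2^-1 *: (x - z) + 0)).
    exact: Vlin _ _ _ Vy (Vlin _ _ _ Vz V0).
  rewrite addr0 -scalerDr addrACA -opprD scalerBr; congr (_ - _).
  rewrite -(scale1r x) -scalerDl scalerA (_ : 2^-1 * _ = 1) ?scale1r//.
  by field.
have [|m Cm mC] := min_norm_exists Ccl Cmid; first by exists x; rewrite /C /= subrr.
exists (x - m) => // v Vv; rewrite subKr.
(* minimize |m - t v| over t *)
have [->|v0'] := eqVneq v 0; first by rewrite ip0r.
have vv : 0 < ip v v by rewrite ipxx exprn_gt0// normr_gt0.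
have h t : ip m m <= ip (m - t *: v) (m - t *: v).
  rewrite !ipxx ler_pXn2r ?nnegrE//; apply: mC; rewrite /C /= opprB addrCA.
  exact: Vlin.
have := h (ip m v / ip v v).
rewrite !(ipBl, ipBr, ipZl, ipZr) (ipC v m) => {}h.
have h2 : ip m v ^+ 2 / ip v v <= 0.
  suff : ip m v ^+ 2 / ip v v = ip m m - (ip m m - ip m v / ip v v * ip m v - (ip m v / ip v v * ip m v - ip m v / ip v v * (ip m v / ip v v * ip v v))) by lra.
  by field; rewrite gt_eqF.
move: h2; rewrite pmulr_lle0 ?invr_gt0// => h2.
by apply/eqP; rewrite -sqrf_eq0 eq_le h2 sqr_ge0.
Qed.

Lemma linear_bounded_continuous (L : H -> R) (c : R) :
  (forall (a : R) x y, L (a *: x + y) = a * L x + L y) ->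
  (forall x, `|L x| <= c * `|x|) -> continuous L.
Proof.
move=> Llin Lc x; apply/cvgrPdist_lt => e e0.
have K : 0 < `|c| + 1 by rewrite ltr_wpDl.
near=> z; have -> : L x - L z = L (x - z).
  by rewrite [in RHS]addrC -(scaleN1r z) Llin mulN1r addrC.
apply: (le_lt_trans (Lc _)).
apply: (@le_lt_trans _ _ ((`|c| + 1) * `|x - z|)).
  by rewrite ler_wpM2r// (le_trans (ler_norm c))// lerDl.
rewrite mulrC -ltr_pdivlMr//; near: z.
by apply: cvgr_dist_lt => //; exact: divr_gt0.
Unshelve. all: by end_near. Qed.

Lemma riesz (L : H -> R) (c : R) :
  (forall (a : R) x y, L (a *: x + y) = a * L x + L y) ->
  (forall x, `|L x| <= c * `|x|) -> exists v, forall x, L x = ip v x.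
Proof.
move=> Llin Lc; have Lcont := linear_bounded_continuous Llin Lc.
have L0 : L 0 = 0.
  by have := Llin 1 0 0; rewrite scaler0 addr0 mul1r -[LHS]addr0 => /addrI.
pose V := L @^-1` [set 0].
have Vcl : closed V by apply: closed_comp; [move=> z _; exact: Lcont|exact: closed_eq].
have Vlin (a : R) u v : V u -> V v -> V (a *: u + v).
  by rewrite /V /= Llin => -> ->; rewrite mulr0 addr0.
have [[x Lx]|] := pselect (exists x, L x != 0); last first.
  move=> nL; exists 0 => x; rewrite ip0l; apply/eqP; apply: contrapT => /negP Lx.
  by apply: nL; exists x.
have [v Vv nV] := hilbert_projection x Vcl (ex_intro V 0 L0) Vlin.
set n := x - v in nV.
have Ln : L n != 0.
  rewrite /n addrC -(scaleN1r v) Llin; move: Vv; rewrite /V /= => ->.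
  by rewrite mulr0 add0r.
have nn : ip n n != 0.
  by apply: contra Ln => /eqP/ip_eq0 ->; rewrite L0.
exists ((L n / ip n n) *: n) => y; rewrite ipZl.
(* The coefficient is chosen so that [L] vanishes on this combination, which is therefore orthogonal
   to [n]. *)
have /nV : V (- (L y / L n) *: n + y) by rewrite /V /= Llin; field.
rewrite ipDr ipZr => h.
have -> : ip n y = L y / L n * ip n n by lra.
by field; rewrite Ln nn.
Qed.

Lemma closure_normP (V : set H) x :
  closure V x <-> forall e, 0 < e -> exists2 v, V v & `|x - v| < e.
Proof.
split=> [Vx e e0|h B /nbhs_ballP[e e0 eB]].
  have [v [Vv]] := Vx _ (nbhsx_ballx x e e0).
  by rewrite -ball_normE; exists v.
have [v Vv xv] := h e e0; exists v; split => //; apply: eB.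
by rewrite -ball_normE.
Qed.

Lemma dense_of_perp (V : set H) : V !=set0 ->
  (forall (a : R) u v, V u -> V v -> V (a *: u + v)) ->
  (forall x, perp V x -> x = 0) -> closure V = setT.
Proof.
move=> [v0 Vv0] Vlin V0; apply/seteqP; split=> // x _.
have clin (a : R) u v : closure V u -> closure V v -> closure V (a *: u + v).
  move=> /closure_normP Vu /closure_normP Vv; apply/closure_normP => e e0.
  have a0 : 0 < `|a| + 1 by rewrite ltr_wpDl.
  have [u' Vu' uu'] := Vu _ (divr_gt0 (divr_gt0 e0 (ltr0Sn R 1)) a0).
  have [v' Vv' vv'] := Vv _ (divr_gt0 e0 (ltr0Sn R 1)).
  exists (a *: u' + v'); first exact: Vlin.
  rewrite opprD addrACA -scalerBr (le_lt_trans (ler_normD _ _))//.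
  rewrite [ltRHS]splitr ler_ltD// normrZ.
  move: uu'; rewrite ltr_pdivlMr// => /ltW; apply: le_trans.
  by rewrite mulrC ler_wpM2l// lerDl.
have [v Vv xv] := hilbert_projection x (@closed_closure _ V) (ex_intro _ v0 (subset_closure Vv0)) clin.
suff /eqP : x - v = 0 by rewrite subr_eq0 => /eqP ->.
by apply: V0 => u Vu; apply: xv; exact: subset_closure.
Qed.

End hilbert.

(** * Orthogonal complements as Hilbert spaces *)

Section perp_space.
Context (R : realType) (H : hilbertType R) (A : set H).

(** Used with [A := perp W], where it is the closed span of [W]; being a complement, it is linear
    and closed with no argument on limits of combinations. *)
Definition perp_space : Type := set_type (perp A).
HB.instance Definition _ := SubType.copy perp_space (set_type (perp A)).
HB.instance Definition _ := [Choice of perp_space by <:].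

Definition perp_pred : pred H := fun x => x \in perp A.

Lemma perp_submod : submod_closed perp_pred.
Proof.
split=> [|a x y /set_mem xA /set_mem yA]; apply: mem_set; first exact: perp0.
exact: perp_lin.
Qed.

HB.instance Definition _ :=
  GRing.SubChoice_isSubLmodule.Build R H _ perp_space perp_submod.

Definition perp_val (x : perp_space) : H := val x.

Lemma perp_valP x : perp A (perp_val x).
Proof. exact: set_mem (valP x). Qed.

Lemma perp_val_lin (a : R) x y : perp_val (a *: x + y) = a *: perp_val x + perp_val y.
Proof. by rewrite /perp_val GRing.valD GRing.valZ. Qed.

Lemma perp_valB x y : perp_val (x - y) = perp_val x - perp_val y.
Proof. exact: GRing.valB. Qed.

Definition perp_norm (x : perp_space) : R := `|perp_val x|.

Lemma perp_normD x y : perp_norm (x + y) <= perp_norm x + perp_norm y.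
Proof. by rewrite /perp_norm /perp_val GRing.valD ler_normD. Qed.

Lemma perp_normZ a x : perp_norm (a *: x) = `|a| * perp_norm x.
Proof. by rewrite /perp_norm /perp_val GRing.valZ normrZ. Qed.

Lemma perp_norm_eq0 x : perp_norm x = 0 -> x = 0.
Proof.
move=> /eqP; rewrite normr_eq0 => /eqP x0; apply: val_inj.
by rewrite [RHS]GRing.val0.
Qed.

HB.instance Definition _ :=
  @Lmodule_isNormed.Build R perp_space perp_norm perp_normD perp_normZ perp_norm_eq0.

Lemma perp_ball x y (e : R) :
  ball (perp_val x) e (perp_val y) = ball x e y :> Prop.
Proof.
by rewrite -!ball_normE -[LHS]/(is_true (`|perp_val x - perp_val y| < e)) -perp_valB.
Qed.

Lemma perp_complete (F : set_system perp_space) : ProperFilter F -> cauchy F -> cvg F.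
Proof.
move=> FF /cauchyP Fc.
have VF : ProperFilter (perp_val @ F) by exact: fmap_proper_filter.
have : cauchy (perp_val @ F).
  apply/cauchyP => e e0; have [a Fa] := Fc e e0.
  exists (perp_val a); suff : F (perp_val @^-1` ball (perp_val a) e) by [].
  by apply: filterS Fa => b ab /=; rewrite perp_ball.
move=> /cauchy_cvg/cvg_ex[l Fl].
have lA : perp A l.
  apply: (closed_cvg _ (@perp_closed _ _ A) _ l Fl).
  by apply: nearW => x; exact: perp_valP.
apply/cvg_ex; exists (SigSub (mem_set lA) : perp_space).
apply/cvg_ballP => e e0; move/cvg_ballP: Fl => /(_ e e0).
move=> Fl; have {}Fl : F (perp_val @^-1` ball l e) by [].
by apply: filterS Fl => b lb; rewrite -perp_ball.
Qed.

HB.instance Definition _ := Uniform_isComplete.Build perp_space perp_complete.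

Definition perp_inner (x y : perp_space) : R := ip (perp_val x) (perp_val y).

Lemma perp_inner_bilinear :
  bilinear_for ( *%R : GRing.Scale.law R R) ( *%R : GRing.Scale.law R R) perp_inner.
Proof.
split=> u a x y; rewrite /perp_inner perp_val_lin.
  by rewrite ipDl ipZl.
by rewrite ipDr ipZr.
Qed.

HB.instance Definition _ := bilinear_isBilinear.Build R perp_space perp_space R
  *%R (idfun \; *%R) perp_inner perp_inner_bilinear.

Lemma perp_inner_hermitian x y :
  perp_inner x y = (-1) ^+ false * idfun (perp_inner y x).
Proof. by rewrite mul1r /perp_inner ipC. Qed.

HB.instance Definition _ := isHermitianSesquilinear.Build R perp_space false idfun
  perp_inner perp_inner_hermitian.

Lemma perp_inner_gt0 x : x != 0 -> 0 < perp_inner x x.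
Proof.
move=> x0; rewrite /perp_inner ipxx exprn_gt0// normr_gt0.
by apply: contra x0 => /eqP x0; apply/eqP/perp_norm_eq0; rewrite /perp_norm x0 normr0.
Qed.

HB.instance Definition _ := isDotProduct.Build R perp_space perp_inner perp_inner_gt0.

Lemma perp_innerxx x : perp_inner x x = `|x| ^+ 2.
Proof. by rewrite /perp_inner ipxx. Qed.

HB.instance Definition _ := NormedModule_hasInner.Build R perp_space perp_innerxx.

End perp_space.

(** * Bessel inequality and wandering sets *)

Section counting.
Context (R : realType) (G : groupType).
Notation count := (@counting (discrete G) R).

Lemma counting_set1 (x : discrete G) : count [set x] = 1%E.
Proof.
rewrite /counting asboolT; last exact: finite_set1.
by rewrite fset_set1 finmap.cardfs1.
Qed.

Lemma integral_counting_set1 (f : discrete G -> \bar R) x :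
  (\int[count]_(y in [set x]) f y = f x)%E.
Proof.
rewrite (@eq_integral _ _ _ _ _ (cst (f x))); last by move=> y; rewrite inE => ->.
rewrite integral_cst; last exact: measurable_discrete.
by rewrite [X in (_ * X)%E](counting_set1 x) mule1.
Qed.

Lemma integral_counting_seq (f : discrete G -> \bar R) (s : seq (discrete G)) :
  uniq s -> (forall x, 0 <= f x)%E ->
  (\int[count]_(y in [set` s]) f y = \sum_(x <- s) f x)%E.
Proof.
move=> us f0.
rewrite (_ : [set` s] = \big[setU/set0]_(x <- s) [set x]); last first.
  rewrite -bigcup_seq; apply/seteqP; split=> [x xs|x [y ys ->]//].
  by exists x.
rewrite ge0_integral_bigsetU//.
  by apply: eq_bigr => x _; exact: integral_counting_set1.
by move=> i j _ _ [x [/= -> ->]].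
Qed.

(** [G] may be uncountable, so the integral is not a series. Bounded finite sums make each level set
    [f >= 1/(n+1)] finite, and monotone convergence along these sets reaches the integral. *)
Lemma integral_counting_le (f : discrete G -> R) (M : R) :
  (forall x, 0 <= f x) ->
  (forall s : seq (discrete G), uniq s -> \sum_(x <- s) f x <= M) ->
  (\int[count]_x (f x)%:E <= M%:E)%E.
Proof.
move=> f0 fM.
pose S (n : nat) : set (discrete G) := [set x | n.+1%:R^-1 <= f x].
have Sfin n : finite_set (S n).
  apply: contrapT => /(infinite_set_fset (Num.bound (M * n.+1%:R)))[B BS Bn].
  have := fM _ (finmap.fset_uniq B); apply/negP; rewrite -ltNge.
  apply: (@lt_le_trans _ _ (\sum_(x <- finmap.enum_fset B) n.+1%:R^-1)).
    rewrite big_const_seq count_predT iter_addr_0 -[X in _ < X]mulr_natl ltr_pdivlMr ?ltr0Sn//.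
    have [M0|M0] := ltP M 0.
      by apply: (@lt_le_trans _ _ 0) => //; rewrite pmulr_llt0.
    apply: (@lt_le_trans _ _ ((Num.bound (M * n.+1%:R))%:R)).
      by rewrite archi_boundP// mulr_ge0.
    by rewrite ler_nat.
  by rewrite !big_seq; apply: ler_sum => x xB; exact: BS.
pose g n x := ((fun x => (f x)%:E) \_ (S n)) x.
have g0 n x : (0 <= g n x)%E.
  by rewrite /g patchE; case: ifPn => // _; rewrite lee_fin.
have gE x n m : (n <= m)%N -> (g n x <= g m x)%E.
  move=> nm; rewrite /g !patchE; case: ifPn => [/set_mem Snx|_].
    rewrite mem_set// /S /=; apply: le_trans Snx.
    by rewrite lef_pV2 ?posrE// ler_nat.
  by case: ifPn => // _; rewrite lee_fin.
rewrite (_ : (fun x => (f x)%:E) = (fun x => limn (g^~ x))); last first.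
  apply/funext => x; apply/esym/cvg_lim => //.
  have [fx0|fx0] := leP (f x) 0.
    apply: cvg_near_cst; apply: nearW => n; rewrite /g patchE; case: ifPn => // _.
    by congr (_%:E); apply/eqP; rewrite eq_le fx0 f0.
  apply: cvg_near_cst.
  have [N _ hN] := near_infty_natSinv_lt (PosNum fx0).
  exists N => // n /= Nn; rewrite /g patchE mem_set//.
  by have /= := hN n Nn => /ltW.
rewrite monotone_convergence//; last by move=> x _ n m; exact: gE.
apply: lime_le.
  apply: ereal_nondecreasing_is_cvgn => n m nm.
  by apply: ge0_le_integral => // x _; exact: gE.
apply: nearW => n; rewrite /g -integral_mkcond.
have [s us Ss] : exists2 s : seq (discrete G), uniq s & S n = [set` s].
  exists (finmap.enum_fset (fset_set (S n))); first exact: finmap.fset_uniq.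
  exact: (esym (fset_setK (Sfin n))).
rewrite Ss integral_counting_seq//.
by rewrite sumEFin lee_fin; exact: fM.
Qed.

Lemma integral_counting_delta (f : discrete G -> R) x :
  (forall y, y != x -> f y = 0) -> (\int[count]_y f y = f x)%R.
Proof.
move=> f0; rewrite /Rintegral.
have -> : (\int[count]_y (f y)%:E = \int[count]_(y in [set x]) (f y)%:E)%E.
  rewrite [RHS]integral_mkcond; apply: eq_integral => y _; rewrite patchE.
  by case: ifPn => //; rewrite notin_setE => /eqP yx; congr EFin; exact: f0.
by rewrite integral_counting_set1.
Qed.

End counting.

Section bessel.
Context (R : realType) (G : groupType) (H : hilbertType R).
Variables (e : G -> H) (c : R).
Hypothesis c0 : 0 <= c.
Hypothesis e_orth : forall g g', g != g' -> ip (e g) (e g') = 0.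
Hypothesis e_norm : forall g, `|e g| <= c.

(** Cauchy-Schwarz against the combination [p] of the [e g] with coefficients [ip (e g) h]: the sum
    [B] is [ip p h], and orthogonality gives [|p|^2 <= c^2 B], so [B^2 <= c^2 |h|^2 B]. The [e g]
    are not normalized, whence the factor [c]. *)
Lemma bessel_seq (s : seq G) h : uniq s ->
  \sum_(g <- s) ip (e g) h ^+ 2 <= (c * `|h|) ^+ 2.
Proof.
move=> us; set B := (X in X <= _).
have B0 : 0 <= B by apply: sumr_ge0 => g _; exact: sqr_ge0.
pose p := \sum_(g <- s) ip (e g) h *: e g.
have ph : ip p h = B.
  by rewrite ip_suml; apply: eq_bigr => g _; rewrite ipZl expr2.
have pp : `|p| ^+ 2 <= c ^+ 2 * B.
  rewrite -ipxx {1}/p ip_suml /B mulr_sumr !big_seq; apply: ler_sum => g gs.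
  rewrite ipZl /p ip_sumr (bigD1_seq g)//= big1 ?addr0 => [|g' g'g]; last first.
    by rewrite ipZr e_orth ?mulr0// eq_sym.
  rewrite ipZr mulrA -expr2 mulrC ler_wpM2r ?sqr_ge0// ipxx.
  by rewrite ler_pXn2r ?nnegrE.
have := cauchy_schwarz p h; rewrite ph ger0_norm// => BB.
have {}BB : B * B <= (c * `|h|) ^+ 2 * B.
  apply: (@le_trans _ _ ((`|p| * `|h|) ^+ 2)).
    by rewrite -expr2 ler_pXn2r ?nnegrE ?mulr_ge0.
  by rewrite !exprMn [leRHS]mulrAC ler_wpM2r ?sqr_ge0//.
have [B00|Bn0] := eqVneq B 0; first by rewrite B00 sqr_ge0.
by move: BB; rewrite ler_pM2r// lt_neqAle eq_sym Bn0.
Qed.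

Lemma bessel h : exists2 k : l2 R G,
  (forall g, l2_fun k g = ip (e g) h) & l2_norm k <= c * `|h|.
Proof.
apply: l2_of_bounded; last by rewrite mulr_ge0.
apply: integral_counting_le => [x|s us]; first exact: sqr_ge0.
exact: bessel_seq.
Qed.

End bessel.

Section orthogonal.
Context (R : realType) (H : hilbertType R).
Implicit Types u v : orthogonal_group H.

Lemma orthM u v x : (u * v : orthogonal_group H)%g x = u (v x).
Proof. by []. Qed.

Lemma orth1 x : (1%g : orthogonal_group H) x = x.
Proof. by []. Qed.

Lemma orth_lin u (a : R) x y : u (a *: x + y) = a *: u x + u y.
Proof. by have [+ _] := set_mem (valP u); apply. Qed.

Lemma orth_ip u x y : ip (u x) (u y) = ip x y.
Proof. by have [_] := set_mem (valP u); apply. Qed.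

Lemma orth_norm u x : `|u x| = `|x|.
Proof.
apply/eqP; rewrite -(@eqrXn2 _ 2)//; apply/eqP.
by rewrite -!ipxx orth_ip.
Qed.

Lemma orthD u x y : u (x + y) = u x + u y.
Proof. by rewrite -[x]scale1r orth_lin !scale1r. Qed.

Lemma orth0 u : u 0 = 0.
Proof. by apply: ip_eq0; rewrite orth_ip ip0l. Qed.

Lemma orthZ u (a : R) x : u (a *: x) = a *: u x.
Proof. by rewrite -[a *: x]addr0 orth_lin orth0 addr0. Qed.

Lemma orthB u x y : u (x - y) = u x - u y.
Proof. by rewrite orthD -scaleN1r orthZ scaleN1r. Qed.

Lemma orth_ipV u x y : ip (u x) y = ip x ((u^-1 : orthogonal_group H)%g y).
Proof. by rewrite -[LHS](orth_ip u^-1%g) -orthM mulVg. Qed.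

End orthogonal.

(** * Tensor decomposition obtained from a wandering set *)

Section wandering.
Context (R : realType) (G : groupType) (H : hilbertType R).
Variable r : G -> orthogonal_group H.
Hypothesis rM : {morph r : g h / (g * h)%g >-> (g * h)%g}.
Variable W : set H.
Hypothesis W_wander : forall g w w', g != 1%g -> W w -> W w' -> ip (r g w) w' = 0.

Local Notation count := (@counting (discrete G) R).

Lemma rep1 : r 1%g = 1%g.
Proof. by apply: (@mulgI _ (r 1%g)); rewrite -rM !mulg1. Qed.

Lemma repV g : r g^-1%g = (r g)^-1%g.
Proof. by apply: (@mulgI _ (r g)); rewrite -rM !mulgV rep1. Qed.

(** Membership in a double complement is tested on vectors of [W], first for [k'], then, after
    moving [r g] to the other side, for [k]. *)
Lemma wander_span g k k' : g != 1%g ->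
  perp (perp W) k -> perp (perp W) k' -> ip (r g k) k' = 0.
Proof.
move=> g1 Wk Wk'; rewrite ipC; apply: Wk' => w Ww.
rewrite orth_ipV -repV; apply: Wk => w' Ww'; apply: W_wander => //.
by apply: contra g1 => /eqP gV; rewrite -(invgK g) gV invg1.
Qed.

Lemma wander_orth k k' g g' : perp (perp W) k -> perp (perp W) k' ->
  g != g' -> ip (r g k) (r g' k') = 0.
Proof.
move=> Wk Wk' gg'; rewrite -[g](mulVKg g') rM orthM orth_ip.
apply: wander_span => //; apply: contra gg' => /eqP e.
by rewrite -[g](mulVKg g') e mulg1.
Qed.

Local Notation K := (perp_space (perp W)).

(* The sum of the [f g *: r g k], defined weakly. *)
Lemma tensor_vec_ex (f : l2 R G) (k : K) : exists v : H, forall h,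
  ip v h = \int[count]_g (l2_fun f g * ip (r g (perp_val k)) h).
Proof.
have Wk := perp_valP k.
have B h : exists2 b : l2 R G, (forall g, l2_fun b g = ip (r g (perp_val k)) h) &
    l2_norm b <= `|perp_val k| * `|h|.
  apply: bessel => [|g g' gg'|g]; first by [].
  - exact: wander_orth.
  - by rewrite orth_norm.
have bE h := projT1 (cid2 (B h)).
pose b h : l2 R G := s2val (cid2 (B h)).
have {}bE h g : l2_fun (b h) g = ip (r g (perp_val k)) h by rewrite /b; case: cid2.
have b_le h : l2_norm (b h) <= `|perp_val k| * `|h| by rewrite /b; case: cid2.
have b_lin (a : R) x y : b (a *: x + y) = a *: b x + b y.
  apply: l2P => g; rewrite bE -[RHS]/(a * l2_fun (b x) g + l2_fun (b y) g) !bE.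
  by rewrite ipDr ipZr.
(* By Bessel the coefficient function [b h] is linear and bounded in [h], so pairing it with [f] is
   a bounded functional and no series has to be summed in [H]. *)
have [||v vE] := @riesz R H (fun h => ip f (b h)) (`|f| * `|perp_val k|).
- by move=> a x y; rewrite b_lin ipDr ipZr.
- move=> h; rewrite (le_trans (cauchy_schwarz _ _))// -mulrA ler_wpM2l//.
  exact: b_le.
exists v => h; rewrite -vE; apply: eq_Rintegral => g _.
by congr (_ * _); exact: bE.
Qed.

Definition tensor_vec f k : H := projT1 (cid (tensor_vec_ex f k)).

Lemma tensor_vecE f k h :
  ip (tensor_vec f k) h = \int[count]_g (l2_fun f g * ip (r g (perp_val k)) h).
Proof. by rewrite /tensor_vec; case: cid. Qed.

Lemma l2_bessel (k : K) h :
  exists b : l2 R G, forall g, l2_fun b g = ip (r g (perp_val k)) h.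
Proof.
have [|g g'|g|b bE _] := @bessel R G H (fun g => r g (perp_val k)) `|perp_val k| _ _ _ h.
- by [].
- by move=> gg'; apply: wander_orth => //; exact: perp_valP.
- by rewrite orth_norm.
- by exists b.
Qed.

Lemma tensor_vec_bilinear :
  bilinear_for ( *:%R : GRing.Scale.law R H) ( *:%R : GRing.Scale.law R H) tensor_vec.
Proof.
split=> u a x y; apply: ip_ext => h; rewrite ipDl ipZl !tensor_vecE.
  have [b bE] := l2_bessel u h.
  have E (f : l2 R G) : \int[count]_g (l2_fun f g * ip (r g (perp_val u)) h) = ip f b.
    by apply: eq_Rintegral => g _; rewrite -bE.
  by rewrite !E ipDl ipZl.
have [b bE] := l2_bessel x h; have [b' b'E] := l2_bessel y h.
have -> : \int[count]_g (l2_fun u g * ip (r g (perp_val (a *: x + y))) h) =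
    ip u (a *: b + b').
  apply: eq_Rintegral => g _.
  by rewrite perp_val_lin orth_lin ipDl ipZl -bE -b'E.
rewrite ipDr ipZr; congr (_ * _ + _); apply: eq_Rintegral => g _.
  by rewrite -bE.
by rewrite -b'E.
Qed.

(** The weak definition is used twice; as distinct translates are orthogonal, the inner integral
    reduces to its term at [g]. *)
Lemma tensor_vec_inner f f' k k' :
  ip (tensor_vec f k) (tensor_vec f' k') = ip f f' * ip k k'.
Proof.
rewrite tensor_vecE.
have E g : ip (r g (perp_val k)) (tensor_vec f' k') = l2_fun f' g * ip k k'.
  rewrite ipC tensor_vecE (integral_counting_delta (x := g)).
    by rewrite orth_ip ipC.
  by move=> g' g'g; rewrite wander_orth ?mulr0//; exact: perp_valP.
rewrite mulrC -[RHS]RintegralZl//; last exact: l2_mul_integrable.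
apply: eq_Rintegral => g _; rewrite E.
by rewrite [l2_fun f' g * _]mulrC mulrCA.
Qed.

Lemma tensor_vec_rep g f k : r g (tensor_vec f k) = tensor_vec (regular_rep R g f) k.
Proof.
apply: ip_ext => h; rewrite orth_ipV !tensor_vecE.
rewrite -[LHS]/(fine _) -(integral_translate g); congr fine.
apply: eq_integral => x _; rewrite regular_repE; congr ((_ * _)%:E).
by rewrite -orth_ipV -orthM -rM mulVKg.
Qed.

Lemma l2_delta (g : G) : exists d : l2 R G, forall x, l2_fun d x = (x == g)%:R.
Proof.
have [||d dE _] := @l2_of_bounded R G (fun x => (x == g)%:R) 1; last by exists d.
- apply: integral_counting_le => [x|s us]; first exact: sqr_ge0.
  rewrite expr1n; have [gs|gs] := boolP (g \in s).
    rewrite (bigD1_seq g)//= eqxx expr1n big1 ?addr0// => x /negPf ->.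
    by rewrite expr0n.
  rewrite big_seq big1// => x xs; case: eqP => [xg|]; last by rewrite expr0n.
  by rewrite -xg xs in gs.
- by [].
Qed.

Hypothesis W_total : forall x, (forall g w, W w -> ip x (r g w) = 0) -> x = 0.

(** With [H] as the tensor product only density needs an argument: each [r g w] is the tensor of a
    delta function with [w], so a vector orthogonal to all tensors vanishes by [W_total]. *)
Theorem wandering_multiple : is_multiple_of r (@regular_rep R G).
Proof.
pose t : {bilinear l2 R G -> K -> H} := HB.pack tensor_vec
  (bilinear_isBilinear.Build R (l2 R G) K H *:%R *:%R tensor_vec tensor_vec_bilinear).
exists K, H, t, r; split.
- split; first by move=> f f' k k'; exact: tensor_vec_inner.
  apply: dense_of_perp.
  + by exists 0, 0%N, (fun=> 0), (fun=> 0); rewrite big_ord0.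
  + move=> a _ _ [n [x [k ->]]] [m [x' [k' ->]]].
    exists (n + m)%N, (fun i : 'I_(n + m) => match fintype.split i with inl i => a *: x i | inr j => x' j end),
      (fun i : 'I_(n + m) => match fintype.split i with inl i => k i | inr j => k' j end).
    rewrite big_split_ord; congr (_ + _).
      rewrite scaler_sumr; apply: eq_bigr => i _.
      by rewrite (unsplitK (inl i)) linearZl_LR.
    by apply: eq_bigr => i _; rewrite (unsplitK (inr i)).
  + move=> x xV; apply: W_total => g w Ww.
    have Kw : perp (perp W) w by exact: perp_perp.
    have [d dE] := l2_delta g.
    have -> : r g w = t d (SigSub (mem_set Kw) : K).
      apply: ip_ext => h; rewrite tensor_vecE (integral_counting_delta (x := g)).
        by rewrite dE eqxx mul1r.
      by move=> y /negPf yg; rewrite dE yg mul0r.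
    apply: xV; exists 1%N, (fun=> d), (fun=> (SigSub (mem_set Kw) : K)).
    by rewrite big_ord1.
- by move=> g f k; exact: tensor_vec_rep.
- by exists idfun; split => //; exists id.
Qed.

End wandering.

(** * Orthogonal representations of symmetric groups *)

Lemma finite_set_seq (I : choiceType) (B : set I) : finite_set B ->
  exists2 b : seq I, uniq b & forall x, x \in b <-> B x.
Proof.
move=> Bfin; exists (finmap.enum_fset (fset_set B)); first exact: finmap.fset_uniq.
by move=> x; rewrite -[in X in _ <-> X](fset_setK Bfin).
Qed.

Section symmetric_group.
Variable I : choiceType.
Implicit Types (s t : Sym I) (S T F B : set I).

Lemma SymM s t x : (s * t : Sym I)%g x = s (t x).
Proof. by []. Qed.

Lemma SymK s x : (s^-1 : Sym I)%g (s x) = x.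
Proof. exact: Sym_invK. Qed.

Lemma SymVK s x : s ((s^-1 : Sym I)%g x) = x.
Proof. exact: Sym_invKV. Qed.

Lemma Sym_inj s : injective s.
Proof. exact: can_inj (SymK s). Qed.

Lemma Sym_image1 S : (1%g : Sym I) @` S = S.
Proof. exact: image_id. Qed.

Lemma Sym_imageM s t S : (s * t : Sym I)%g @` S = s @` (t @` S).
Proof. by rewrite image_comp. Qed.

Lemma Sym_imageKV s S : (s^-1 : Sym I)%g @` (s @` S) = S.
Proof. by rewrite -Sym_imageM mulVg Sym_image1. Qed.

Definition swap (a b x : I) : I := if x == a then b else if x == b then a else x.

Lemma swapK a b : involutive (swap a b).
Proof.
move=> x; rewrite /swap; have [->|xa] := eqVneq x a.
  by rewrite eqxx; case: eqVneq.
have [->|xb] := eqVneq x b; first by rewrite eqxx.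
by rewrite (negPf xa) (negPf xb).
Qed.

Lemma swap_bij a b : bijective (swap a b).
Proof. by exists (swap a b); exact: swapK. Qed.

Definition Sym_swap a b : Sym I := Sym_of (swap_bij a b).

Lemma Sym_swapL a b : Sym_swap a b a = b.
Proof. by rewrite Sym_ofE /swap eqxx. Qed.

Lemma Sym_swapN a b x : x <> a -> x <> b -> Sym_swap a b x = x.
Proof. by move=> /eqP/negPf xa /eqP/negPf xb; rewrite Sym_ofE /swap xa xb. Qed.

Definition fixes S s := forall x, S x -> s x = x.

Lemma fixes1 S : fixes S 1%g.
Proof. by []. Qed.

Lemma fixesM S s t : fixes S s -> fixes S t -> fixes S (s * t)%g.
Proof. by move=> Ss St x Sx; rewrite SymM St// Ss. Qed.

Lemma fixesV S s : fixes S s -> fixes S s^-1%g.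
Proof. by move=> Ss x Sx; rewrite -{1}(Ss x Sx) SymK. Qed.

Lemma fixesS S T s : S `<=` T -> fixes T s -> fixes S s.
Proof. by move=> ST Ts x /ST; exact: Ts. Qed.

Lemma fixes_notin S s x : fixes S s -> ~ S x -> ~ S (s x).
Proof. by move=> Ss Sx Ssx; apply: Sx; rewrite -(Sym_inj (Ss _ Ssx)). Qed.

Hypothesis I_inf : infinite_set [set: I].

Lemma fresh_element F : finite_set F -> exists x, ~ F x.
Proof.
move=> Ffin; have [x []] := infinite_setN0 (infinite_setD I_inf Ffin).
by exists x.
Qed.

Lemma move_off_seq (b : seq I) T F : uniq b -> finite_set T -> finite_set F ->
    (forall x, x \in b -> ~ T x) ->
  exists2 s, fixes T s & forall x, x \in b -> ~ F (s x).
Proof.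
elim: b T => [|x b IH] T /=; first by exists 1%g.
move=> /andP[xb ub] Tfin Ffin bT.
have xT : ~ T x by apply: bT; rewrite mem_head.
(* Adding [x] to the fixed set keeps it in place until a final transposition sends it to a fresh
   point, leaving the images of the other entries alone. *)
have [//||//||s sTx sF] := IH (x |` T).
- by rewrite finite_setU; split.
- move=> y yb [yx|]; first by rewrite -yx yb in xb.
  by apply: bT; rewrite inE yb orbT.
have sx : s x = x by apply: sTx; left.
have sT : fixes T s by apply: fixesS sTx => y; right.
have [|c cP] := @fresh_element (F `|` T `|` s @` [set` b]).
  by rewrite !finite_setU; do !split => //; exact: finite_image.
have cF : ~ F c by move=> ?; apply: cP; left; left.
have cT : ~ T c by move=> ?; apply: cP; left; right.
exists (Sym_swap x c * s)%g.
  apply: fixesM => // y Ty; apply: Sym_swapN => [yx|yc].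
    by rewrite yx in Ty.
  by rewrite yc in Ty.
move=> y; rewrite inE SymM => /orP[/eqP ->|yb]; first by rewrite sx Sym_swapL.
rewrite Sym_swapN; first exact: sF.
  by rewrite -sx => /Sym_inj yx; rewrite -yx yb in xb.
by move=> syc; apply: cP; right; exists y.
Qed.

Lemma move_off B T F : finite_set B -> finite_set T -> finite_set F ->
    (forall x, B x -> ~ T x) ->
  exists2 s, fixes T s & forall x, B x -> ~ F (s x).
Proof.
move=> Bfin Tfin Ffin BT.
have [b ub bB] := finite_set_seq Bfin.
have [x /bB/BT//|s sT sF] := @move_off_seq b T F ub Tfin Ffin.
by exists s => // x /bB; exact: sF.
Qed.

(** The stabilizer of [S] is highly transitive off [S]: [s] and [t] encode two tuples of distinct
    points, and one transposition per entry carries the first tuple to the second. *)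
Lemma match_up_seq (b : seq I) S s t : uniq b ->
    (forall x, x \in b -> ~ S (s x) /\ ~ S (t x)) ->
  exists2 u, fixes S u & forall x, x \in b -> u (s x) = t x.
Proof.
elim: b => [|x b IH] /=; first by exists 1%g.
move=> /andP[xb ub] bS; have [sxS txS] := bS x (mem_head _ _).
have [//|y yb|u uS ub'] := IH; first by apply: bS; rewrite inE yb orbT.
exists (Sym_swap (u (s x)) (t x) * u)%g.
  apply: fixesM => // y Sy; apply: Sym_swapN => e; last by rewrite e in Sy.
  by rewrite e in Sy; exact: fixes_notin Sy.
move=> y; rewrite inE SymM => /orP[/eqP ->|yb]; first by rewrite Sym_swapL.
rewrite Sym_swapN; first exact: ub'.
  by move=> /Sym_inj/Sym_inj yx; rewrite -yx yb in xb.
by rewrite ub' // => /Sym_inj yx; rewrite -yx yb in xb.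
Qed.

Lemma match_up B S s t : finite_set B ->
    (forall x, B x -> ~ S (s x) /\ ~ S (t x)) ->
  exists2 u, fixes S u & forall x, B x -> u (s x) = t x.
Proof.
move=> Bfin BS.
have [b ub bB] := finite_set_seq Bfin.
have [x /bB/BS//|u uS ub'] := @match_up_seq b S s t ub.
by exists u => // x /bB; exact: ub'.
Qed.

End symmetric_group.

(** Substitute for averaging over [K]: isometries preserving [C] preserve its closure, hence the
    unique point of least norm there. *)
Lemma invariant_min (R : realType) (H : hilbertType R) (C : set H)
    (K : set (orthogonal_group H)) :
  (forall x y, C x -> C y -> C (2^-1 *: (x + y))) -> C !=set0 ->
  (forall u x, K u -> C x -> C (u x)) ->
  exists2 m, closure C m & forall u, K u -> u m = m.
Proof.
move=> Cmid [x0 Cx0] CK.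
have cmid x y : closure C x -> closure C y -> closure C (2^-1 *: (x + y)).
  move=> /closure_normP Cx /closure_normP Cy; apply/closure_normP => e e0.
  have [x' Cx' xx'] := Cx e e0; have [y' Cy' yy'] := Cy e e0.
  exists (2^-1 *: (x' + y')); first exact: Cmid.
  rewrite -scalerBr opprD addrACA normrZ ger0_norm ?invr_ge0//.
  have := ler_normD (x - x') (y - y'); lra.
have [|m Cm mC] := min_norm_exists (@closed_closure _ C) cmid.
  by exists x0; exact: subset_closure.
exists m => // u Ku; apply: (min_norm_unique cmid Cm _ mC); last by rewrite orth_norm.
move/closure_normP: Cm => Cm; apply/closure_normP => e e0.
have [v Cv mv] := Cm e e0; exists (u v); first exact: CK.
by rewrite -orthB orth_norm.
Qed.

(** * Fixed spaces of finite sets and their independence *)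

Section symmetric_rep.
Context (R : realType) (H : hilbertType R) (I : choiceType).
Hypothesis I_inf : infinite_set [set: I].
Variable V : Sym I -> orthogonal_group H.
Hypothesis VM : {morph V : s t / (s * t)%g >-> (s * t)%g}.
Implicit Types (s t : Sym I) (S T F : set I) (x y : H).

Definition fixed_vectors S : set H := [set x | forall s, fixes S s -> V s x = x].

(** As an orthogonal complement, the fixed space is closed and linear at once, so that one can
    project onto it. *)
Lemma fixed_vectors_perp S :
  fixed_vectors S = perp [set z | exists s y, fixes S s /\ z = V s y - y].
Proof.
apply/seteqP; split=> [x xS _ [s [y [sS ->]]]|x xS s sS].
  rewrite ipBr [ip x (V s y)]ipC orth_ipV -(repV VM) xS ?(ipC y) ?subrr//.
  exact: fixesV.
apply: ip_ext => y; rewrite orth_ipV -(repV VM); apply/eqP.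
rewrite -subr_eq0 -ipBr xS//; exists s^-1%g, y; split => //.
exact: fixesV.
Qed.

Lemma fixed_vectors_closed S : closed (fixed_vectors S).
Proof. by rewrite fixed_vectors_perp; exact: perp_closed. Qed.

Lemma fixed_vectors_lin S (a : R) x y :
  fixed_vectors S x -> fixed_vectors S y -> fixed_vectors S (a *: x + y).
Proof. by rewrite fixed_vectors_perp; exact: perp_lin. Qed.

Lemma fixed_vectors0 S : fixed_vectors S 0.
Proof. by move=> s _; exact: orth0. Qed.

Lemma fixed_vectorsS S T : S `<=` T -> fixed_vectors S `<=` fixed_vectors T.
Proof. by move=> ST x xS s sT; apply: xS; exact: fixesS sT. Qed.

Lemma fixed_vectors_image s S x : fixed_vectors S x -> fixed_vectors (s @` S) (V s x).
Proof.
move=> xS t tS; rewrite -orthM -VM -[(t * s)%g](mulVKg s) VM orthM xS//.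
by move=> i Si; rewrite !SymM tS ?SymK//; exists i.
Qed.

(** [t^-1 * s] fixes [S] pointwise. Thus [V s x] depends only on the places to which [s] sends [S],
    which [match_up] can control. *)
Lemma fixed_vectors_eq S s t x : fixed_vectors S x ->
  (forall i, S i -> s i = t i) -> V s x = V t x.
Proof.
move=> xS st; rewrite -[s](mulVKg t) VM orthM xS// => i Si.
by rewrite SymM st// SymK.
Qed.

Section independence.
Variables (S T : set I) (x : H).
Hypotheses (S_fin : finite_set S) (T_fin : finite_set T).
Hypotheses (x_fixed : fixed_vectors S x).
Hypothesis x_perp : perp (fixed_vectors (S `&` T)) x.

Let off F s := forall i, (S `\` T) i -> ~ F (s i).

Let off_const s t : fixes (S `&` T) s -> fixes (S `&` T) t ->
  off S s -> off S t -> ip x (V s x) = ip x (V t x).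
Proof.
move=> sA tA sS tS.
(* This [u] fixes [S], hence [x], and carries [V s x] to [V t x]. *)
have [i Bi|u uS ust] := @match_up I (S `\` T) S s t (finite_setD _ S_fin).
  by split; [exact: sS|exact: tS].
rewrite -(@fixed_vectors_eq S (u * s)%g t x)//.
  by rewrite VM orthM [RHS]ipC orth_ipV -(repV VM) (x_fixed (fixesV uS)) ipC.
move=> i Si; rewrite SymM; have [Ti|nTi] := pselect (T i); last by apply: ust.
by rewrite sA ?tA//; exact: uS.
Qed.

Let A_fin : finite_set (S `&` T).
Proof. exact: finite_setIl. Qed.

Let off_ip_eq0 s : fixes (S `&` T) s -> off S s -> ip x (V s x) = 0.
Proof.
move=> sA sS; set c := ip _ _.
(* [C] contains the convex hull of the orbit of [x]; the point of minimal norm of its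
   closure is 0, since it is both fixed by, and orthogonal to the vectors fixed by, the
   stabilizer of [S `&` T]. *)
pose C : set H := [set v | perp (fixed_vectors (S `&` T)) v /\
  exists2 F, finite_set F & forall t, fixes (S `&` T) t -> off F t -> ip v (V t x) = c].
have Cx : C x.
  by split => //; exists S => // t tA tS; exact: off_const.
have Cmid u v : C u -> C v -> C (2^-1 *: (u + v)).
  move=> [uA [F Ff uF]] [vA [F' F'f vF']]; split.
    rewrite scalerDr; apply: perp_lin => //.
    by rewrite -[_ *: v]addr0; apply: perp_lin => //; exact: perp0.
  exists (F `|` F'); first by rewrite finite_setU.
  move=> t tA tF; rewrite ipZl ipDl uF// ?vF'//; first by field.
    by move=> i Bi Fi; apply: (tF i Bi); right.
  by move=> i Bi Fi; apply: (tF i Bi); left.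
have CK t v : fixes (S `&` T) t -> C v -> C (V t v).
  move=> tA [vA [F Ff vF]]; split.
    by move=> z zA; rewrite orth_ipV -(repV VM) zA ?vA//; exact: fixesV.
  exists (t @` F); first exact: finite_image.
  move=> t' t'A t'F; rewrite orth_ipV -(repV VM) -orthM -VM; apply: vF.
    by apply: fixesM => //; exact: fixesV.
  move=> i Bi Fi; apply: (t'F i Bi); exists ((t^-1 * t' : Sym I)%g i) => //.
  by rewrite SymM SymVK.
have [|u v [t tA <-]|m Cm mK] := invariant_min (K := V @` fixes (S `&` T)) Cmid.
- by exists x.
- exact: CK.
have mA : fixed_vectors (S `&` T) m by move=> t tA; apply: mK; exists t.
have m0 : m = 0.
  apply: ip_eq0; apply/eqP; rewrite -normr_le0; apply/ler_addgt0Pr => e e0.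
  have K0 : 0 < `|m| + 1 by rewrite ltr_wpDl.
  have [v [vA _] mv] := (closure_normP _ _).1 Cm _ (divr_gt0 e0 K0).
  rewrite add0r -[X in ip X _](subrK v) ipDl (vA _ mA) addr0.
  apply: (le_trans (cauchy_schwarz _ _)).
  apply: (@le_trans _ _ (`|m - v| * (`|m| + 1))); first by rewrite ler_wpM2l// lerDl.
  by rewrite -ler_pdivlMr// ltW.
(* Elements [v] of [C] come arbitrarily close to [m = 0], and [c = ip v (V t x)] for some [t], where
   [V t x] has the norm of [x]; so [c] is arbitrarily small. *)
apply/eqP; rewrite -normr_le0; apply/ler_addgt0Pr => e e0.
have K0 : 0 < `|x| + 1 by rewrite ltr_wpDl.
have [v [_ [F Ff vF]]] := (closure_normP _ _).1 Cm _ (divr_gt0 e0 K0).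
rewrite m0 sub0r normrN add0r => ve.
have [|t tA tF] := @move_off I I_inf (S `\` T) (S `&` T) F (finite_setD _ S_fin) A_fin Ff.
  by move=> i [_ nTi] [].
rewrite -(vF t tA tF); apply: (le_trans (cauchy_schwarz _ _)); rewrite orth_norm.
apply: (@le_trans _ _ (`|v| * (`|x| + 1))); first by rewrite ler_wpM2l// lerDl.
by rewrite -ler_pdivlMr// ltW.
Qed.

(** Adding up N pairwise orthogonal translates of [x] by permutations fixing [T] multiplies the
    inner product with [z] by N but the norm only by the square root of N; Cauchy-Schwarz for every
    N forces the product to be 0. *)
Lemma fixed_vectors_perp_independent : perp (fixed_vectors T) x.
Proof.
move=> z zT; set a := ip x z.
(* [F] contains the places already used: a translate that avoids them is orthogonal to the sum [v]
   built so far. *)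
pose far N v := [/\ ip v z = N%:R * a, `|v| ^+ 2 = N%:R * `|x| ^+ 2 &
  exists2 F, finite_set F & forall t, fixes T t -> off F t -> ip v (V t x) = 0].
have farN N : exists v, far N v.
  elim: N => [|N [v [vz vv [F Ff vF]]]].
    exists 0; split; rewrite ?ip0l ?normr0 ?mul0r ?expr0n//.
    by exists set0 => // t _ _; rewrite ip0l.
  have [||t tT tF] := @move_off I I_inf (S `\` T) T (F `|` S) (finite_setD _ S_fin) T_fin.
  - by rewrite finite_setU.
  - by move=> i [].
  exists (v + V t x); split.
  - by rewrite ipDl vz orth_ipV -(repV VM) zT ?mulrSr ?mulrDl ?mul1r//; exact: fixesV.
  - rewrite -ipxx !(ipDl, ipDr) [ip (V t x) v]ipC vF//; last first.
      by move=> i Bi Fi; apply: (tF i Bi); left.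
    by rewrite orth_ip !ipxx vv mulrSr mulrDl mul1r; ring.
  - exists (F `|` t @` S); first by rewrite finite_setU; split => //; exact: finite_image.
    move=> t' t'T t'F; rewrite ipDl vF//; last first.
      by move=> i Bi Fi; apply: (t'F i Bi); left.
    rewrite add0r orth_ipV -(repV VM) -orthM -VM; apply: off_ip_eq0.
      by apply: fixesS (fixesM (fixesV tT) t'T) => i [].
    move=> i Bi Si; apply: (t'F i Bi); right; exists ((t^-1 * t' : Sym I)%g i) => //.
    by rewrite SymM SymVK.
have bound N : N%:R * a ^+ 2 <= (`|x| * `|z|) ^+ 2.
  case: N => [|N]; first by rewrite mul0r sqr_ge0.
  have [v [vz vv _]] := farN N.+1.
  have := cauchy_schwarz v z; rewrite vz => h.
  have : (N.+1%:R * a) ^+ 2 <= (`|v| * `|z|) ^+ 2.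
    by rewrite -real_normK ?num_real// ler_pXn2r ?nnegrE ?mulr_ge0.
  rewrite !exprMn vv -mulrA expr2 -mulrA ler_pM2l// ltr0n//.
have [/eqP|a0] := eqVneq (a ^+ 2) 0; first by rewrite sqrf_eq0 => /eqP.
have {}a0 : 0 < a ^+ 2 by rewrite lt_neqAle eq_sym a0 sqr_ge0.
have := bound (Num.bound ((`|x| * `|z|) ^+ 2 / a ^+ 2)).
rewrite leNgt -ltr_pdivrMr// archi_boundP//.
by rewrite divr_ge0 ?sqr_ge0// ltW.
Qed.

End independence.

Definition fixed_vectors_new S : set H :=
  [set x | fixed_vectors S x /\ forall T, T `<` S -> perp (fixed_vectors T) x].

Lemma fixed_vectors_new_image s S x :
  fixed_vectors_new S x -> fixed_vectors_new (s @` S) (V s x).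
Proof.
move=> [xS xT]; split; first exact: fixed_vectors_image.
move=> T [TS nST] z zT; rewrite orth_ipV -(repV VM).
suff sTS : (s^-1 : Sym I)%g @` T `<` S by exact: xT sTS _ (fixed_vectors_image zT).
split; first by move=> _ [j Tj <-]; have [k Sk <-] := TS _ Tj; rewrite SymK.
by move=> ST; apply: nST => _ [i /ST[j Tj <-] <-]; rewrite SymVK.
Qed.

(** If [S] lies in [T], it does so properly and [y] is orthogonal to its fixed space by definition.
    Otherwise the intersection is proper in [S], so [x] is orthogonal to its fixed space and
    independence applies. *)
Lemma fixed_vectors_new_orth S T x y : finite_set S -> finite_set T -> S <> T ->
  fixed_vectors_new S x -> fixed_vectors_new T y -> ip x y = 0.
Proof.
move=> Sf Tf ST [xS xS'] [yT yT'].
have [TS|nTS] := pselect (S `<=` T).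
  rewrite ipC; apply: (yT' S) => //; split => // TS'.
  by apply: ST; apply/seteqP; split.
apply: (@fixed_vectors_perp_independent S T x Sf Tf xS) => //; apply: xS'.
split; first exact: subIsetl.
by move=> SST; apply: nTS => i /SST[].
Qed.

Hypothesis V_cont : forall x (e : R), 0 < e -> exists2 J : set I, finite_set J &
  forall s, fixes J s -> `|V s x - x| <= e.
Hypothesis V_noinv : forall x, (forall s, V s x = x) -> x = 0.

Lemma fixed_vectors_total x :
  (forall S, finite_set S -> S !=set0 -> perp (fixed_vectors_new S) x) -> x = 0.
Proof.
move=> x_perp.
(* Induction on the size of [S]: the projection [v] of [x] is orthogonal to the fixed spaces of
   proper subsets, hence is new, and so orthogonal to [x], which forces [v = 0]. For empty [S],
   where nothing is assumed on [x], [v] is invariant and [V_noinv] applies. *)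
have xS S : finite_set S -> perp (fixed_vectors S) x.
  move=> Sf; have [n] := ubnP (size (finmap.enum_fset (fset_set S))).
  elim: n S Sf => // n IH S Sf Sn.
  have [v vS vw] := hilbert_projection x (@fixed_vectors_closed S)
    (ex_intro _ 0 (@fixed_vectors0 S)) (@fixed_vectors_lin S).
  suff v0 : v = 0 by rewrite -(subr0 x) -v0.
  have vnew : fixed_vectors_new S v.
    split => // T TS z zT.
    have zS : fixed_vectors S z by apply: fixed_vectorsS zT; exact: properW.
    rewrite -[v](subKr x) ipBl (vw _ zS) subr0.
    have TS' : T `<=` S by exact: properW.
    have Tf : finite_set T by exact: sub_finite_set Sf.
    apply: (IH T Tf _ _ zT); rewrite -ltnS; apply: leq_trans Sn; rewrite ltnS.
    apply: finmap.fproper_ltn_card; rewrite finmap.fproperE.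
    apply/andP; split; first by rewrite -fset_set_sub.
    by apply/negP; rewrite -fset_set_sub//; case: TS.
  have xv : ip x v = ip v v.
    by have := vw _ vS; rewrite ipBl => /eqP; rewrite subr_eq0 => /eqP.
  apply: ip_eq0; rewrite -xv.
  have [S0|/set0P S0] := eqVneq S set0; last exact: x_perp Sf S0 _ vnew.
  suff -> : v = 0 by rewrite ip0r.
  by apply: V_noinv => s; apply: vS; rewrite S0.
apply: ip_eq0; apply/eqP; rewrite -normr_le0; apply/ler_addgt0Pr => e e0; rewrite add0r.
have K0 : 0 < `|x| + 1 by rewrite ltr_wpDl.
have [J Jf Je] := V_cont x (divr_gt0 e0 K0); set d := e / _ in Je.
(* A vector fixed by the stabilizer of [J] is wanted near [x]. The orbit of [x] under this
   stabilizer stays within [d] of [x], so [C] contains [x]; its fixed point [m] is within [d] of [x]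
   (take [s = 1]) and orthogonal to [x], whence [|x|^2 <= |x| d]. *)
pose C : set H := [set v | forall s, fixes J s -> `|v - V s x| <= d].
have Ccl : closed C.
  rewrite (_ : C = \bigcap_(s in fixes J) ((fun v => `|v - V s x|) @^-1` [set r | r <= d])).
    apply: closed_bigI => s _; apply: closed_comp; last exact: closed_le.
    move=> v _; apply: cvg_norm.
    by apply: cvgB; [exact: cvg_id|exact: cvg_cst].
  by apply/seteqP; split.
have [u v uC vC s sJ||_ v [s sJ <-] vC t tJ|m Cm mJ] := @invariant_min R H C (V @` fixes J).
- rewrite (_ : _ - _ = 2^-1 *: (u - V s x) + 2^-1 *: (v - V s x)).
    rewrite (le_trans (ler_normD _ _))// !normrZ ger0_norm ?invr_ge0//.
    have := uC _ sJ; have := vC _ sJ; lra.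
  rewrite -scalerDr addrACA -opprD scalerBr; congr (_ - _).
  rewrite -(scale1r (V s x)) -scalerDl scalerA (_ : 2^-1 * _ = 1) ?scale1r//.
  by field.
- by exists x => s sJ; rewrite distrC Je.
- rewrite -[V t x]orth1 -(mulgV (V s)) orthM -orthB orth_norm -(repV VM) -orthM -VM.
  by apply: vC; exact: fixesM (fixesV sJ) tJ.
have {}Cm : C m by rewrite ((closure_id C).1 Ccl).
have := Cm 1%g (@fixes1 _ _); rewrite (rep1 VM) orth1 => mx.
have xm : ip x m = 0 by apply: (xS J Jf) => s sJ; apply: mJ; exists s.
rewrite -[X in ip _ X](subKr m) ipBr xm sub0r -ipNr opprB.
rewrite (le_trans (cauchy_schwarz _ _))//.
apply: (@le_trans _ _ ((`|x| + 1) * d)); last by rewrite mulrC divfK// gt_eqF.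
by rewrite ler_pM// ?lerDl// distrC.
Qed.

Theorem symmetric_rep_multiple (G : groupType) (alpha : G -> Sym I)
    (alphaM : {morph alpha : g h / (g * h)%g >-> (g * h)%g})
    (alpha_free : forall g S, g != 1%g -> finite_set S -> S !=set0 -> alpha g @` S <> S)
    (r : G -> orthogonal_group H) :
  (forall g, r g = V (alpha g)) -> is_multiple_of r (@regular_rep R G).
Proof.
move=> rV; have rM : {morph r : g h / (g * h)%g >-> (g * h)%g}.
  by move=> g h; rewrite !rV alphaM VM.
have alpha1 : alpha 1%g = 1%g by apply: (@mulgI _ (alpha 1%g)); rewrite -alphaM !mulg1.
have alphaV g : alpha g^-1%g = (alpha g)^-1%g.
  by apply: (@mulgI _ (alpha g)); rewrite -alphaM !mulgV alpha1.
pose orbit S : set (set I) := [set alpha g @` S | g in [set: G]].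
have orbit_image g S : orbit (alpha g @` S) = orbit S.
  apply/seteqP; split=> [_ [h _ <-]|_ [h _ <-]].
    by exists (h * g)%g => //; rewrite alphaM Sym_imageM.
  by exists (h * g^-1)%g => //; rewrite alphaM alphaV Sym_imageM Sym_imageKV.
(* The choice depends only on the orbit as a set, so equal orbits get the same representative. *)
pose rep S := xget set0 (orbit S).
have repP S : exists g, rep S = alpha g @` S.
  have [g _ gS] : orbit S (rep S); last by exists g.
  by apply: xgetPex; exists S, 1%g; rewrite ?alpha1 ?Sym_image1.
pose W : set H := [set x | exists S, [/\ finite_set S, S !=set0, rep S = S &
  fixed_vectors_new S x]].
apply: (@wandering_multiple R G H r rM W) => [g w w' g1|x xW].
  move=> [S [Sf S0 rS wS]] [S' [S'f S'0 rS' wS']]; rewrite rV.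
  apply: (fixed_vectors_new_orth _ S'f _ (fixed_vectors_new_image _ wS) wS').
    exact: finite_image.
  (* Two representatives in one orbit coincide, so [alpha g] would preserve [S]. *)
  move=> gSS'; apply: (alpha_free g S g1 Sf S0).
  by rewrite gSS' -rS -rS' -gSS' /rep orbit_image.
apply: fixed_vectors_total => S Sf S0 z zS.
have [g repS] := repP S.
have -> : z = r g^-1%g (r g z) by rewrite -orthM -rM mulVg (rep1 rM).
apply: xW; exists (rep S); split.
- by rewrite repS; exact: finite_image.
- by rewrite repS; case: S0 => i Si; exists (alpha g i), i.
- by rewrite repS /rep orbit_image -/(rep S) repS.
- by rewrite repS rV; exact: fixed_vectors_new_image.
Qed.

End symmetric_rep.

(** * Free groups are torsion-free *)

Section free_group_torsion.
Local Open Scope group_scope.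
Variable A : choiceType.
Implicit Types (x y : free_group A) (l m : letter A) (u v w : seq (letter A)).

Local Notation ok := (fun l m => m != linv l).

Lemma wmul_cat u v : reduced (u ++ v) -> wmul u v = u ++ v.
Proof.
elim: u => //= l u IH luv.
rewrite IH; last by case: (u ++ v) luv => //= m w /andP[].
by case: (u ++ v) luv => //= m w /andP[/negPf ->].
Qed.

(* A nonempty word whose last letter does not cancel its first has no cancellation in any of its powers. *)
Lemma cyclically_reduced_expg l u x n :
  val x = l :: u -> l != linv (last l u) -> val (x ^+ n.+1) = flatten (nseq n.+1 (l :: u)).
Proof.
move=> xE lu; have red : path ok l u by have := valP x; rewrite xE.
suff H k : val (x ^+ k) = flatten (nseq k (l :: u)) /\ path ok l (u ++ flatten (nseq k (l :: u))).
  exact: (H n.+1).1.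
elim: k => [|k [IH1 IH2]]; first by split; rewrite //= cats0.
have E : val (x ^+ k.+1) = flatten (nseq k.+1 (l :: u)).
  by rewrite expgS -[LHS]/(wmul (val x) (val (x ^+ k))) xE IH1 wmul_cat.
split => //; rewrite cat_path red /=.
by rewrite lu.
Qed.

(** A shortest counterexample is not cyclically reduced, as its powers would be nonempty words;
    conjugating by its first letter then removes both end letters, against minimality. *)
Lemma free_group_torsion_free x n : x ^+ n.+1 = 1 -> x = 1.
Proof.
move=> xn.
pose P k := `[< exists2 y : free_group A, y ^+ n.+1 = 1 & y <> 1 /\ size (val y) = k >].
apply: contrapT => x1.
have Pex : exists k, P k by exists (size (val x)); apply/asboolP; exists x.
case: (ex_minnP Pex) => k /asboolP[y yn [y1 yk]] kmin.
case E : (val y) => [|l u]; first by apply: y1; apply: val_inj; rewrite E.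
have [lu|lu] := eqVneq l (linv (last l u)); last first.
  by have := cyclically_reduced_expg n E lu; rewrite yn.
(* In a one-letter word the letter would be its own inverse. *)
case/lastP: u E lu => [|u m] E.
  by case: l {E} => a b /= [] /eqP; case: b.
rewrite last_rcons => lm.
pose g : free_group A := Sub [:: l] isT.
have zE : val (y ^ g : free_group A) = u.
  have red : reduced (l :: u) by have := valP y; rewrite E /= rcons_path => /andP[].
  have yl : wmul (l :: rcons u m) [:: l] = l :: u.
    rewrite -rcons_cons /wmul foldr_rcons (_ : lcons m [:: l] = [::]).
      by have := @wmul_cat (l :: u) [::]; rewrite cats0; exact.
    by rewrite /= lm eqxx.
  rewrite -[LHS]/(wmul (winv [:: l]) (wmul (val y) [:: l])) E yl.
  by rewrite /winv /= lm linvK eqxx.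
have : (k <= size u)%N.
  apply: kmin; apply/asboolP; exists (y ^ g); first by rewrite -conjXg yn conj1g.
  split=> [z1|]; last by rewrite zE.
  by apply: y1; rewrite -(conjgK g y) z1 conj1g.
by rewrite -yk E /= size_rcons ltnNge leqnSn.
Qed.

End free_group_torsion.

(** * Automorphisms of measure algebras *)

Section measure_algebra.
Context d (X : measurableType d) (R : realType) (P : probability X R).
Implicit Types (A B C D : mset X) (a b c : MAlg P) (T U : AutMAlg P).

Local Notation cl := (mclass P).

Lemma mclass_eq A B : (A : set X) = B -> cl A = cl B.
Proof. by move=> AB; apply/mclassP; rewrite AB setYK measure0. Qed.

Lemma mclass_surj a : exists A, a = cl A.
Proof. by exists (repr a); rewrite mclass_repr. Qed.

Lemma fine_prob_le (A B : set X) : measurable A -> measurable B -> A `<=` B ->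
  fine (P A) <= fine (P B).
Proof.
move=> mA mB AB; rewrite fine_le ?fin_num_measure//.
by apply: le_measure; rewrite ?inE.
Qed.

Lemma fine_probU_le (A B : set X) : measurable A -> measurable B ->
  fine (P (A `|` B)) <= fine (P A) + fine (P B).
Proof.
move=> mA mB; rewrite -fineD ?fin_num_measure// fine_le ?fin_num_measure//.
- exact: measurableU.
- by rewrite fin_numD !fin_num_measure.
- exact: measureU2.
Qed.

Lemma MAlg_dist_sub A B A' B' C D :
  C `+` D `<=` (A `+` A') `|` (B `+` B') ->
  MAlg_dist (cl C) (cl D) <= MAlg_dist (cl A) (cl A') + MAlg_dist (cl B) (cl B').
Proof.
move=> s; rewrite !MAlg_distE; apply: le_trans (fine_probU_le _ _).
- apply: fine_prob_le => //; first exact: measurable_setY.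
  by apply: measurableU; exact: measurable_setY.
- exact: measurable_setY.
- exact: measurable_setY.
Qed.

Lemma MAlg_distU a b a' b' :
  MAlg_dist (MAlgU a b) (MAlgU a' b') <= MAlg_dist a a' + MAlg_dist b b'.
Proof.
have [A ->] := mclass_surj a; have [B ->] := mclass_surj b.
have [A' ->] := mclass_surj a'; have [B' ->] := mclass_surj b'.
rewrite !MAlgUE ?(measurableU _ _ (measurable_mset _) (measurable_mset _))//.
- exact: measurableU.
- exact: measurableU.
- by move=> m1 m2; apply: MAlg_dist_sub; exact: setYU_sub.
Qed.

Lemma MAlg_distI a b a' b' :
  MAlg_dist (MAlgI a b) (MAlgI a' b') <= MAlg_dist a a' + MAlg_dist b b'.
Proof.
have [A ->] := mclass_surj a; have [B ->] := mclass_surj b.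
have [A' ->] := mclass_surj a'; have [B' ->] := mclass_surj b'.
rewrite !MAlgIE.
- exact: measurableI.
- exact: measurableI.
- by move=> m1 m2; apply: MAlg_dist_sub; exact: setYI_sub.
Qed.

Lemma MAlg_distY a b a' b' :
  MAlg_dist (MAlgY a b) (MAlgY a' b') <= MAlg_dist a a' + MAlg_dist b b'.
Proof.
have [A ->] := mclass_surj a; have [B ->] := mclass_surj b.
have [A' ->] := mclass_surj a'; have [B' ->] := mclass_surj b'.
by rewrite !MAlgYE; apply: MAlg_dist_sub; exact: setYY_sub.
Qed.

Lemma MAlg_mu_dist a b : `|MAlg_mu a - MAlg_mu b| <= MAlg_dist a b.
Proof.
have [A ->] := mclass_surj a; have [B ->] := mclass_surj b.
have h (C D : mset X) : fine (P C) <= fine (P D) + fine (P (C `+` D)).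
  apply: le_trans (fine_probU_le _ _) => //; last exact: measurable_setY.
  apply: fine_prob_le => //; first by apply: measurableU => //; exact: measurable_setY.
  by move=> x /= Cx; case: (pselect ((D : set X) x)); tauto.
rewrite !MAlg_muE MAlg_distE ler_norml.
have := h A B; have := h B A; rewrite [(B : set X) `+` A]setYC; lra.
Qed.

(** For nested sets, control of the measures alone controls the distance; this is what
    [nested_matching] is made to exploit. *)
Lemma MAlg_dist_nested A B : A `<=` B \/ B `<=` A ->
  MAlg_dist (cl A) (cl B) = `|MAlg_mu (cl A) - MAlg_mu (cl B)|.
Proof.
have h (C D : mset X) : C `<=` D ->
    MAlg_dist (cl C) (cl D) = `|MAlg_mu (cl C) - MAlg_mu (cl D)|.
  move=> CD; rewrite MAlg_distE !MAlg_muE distrC.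
  have mDC : measurable ((D : set X) `\` C) by exact: measurableD.
  have -> : (C : set X) `+` D = (D : set X) `\` C.
    by apply/seteqP; split=> x /=; have := CD x; tauto.
  have -> : fine (P D) = fine (P C) + fine (P ((D : set X) `\` C)).
    rewrite -fineD ?fin_num_measure// -measureU//; last first.
      by apply/seteqP; split=> x //= -[? []].
    congr (fine (P _)); apply/seteqP; split=> x /=; have := CD x; last tauto.
    by case: (pselect ((C : set X) x)); tauto.
  by rewrite addrAC subrr add0r ger0_norm// fine_ge0.
by case=> [|BA]; [exact: h|rewrite MAlg_dist_sym distrC h].
Qed.

Lemma AutMAlgP T : MAlg_iso T.
Proof. exact: set_mem (valP T). Qed.

Lemma AutMAlg_ext T U : (forall a, T a = U a) -> T = U.
Proof. by move=> TU; apply/val_inj/SymP. Qed.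

Lemma AutMAlgM T U a : (T * U : AutMAlg P)%g a = T (U a).
Proof. by []. Qed.

Lemma AutMAlgK T a : (T^-1 : AutMAlg P)%g (T a) = a.
Proof. exact: Sym_invK. Qed.

Lemma AutMAlg_dist T a b : MAlg_dist (T a) (T b) = MAlg_dist a b.
Proof. exact: (MAlg_iso_dist (AutMAlgP T)). Qed.

Definition measure_preserving (f : X -> X) : Prop :=
  measurable_fun setT f /\ forall A : set X, measurable A -> P (f @^-1` A) = P A.

Lemma measurable_preimage f (A : set X) :
  measurable_fun [set: X] f -> measurable A -> measurable (f @^-1` A).
Proof. by move=> mf mA; rewrite -[X in measurable X]setTI; exact: mf. Qed.

Section pullback.
Variable f : X -> X.
Hypothesis mf : measure_preserving f.

Definition preimage_mset A : mset X :=
  mset_of (measurable_preimage mf.1 (measurable_mset A)).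

Definition pullback a : MAlg P := cl (preimage_mset (repr a)).

Lemma pullbackE A : pullback (cl A) = cl (preimage_mset A).
Proof.
apply/mclassP => /=.
rewrite -[X in P X]/(f @^-1` ((repr (cl A) : mset X) `+` A)) mf.2 ?repr_mclass//.
exact: measurable_setY.
Qed.

End pullback.

(** Preimages under the inverse [g] are images under [f]. The result is stated through an equality
    of sets so that [B] may carry any proof of measurability. *)
Lemma pullback_aut f g (mf : measure_preserving f) (mg : measure_preserving g) :
  cancel f g -> cancel g f ->
  exists T, forall A B, (B : set X) = g @^-1` A -> T (cl A) = cl B.
Proof.
move=> fg gf.
have K h k (mh : measure_preserving h) (mk : measure_preserving k) :
    cancel h k -> cancel (pullback mk) (pullback mh).
  move=> hk a; have [A ->] := mclass_surj a; rewrite !pullbackE.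
  by apply: mclass_eq; apply/seteqP; split=> x; rewrite -[(preimage_mset _ _ : set X) x]/((A : set X) (k (h x))) hk.
have bij : bijective (pullback mg) by exists (pullback mf); exact: K.
have iso : MAlg_iso (pullback mg).
  split => //.
  - move=> a b; have [A ->] := mclass_surj a; have [B ->] := mclass_surj b.
    rewrite -[LHS]/(MAlg_dist _ _) -[RHS]/(MAlg_dist _ _) !pullbackE !MAlg_distE.
    congr fine; rewrite -[LHS]/(P (g @^-1` ((A : set X) `+` B))) mg.2//.
    exact: measurable_setY.
  - by rewrite pullbackE; apply: mclass_eq.
  - by rewrite pullbackE; apply: mclass_eq.
  - move=> a b; have [A ->] := mclass_surj a; have [B ->] := mclass_surj b.
    rewrite (MAlgUE P (measurableU _ _ (measurable_mset A) (measurable_mset B))).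
    rewrite !pullbackE (MAlgUE P (measurableU _ _ (measurable_mset _) (measurable_mset _))).
    exact: mclass_eq.
  - move=> a b; have [A ->] := mclass_surj a; have [B ->] := mclass_surj b.
    rewrite (MAlgIE P (measurableI _ _ (measurable_mset A) (measurable_mset B))).
    rewrite !pullbackE (MAlgIE P (measurableI _ _ (measurable_mset _) (measurable_mset _))).
    exact: mclass_eq.
  - move=> a b; have [A ->] := mclass_surj a; have [B ->] := mclass_surj b.
    by rewrite MAlgYE !pullbackE MAlgYE; apply: mclass_eq.
  - move=> a; have [A ->] := mclass_surj a.
    by rewrite pullbackE !MAlg_muE mg.2.
exists (SigSub (mem_set (iso : is_AutMAlg (Sym_of bij)))) => A B BA.
rewrite -[LHS]/(pullback mg (cl A)) pullbackE.
by apply: mclass_eq; rewrite BA.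
Qed.

End measure_algebra.

(** * The product space *)

Section cubes.
Variable I : choiceType.
Local Notation X := (product_space I bool).
Implicit Types (F J : seq I) (x y : X).

Definition restr F x : (size F).-tuple bool := map_tuple x (in_tuple F).

(* [ext t] is [false] off [F]. *)
Definition ext F (t : (size F).-tuple bool) : X := fun i => nth false t (index i F).

Lemma ext_restr F x i : i \in F -> ext (restr F x) i = x i.
Proof. by move=> iF; rewrite /ext /= (nth_map i) ?index_mem// nth_index. Qed.

Lemma restr_ext F (t : (size F).-tuple bool) : uniq F -> restr F (ext t) = t.
Proof.
move=> uF; apply: val_inj; rewrite /=; apply: (@eq_from_nth _ false).
  by rewrite size_map size_tuple.
move=> k; rewrite size_map => kF.
have i0 : I by move: kF; clear; case: F.
by rewrite (nth_map i0)// /ext index_uniq.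
Qed.

Lemma restr_eqP F x y : restr F x = restr F y <-> (forall i, i \in F -> x i = y i).
Proof.
split=> [/(congr1 val) /= /eq_in_map//|xy].
by apply: val_inj => /=; exact/eq_in_map.
Qed.

Definition cube J x0 : set X := [set x | forall i, i \in J -> x i = x0 i].

Definition cyl F (b : {set (size F).-tuple bool}) : set X := [set x | restr F x \in b].
Arguments cyl : clear implicits.

Lemma measurable_coord i (B : set bool) : measurable ((fun x : X => x i) @^-1` B).
Proof. by apply: sub_sigma_algebra; exists i, B. Qed.

Lemma measurable_cube J x0 : measurable (cube J x0).
Proof.
elim: J => [|i J IH].
  rewrite (_ : cube _ _ = setT); first exact: measurableT.
  by apply/seteqP; split.
rewrite (_ : cube _ _ = (fun x : X => x i) @^-1` [set x0 i] `&` cube J x0).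
  by apply: measurableI => //; exact: measurable_coord.
apply/seteqP; split=> [x xJ|x [xi xJ] j].
  by split; [apply: xJ; rewrite mem_head|move=> j jJ; apply: xJ; rewrite inE jJ orbT].
by rewrite inE => /orP[/eqP ->//|]; exact: xJ.
Qed.

Lemma measurable_cyl F (b : {set (size F).-tuple bool}) : measurable (cyl F b).
Proof.
rewrite (_ : cyl F b = \bigcup_(q in [set` b]) [set x | restr F x = q]).
  apply: fin_bigcup_measurable => // q _.
  have [[x0 x0q]|] := pselect (exists x0, restr F x0 = q); last first.
    move=> nq; rewrite (_ : [set _ | _] = set0); first exact: measurable0.
    by apply/seteqP; split=> // x xq; apply: nq; exists x.
  rewrite (_ : [set _ | _] = cube F x0); first exact: measurable_cube.
  by apply/seteqP; split=> x /=; rewrite -x0q => /restr_eqP.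
by apply/seteqP; split=> [x xb|x [q qb /= xq]]; [exists (restr F x)|rewrite /cyl /= xq].
Qed.

Definition mcyl F (b : {set (size F).-tuple bool}) : mset X := mset_of (measurable_cyl b).
Arguments mcyl : clear implicits.

Lemma cyl_widen F F' (b : {set (size F).-tuple bool}) : {subset F <= F'} ->
  exists b' : {set (size F').-tuple bool}, cyl F b = cyl F' b'.
Proof.
move=> FF'; exists [set t | restr F (ext t) \in b]%SET.
apply/seteqP; split=> x; rewrite /cyl /= inE.
  by rewrite (_ : restr F (ext _) = restr F x)//; apply/restr_eqP => i /FF'; exact: ext_restr.
by rewrite (_ : restr F (ext _) = restr F x)//; apply/restr_eqP => i /FF'; exact: ext_restr.
Qed.

Lemma measurable_to_product d (Y : measurableType d) (f : Y -> X) :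
  (forall i (B : set bool), measurable [set y | B (f y i)]) -> measurable_fun setT f.
Proof.
move=> mf; apply: measurability => //.
by move=> _ [_ [i [B [mB ->]] <-]]; rewrite setTI; exact: mf.
Qed.

(** Composition with [s] reverses products; preimages reverse them once more, so [coord_aut] is a
    morphism, and it sends coordinate [i] to coordinate [s i]. *)
Definition perm_coord (s : Sym I) (x : X) : X := fun i => x (s i).

Definition cube_perm F (tau : {perm (size F).-tuple bool}) (x : X) : X :=
  fun i => if i \in F then ext (tau (restr F x)) i else x i.

Lemma perm_coordK s : cancel (perm_coord s) (perm_coord s^-1%g).
Proof. by move=> x; apply/funext => i; rewrite /perm_coord SymVK. Qed.

Lemma perm_coordVK s : cancel (perm_coord s^-1%g) (perm_coord s).
Proof. by move=> x; apply/funext => i; rewrite /perm_coord SymK. Qed.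

Lemma measurable_perm_coord s : measurable_fun setT (perm_coord s : X -> X).
Proof. by apply: measurable_to_product => i B; exact: measurable_coord. Qed.

Section cube_perm.
Variables (F : seq I).
Hypothesis uF : uniq F.
Implicit Type tau : {perm (size F).-tuple bool}.

Lemma restr_cube_perm tau x : restr F (cube_perm tau x) = tau (restr F x).
Proof.
rewrite -[RHS]restr_ext//; apply/restr_eqP => i iF.
by rewrite /cube_perm iF.
Qed.

(** The product of [{perm _}] applies its left factor first, whence the reversed order. *)
Lemma cube_permM tau tau' x : cube_perm tau (cube_perm tau' x) = cube_perm (tau' * tau)%g x.
Proof.
apply/funext => i; rewrite {1}/cube_perm restr_cube_perm /cube_perm permM.
by case: (i \in F).
Qed.

Lemma cube_perm1 x : cube_perm (1%g : {perm (size F).-tuple bool}) x = x.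
Proof. by apply/funext => i; rewrite /cube_perm perm1; case: ifP => // /ext_restr ->. Qed.

Lemma cube_permK tau : cancel (cube_perm tau) (cube_perm tau^-1%g).
Proof. by move=> x; rewrite cube_permM fingroup.mulgV cube_perm1. Qed.

Lemma cube_permVK tau : cancel (cube_perm tau^-1%g) (cube_perm tau).
Proof. by move=> x; rewrite cube_permM fingroup.mulVg cube_perm1. Qed.

Lemma measurable_cube_perm tau : measurable_fun setT (cube_perm tau : X -> X).
Proof.
apply: measurable_to_product => i B; rewrite /cube_perm; case: (boolP (i \in F)) => _; last first.
  exact: measurable_coord.
rewrite (_ : [set _ | _] = cyl F [set t | ext (tau t) i \in B]%SET).
  exact: measurable_cyl.
apply/seteqP; split=> x; rewrite /cyl /= finset.inE; [exact: mem_set|exact: set_mem].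
Qed.

(** When [J] contains [F], the coordinates in [J] of the image depend only on those of the point, so
    the preimage is one cube over the same [J]. For a smaller [J] it would only be a union of
    cubes. *)
Lemma cube_perm_cube tau J x0 : {subset F <= J} ->
  cube_perm tau @^-1` cube J x0 = cube J (cube_perm tau^-1%g x0).
Proof.
have E x y : {subset F <= J} -> (forall i, i \in J -> x i = y i) ->
    forall (sigma : {perm (size F).-tuple bool}) i, i \in J -> cube_perm sigma x i = cube_perm sigma y i.
  move=> FJ xy sigma i iJ; rewrite /cube_perm; case: ifP => _; last exact: xy.
  by rewrite (_ : restr F x = restr F y)//; apply/restr_eqP => k /FJ; exact: xy.
move=> FJ; apply/seteqP; split=> x xJ i iJ.
  by rewrite -{1}(cube_permK tau x); exact: E xJ _ _ iJ.
by rewrite -(cube_permVK tau x0); exact: E xJ _ _ iJ.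
Qed.

End cube_perm.

Context (R : realType) (mu : probability X R).
Hypothesis mu_product : product_measure (bernoulli_prob (2^-1 : R)) mu.

Lemma bernoulli_half_set1 (b : bool) : bernoulli_prob (2^-1 : R) [set b] = (2^-1)%:E.
Proof.
rewrite bernoulli_probE; last by apply/andP; split; lra.
rewrite !diracE /unstable.onem.
have E (c d : bool) : (c \in [set d]) = (c == d).
  by apply/idP/idP => [/set_mem ->//|/eqP ->]; exact: mem_set.
rewrite !E; case: b => /=; rewrite mule1 mule0 ?adde0 ?add0e//.
by congr (_%:E); field.
Qed.

Lemma mu_cube J x0 : uniq J -> mu (cube J x0) = (\prod_(i <- J) (2^-1)%:E)%E.
Proof.
move=> uJ; have := @mu_product J (fun i => [set x0 i]) uJ (fun _ => Logic.I).
rewrite -[X in mu X = _]/(cube J x0) => ->; apply: eq_bigr => i _.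
exact: bernoulli_half_set1.
Qed.

Lemma cube_mem_eq J J' x0 : J =i J' -> cube J x0 = cube J' x0.
Proof.
by move=> JJ'; apply/seteqP; split=> x xJ i iJ; apply: xJ; rewrite ?JJ' // -JJ'.
Qed.

Lemma cube_split i J x0 (x1 := fun b j => if j == i then b else x0 j) : i \notin J ->
  cube J x0 = cube (i :: J) (x1 true) `|` cube (i :: J) (x1 false) /\
  cube (i :: J) (x1 true) `&` cube (i :: J) (x1 false) = set0.
Proof.
move=> iJ; have x1J b j : j \in J -> x1 b j = x0 j.
  by rewrite /x1; case: eqP => // -> jJ; rewrite jJ in iJ.
have x1i b : x1 b i = b by rewrite /x1 eqxx.
split; apply/seteqP; split=> // x.
- move=> xJ; have h b : x i = b -> cube (i :: J) (x1 b) x.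
    move=> xi j; rewrite inE => /orP[/eqP ->|jJ]; first by rewrite x1i.
    by rewrite x1J// xJ.
  by case E : (x i); [left|right]; exact: h.
- by move=> [] xJ j jJ; rewrite xJ ?x1J// inE jJ orbT.
- by move=> [/(_ i (mem_head _ _)) + /(_ i (mem_head _ _))]; rewrite !x1i => ->.
Qed.

(** Cubes, with the empty set added to make them stable under intersection, are a pi-system
    generating the sigma-algebra. The restriction to [J] containing [F] is made for [cube_perm]. *)
Lemma preserving_of_cubes F (f : X -> X) : measurable_fun setT f ->
  (forall J x0, uniq J -> {subset F <= J} -> mu (f @^-1` cube J x0) = mu (cube J x0)) ->
  measure_preserving mu f.
Proof.
move=> mf fF; split => //.
have mpre A : measurable A -> measurable (f @^-1` A) by exact: measurable_preimage.
(* A cube over [J] is the disjoint union of two cubes over [i :: J], so the equality survives the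
   removal of [i]; removing [F] from [F ++ J] reaches any [J]. *)
have drop i J : (forall x0, mu (f @^-1` cube (i :: J) x0) = mu (cube (i :: J) x0)) ->
    forall x0, mu (f @^-1` cube J x0) = mu (cube J x0).
  move=> iJE x0; have [iJ|iJ] := boolP (i \in J).
    rewrite (@cube_mem_eq J (i :: J)) ?iJE// => j; rewrite inE.
    by case: eqP => // ->.
  have [-> dis] := cube_split x0 iJ.
  have mc y := measurable_cube (i :: J) y.
  rewrite preimage_setU measureU//; [|apply: mpre; exact: mc|apply: mpre; exact: mc|].
    by rewrite measureU//; congr (_ + _)%E; exact: iJE.
  by rewrite -preimage_setI dis preimage_set0.
have cubeE J x0 : mu (f @^-1` cube J x0) = mu (cube J x0).
  have : forall x0, mu (f @^-1` cube (F ++ J) x0) = mu (cube (F ++ J) x0).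
    move=> y; have E : undup (F ++ J) =i F ++ J by move=> j; rewrite mem_undup.
    rewrite -!(cube_mem_eq _ E) fF ?undup_uniq// => j jF.
    by rewrite E mem_cat jF.
  move: F {fF} => F; elim: F => [|i F IH] h; first exact: h.
  by apply: IH; exact: drop h.
move=> A mA.
pose G : set (set X) := [set C | C = set0 \/ exists J x0, C = cube J x0].
have GT : G setT.
  by right; exists [::], (fun=> false); apply/seteqP; split.
have mG : @measurable _ X = <<s G >>.
  apply/seteqP; split.
    apply: smallest_sub; first exact: smallest_sigma_algebra.
    move=> _ [i [B [_ ->]]].
    rewrite (_ : _ @^-1` B = \bigcup_(b in B) cube [:: i] (fun=> b)).
      apply: (@fin_bigcup_measurable _ (@g_sigma_algebraType X G)) => [|b _].
        exact: finite_finset.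
      by apply: sub_sigma_algebra; right; exists [:: i], (fun=> b).
    apply/seteqP; split=> [x Bx|x [b Bb xb]].
      by exists (x i) => // j; rewrite inE => /eqP ->.
    by rewrite /= (xb i) ?mem_head.
  apply: smallest_sub; first exact: sigma_algebra_measurable.
  by move=> _ [->|[J [x0 ->]]]; [exact: measurable0|exact: measurable_cube].
apply/esym; apply: (@measure_unique _ _ X G (fun=> setT) mG _ _ _ mu (measure_function_pushforward__canonical__measure_function_Measure mu mf)).
- move=> C D [->|[J [x0 ->]]]; first by rewrite set0I; left.
  move=> [->|[J' [x0' ->]]]; first by rewrite setI0; left.
  have [[x1 [x1J x1J']]|nx] := pselect (exists x, cube J x0 x /\ cube J' x0' x); last first.
    by left; apply/seteqP; split=> // x [xJ xJ']; apply: nx; exists x.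
  right; exists (J ++ J'), x1; apply/seteqP; split=> x.
    move=> [xJ xJ'] i; rewrite mem_cat => /orP[iJ|iJ'].
      by rewrite xJ// x1J.
    by rewrite xJ'// x1J'.
  move=> xJ; split=> i iJ; rewrite xJ ?mem_cat ?iJ ?orbT//.
    exact: x1J.
  exact: x1J'.
- by [].
- by rewrite bigcup_const.
- by move=> C [->|[J [x0 ->]]]; [rewrite !measure0|exact: (esym (cubeE _ _))].
- by move=> _; rewrite [X in (X < _)%E](probability_setT mu) ltry.
- exact: mA.
Qed.

Lemma perm_coord_preserving s : measure_preserving mu (perm_coord s).
Proof.
apply: (@preserving_of_cubes [::]) => [|J x0 uJ _]; first exact: measurable_perm_coord.
have -> : perm_coord s @^-1` cube J x0 = cube (map s J) (perm_coord s^-1%g x0).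
  apply/seteqP; split=> x xJ i.
    by move=> /mapP[j jJ ->]; rewrite /perm_coord SymK; exact: xJ.
  move=> iJ; rewrite /perm_coord xJ ?map_f//.
  by rewrite /perm_coord SymK.
rewrite !mu_cube ?map_inj_uniq//; last exact: Sym_inj.
by rewrite big_map.
Qed.

Lemma cube_perm_preserving F (tau : {perm (size F).-tuple bool}) : uniq F ->
  measure_preserving mu (cube_perm tau).
Proof.
move=> uF; apply: (@preserving_of_cubes F) => [|J x0 uJ FJ].
  exact: measurable_cube_perm.
by rewrite cube_perm_cube// !mu_cube.
Qed.

End cubes.
Arguments cyl {I} F b.
Arguments mcyl {I} F b.

(* A permutation maximizing the number of agreements works: otherwise a transposition increases it. *)
Lemma nested_matching (Q : finType) (L : eqType) (p l : Q -> L) :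
  exists tau : {perm Q}, forall q,
    (forall r, p r = q -> l (tau r) = q) \/ (forall r, l (tau r) = q -> p r = q).
Proof.
pose m (tau : {perm Q}) := #|[set r | l (tau r) == p r]%SET|.
have [//|tau _ tau_max] := @arg_maxnP {perm Q} 1%g xpredT m.
exists tau => q; apply: contrapT => /not_orP[/existsNP[r0 /not_implyP[pr0 lr0]]].
move=> /existsNP[r1 /not_implyP[lr1 pr1]].
have := tau_max (tperm r0 r1 * tau)%g isT; apply/negP; rewrite -ltnNge.
apply: proper_card; apply/properP; split; last first.
  exists r0; first by rewrite inE permM tpermL lr1 pr0.
  by rewrite inE pr0; apply/eqP.
apply/fintype.subsetP => r; rewrite !inE permM => /eqP rE.
have [rr0|rr0] := eqVneq r r0; first by move: rE; rewrite rr0 pr0.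
have [rr1|rr1] := eqVneq r r1; first by move: rE; rewrite rr1 lr1 => /esym.
by rewrite tpermD 1?eq_sym// rE.
Qed.

Lemma setYCC T (A B : set T) : (~` A) `+` (~` B) = A `+` B.
Proof.
by apply/seteqP; split=> x /=; case: (pselect (A x)); case: (pselect (B x)); tauto.
Qed.

(** * Density of cylinders, and automorphisms induced by point maps *)

Section cylinders_dense.
Context (I : choiceType) (R : realType).
Local Notation X := (product_space I bool).
Variable mu : probability X R.
Local Notation cl := (mclass mu).
Implicit Types (F J : seq I).

Lemma MAlg_dist_set_eq (A B : mset X) : (A : set X) = B -> MAlg_dist (cl A) (cl B) = 0.
Proof. by move=> AB; rewrite (mclass_eq mu AB) MAlg_distxx. Qed.

Lemma cylU F (b b' : {set (size F).-tuple bool}) : cyl F (b :|: b') = cyl F b `|` cyl F b'.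
Proof.
by apply/seteqP; split=> x; rewrite /cyl /= finset.inE => /orP.
Qed.

Lemma cylI F (b b' : {set (size F).-tuple bool}) : cyl F (b :&: b') = cyl F b `&` cyl F b'.
Proof.
by apply/seteqP; split=> x; rewrite /cyl /= finset.inE => /andP.
Qed.

Lemma cylC F (b : {set (size F).-tuple bool}) : cyl F (~: b) = ~` cyl F b.
Proof.
by apply/seteqP; split=> x; rewrite /cyl /= finset.inE => /negP.
Qed.

Let approximable (a : MAlg mu) := forall e : R, 0 < e ->
  exists F (b : {set (size F).-tuple bool}), MAlg_dist a (cl (mcyl F b)) < e.

Let approximableU a b : approximable a -> approximable b -> approximable (MAlgU a b).
Proof.
move=> ha hb e e0; have e2 : 0 < e / 2 by rewrite divr_gt0.
have [F [c ac]] := ha _ e2; have [F' [c' bc']] := hb _ e2.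
have [|k ck] := @cyl_widen _ F (F ++ F') c; first by move=> i; rewrite mem_cat => ->.
have [|k' ck'] := @cyl_widen _ F' (F ++ F') c'.
  by move=> i; rewrite mem_cat => ->; rewrite orbT.
exists (F ++ F'), (k :|: k').
have -> : cl (mcyl (F ++ F') (k :|: k')) = MAlgU (cl (mcyl F c)) (cl (mcyl F' c')).
  rewrite (MAlgUE mu (measurableU _ _ (measurable_mset _) (measurable_mset _))).
  by apply: mclass_eq; rewrite -[RHS]/(cyl F c `|` cyl F' c') ck ck' -cylU.
apply: (le_lt_trans (MAlg_distU _ _ _ _)).
by rewrite [e]splitr ltrD.
Qed.

(** The measurable approximable sets form a sigma-algebra containing the coordinate sets. *)
Lemma mclass_approximable A : measurable A ->
  forall mA : measurable A, approximable (cl (mset_of mA)).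
Proof.
pose C (A : set X) := measurable A /\ forall mA : measurable A, approximable (cl (mset_of mA)).
move=> mA; suff [] : C A by []; move: A mA => A0 mA0.
apply: (@smallest_sub _ (sigma_algebra setT) (@cylinders I _ bool) C) mA0; last first.
  move=> _ [i [B [mB ->]]]; split=> [|mB' e e0]; first exact: measurable_coord.
  exists [:: i], [set t | ext t i \in B]%SET.
  rewrite MAlg_dist_set_eq//.
  have E x : restr [:: i] x \in [set t | ext t i \in B]%SET <-> B (x i).
    by rewrite finset.inE (ext_restr x (mem_head i [::])); split=> [/set_mem|/mem_set].
  by apply/seteqP; split=> x; rewrite /= /cyl /=; move: (E x); tauto.
split.
- split=> [|mA e e0]; first exact: measurable0.
  exists [::], finset.set0.
  rewrite MAlg_dist_set_eq//.
  apply/seteqP; split=> x // x0; have : restr [::] x \in finset.set0 := x0.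
  by rewrite finset.inE.
- move=> A [mA hA]; rewrite setTD; split=> [|mA' e e0]; first exact: measurableC.
  have [F [b Ab]] := hA mA e e0; exists F, (~: b).
  move: Ab; rewrite !MAlg_distE; congr (fine (mu _) < e).
  have -> : (mcyl F (~: b) : set X) = ~` mcyl F b := cylC b.
  exact: (esym (setYCC A (cyl F b))).
- suff : forall A : nat -> set X, (forall n, C (A n)) -> C (\bigcup_k A k) by [].
  move=> A CA.
  have mA n : measurable (A n) by exact: (CA n).1.
  split=> [|mA' e e0]; first exact: bigcup_measurable.
  (* Finite unions are approximable and increase to the whole union; by continuity from below and
     nestedness, some [U N] is within [e / 2] of it. *)
  pose U n : set X := [set x | exists2 k, (k <= n)%N & A k x].
  have US n : U n.+1 = U n `|` A n.+1.
    apply/seteqP; split=> [x [k + Akx]|x [[k kn Akx]|Anx]].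
    - by rewrite leq_eqVlt => /orP[/eqP <-|kn]; [right|left; exists k].
    - by exists k => //; exact: leqW.
    - by exists n.+1.
  have U0 : U 0%N = A 0%N.
    apply/seteqP; split=> [x [k]|x Ax]; last by exists 0%N.
    by rewrite leqn0 => /eqP ->.
  have mU n : measurable (U n).
    by elim: n => [|n IH]; rewrite ?U0// US; exact: measurableU.
  have hU n : approximable (cl (mset_of (mU n))).
    elim: n => [|n IH].
      have -> : cl (mset_of (mU 0%N)) = cl (mset_of (mA 0%N)) by exact: mclass_eq.
      exact: (CA 0%N).2.
    have -> : cl (mset_of (mU n.+1)) = MAlgU (cl (mset_of (mU n))) (cl (mset_of (mA n.+1))).
      rewrite (@MAlgUE _ _ _ mu (mset_of (mU n)) (mset_of (mA n.+1)) (measurableU _ _ (mU n) (mA n.+1))).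
      by apply: mclass_eq; exact: US.
    by apply: approximableU => //; exact: (CA n.+1).2.
  have UA : \bigcup_n U n = \bigcup_k A k.
    apply/seteqP; split=> [x [p _ [k _ Akx]]|x [k _ Akx]]; first by exists k.
    by exists k => //; exists k.
  have Ucvg : mu (U n) @[n --> \oo] --> mu (\bigcup_k A k).
    rewrite -UA; apply: nondecreasing_cvg_mu => //; first by rewrite UA.
    by move=> p q pq; apply/subsetPset => x [k kp Akx]; exists k => //; exact: leq_trans pq.
  have e2 : 0 < e / 2 by rewrite divr_gt0.
  have /cvgr_dist_lt/(_ _ e2)[N _ hN] : fine (mu (U n)) @[n --> \oo] --> fine (mu (\bigcup_k A k)).
    by apply: fine_cvg; rewrite fineK// fin_num_measure.
  have [F [b Ub]] := hU N _ e2; exists F, b.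
  apply: (le_lt_trans (MAlg_dist_triangle (cl (mset_of (mU N))) _ _)).
  rewrite [e]splitr ltrD// MAlg_dist_nested; last by right => x [k _ Akx]; exists k.
  by rewrite !MAlg_muE; exact: (hN N (leqnn N)).
Qed.

Lemma cyl_dense (a : MAlg mu) (e : R) : 0 < e ->
  exists F (b : {set (size F).-tuple bool}), MAlg_dist a (cl (mcyl F b)) < e.
Proof.
move=> e0; have [A ->] := mclass_surj a.
have -> : cl A = cl (mset_of (measurable_mset A)) by exact: mclass_eq.
exact: mclass_approximable.
Qed.

Lemma cyl_dense_seq (s : seq (MAlg mu)) J (e : R) : 0 < e ->
  exists F, [/\ uniq F, {subset J <= F} & forall a, a \in s ->
    exists b : {set (size F).-tuple bool}, MAlg_dist a (cl (mcyl F b)) < e].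
Proof.
move=> e0; elim: s => [|a s [F [uF JF sF]]].
  by exists (undup J); split=> [||//]; [exact: undup_uniq|move=> i; rewrite mem_undup].
have [F' [b ab]] := cyl_dense a e0.
exists (undup (F' ++ F)); split=> [||c].
- exact: undup_uniq.
- by move=> i /JF iF; rewrite mem_undup mem_cat iF orbT.
- have widen K (k : {set (size K).-tuple bool}) : {subset K <= F' ++ F} ->
      MAlg_dist c (cl (mcyl K k)) < e -> exists b : {set (size (undup (F' ++ F))).-tuple bool},
      MAlg_dist c (cl (mcyl _ b)) < e.
    move=> KF ck; have [|k' kk'] := @cyl_widen _ K (undup (F' ++ F)) k.
      by move=> i /KF; rewrite mem_undup.
    by exists k'; have <- : cl (mcyl K k) = cl (mcyl _ k') by exact: mclass_eq.
  rewrite inE => /orP[/eqP ca|/sF[k ck]].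
    by apply: (widen F' b); rewrite ?ca// => i; rewrite mem_cat => ->.
  by apply: (widen F k) => // i iF; rewrite mem_cat iF orbT.
Qed.

Hypothesis mu_product : product_measure (bernoulli_prob (2^-1 : R)) mu.

Lemma coord_aut_ex (s : Sym I) : exists T : AutMAlg mu, forall A B : mset X,
  (B : set X) = perm_coord s @^-1` A -> T (cl A) = cl B.
Proof.
apply: (@pullback_aut _ _ _ mu (perm_coord s^-1%g) (perm_coord s)).
- exact: perm_coord_preserving.
- exact: perm_coord_preserving.
- exact: perm_coordVK.
- exact: perm_coordK.
Qed.

Definition coord_aut (s : Sym I) : AutMAlg mu := projT1 (cid (coord_aut_ex s)).

Lemma coord_autE (s : Sym I) (A B : mset X) :
  (B : set X) = perm_coord s @^-1` A -> coord_aut s (cl A) = cl B.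
Proof. exact: (projT2 (cid (coord_aut_ex s))). Qed.

Lemma coord_autM : {morph coord_aut : s t / (s * t)%g >-> (s * t)%g}.
Proof.
move=> s t; apply: AutMAlg_ext => a; have [A ->] := mclass_surj a.
have mp u (C : mset X) := measurable_preimage (@measurable_perm_coord _ u) (measurable_mset C).
rewrite AutMAlgM (@coord_autE t A (mset_of (mp t A)))//.
rewrite (@coord_autE s _ (mset_of (mp s (mset_of (mp t A)))))//.
exact: coord_autE.
Qed.

Definition off F (A : set X) := forall x y, (forall i, i \notin F -> x i = y i) -> A x -> A y.

Lemma cube_aut_ex F (tau : {perm (size F).-tuple bool}) : uniq F ->
  exists T : AutMAlg mu, (forall A : mset X, off F A -> T (cl A) = cl A) /\
    forall b, T (cl (mcyl F b)) = cl (mcyl F (tau @: b)%SET).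
Proof.
move=> uF.
have [||||T TE] := @pullback_aut _ _ _ mu (cube_perm tau) (cube_perm tau^-1%g).
- exact: cube_perm_preserving.
- exact: cube_perm_preserving.
- exact: cube_permK.
- exact: cube_permVK.
exists T; split=> [A FA|b]; apply: TE; apply/seteqP; split=> x /=.
- by apply: FA => i /negPf iF; rewrite /cube_perm iF.
- by apply: FA => i /negPf iF; rewrite /cube_perm iF.
- move=> /imsetP[r rb xr].
  suff : restr F (cube_perm tau^-1%g x) \in b by [].
  by rewrite restr_cube_perm// xr permK.
- move=> xb; have {}xb : restr F (cube_perm tau^-1%g x) \in b := xb.
  rewrite restr_cube_perm// in xb.
  by apply/imsetP; exists ((tau^-1)%g (restr F x)) => //; rewrite permKV.
Qed.

End cylinders_dense.

(** * Approximation of automorphisms by finitary ones *)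

Section approximation.
Context (I : choiceType) (R : realType).
Local Notation X := (product_space I bool).
Variable mu : probability X R.
Local Notation cl := (mclass mu).
Implicit Types (F J K : seq I) (T G : AutMAlg mu).

Definition coord_mset i (c : bool) : mset X := mset_of (measurable_coord i [set c]).

Definition mcube K x0 : mset X := mset_of (measurable_cube K x0).

Lemma coord_msetC i : cl (coord_mset i false) = MAlgY MAlgT (cl (coord_mset i true)).
Proof.
rewrite MAlgYE; apply: mclass_eq; apply: etrans (esym (setTYC _)).
suff : forall x : X, (x i = false) = ~ (x i = true) by move=> E; apply/funext.
by move=> x; apply/propext; case: (x i).
Qed.

Lemma mcylC F (b : {set (size F).-tuple bool}) :
  cl (mcyl F (~: b)) = MAlgY MAlgT (cl (mcyl F b)).
Proof.
rewrite MAlgYE; apply: mclass_eq; apply: etrans (esym (setTYC _)); exact: cylC.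
Qed.

Lemma mcylI F (b b' : {set (size F).-tuple bool}) :
  cl (mcyl F (b :&: b')) = MAlgI (cl (mcyl F b)) (cl (mcyl F b')).
Proof.
rewrite (MAlgIE mu (measurableI _ _ (measurable_mset _) (measurable_mset _))).
by apply: mclass_eq; exact: cylI.
Qed.

Lemma mcylU F (b b' : {set (size F).-tuple bool}) :
  cl (mcyl F (b :|: b')) = MAlgU (cl (mcyl F b)) (cl (mcyl F b')).
Proof.
rewrite (MAlgUE mu (measurableU _ _ (measurable_mset _) (measurable_mset _))).
by apply: mclass_eq; exact: cylU.
Qed.

Lemma mcyl0 F : cl (mcyl F finset.set0) = MAlg0.
Proof.
apply: mclass_eq; apply/seteqP; split=> x //= x0.
by have : restr F x \in finset.set0 := x0; rewrite finset.inE.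
Qed.

Lemma mcubeS i K x0 :
  cl (mcube (i :: K) x0) = MAlgI (cl (coord_mset i (x0 i))) (cl (mcube K x0)).
Proof.
rewrite (MAlgIE mu (measurableI _ _ (measurable_mset _) (measurable_mset _))).
apply: mclass_eq; apply/seteqP; split=> [x xK|x [xi xK] j].
  by split; [apply: xK; rewrite mem_head|move=> j jK; apply: xK; rewrite inE jK orbT].
by rewrite inE => /orP[/eqP ->//|]; exact: xK.
Qed.

Section labels.
Variables (T : AutMAlg mu) (J F : seq I) (E : I -> {set (size F).-tuple bool}) (eta : R).
Hypothesis E_close : forall i, i \in J ->
  MAlg_dist (T (cl (coord_mset i true))) (cl (mcyl F (E i))) <= eta.

(** [E i] stands for the image under [T] of the set where coordinate [i] is true, so membership in
    the [E i] decodes a pattern on [F] into a pattern on [J]; these are the [r] that decode to [x0]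
    on [K]. *)
Let label_set K (x0 : X) := [set r | all (fun i => (r \in E i) == x0 i) K]%SET.

Lemma label_set_close K x0 : {subset K <= J} ->
  MAlg_dist (T (cl (mcube K x0))) (cl (mcyl F (label_set K x0))) <= (size K)%:R * eta.
Proof.
elim: K => [|i K IH] KJ.
  have -> : cl (mcube [::] x0) = MAlgT by apply: mclass_eq; apply/seteqP; split.
  rewrite (MAlg_isoT (AutMAlgP T)) mul0r.
  have <- : cl (mcyl F (label_set [::] x0)) = MAlgT.
    apply: mclass_eq; apply/seteqP; split=> // x _.
    by suff : restr F x \in label_set [::] x0 by []; rewrite finset.inE.
  by rewrite MAlg_distxx.
have iJ : i \in J by apply: KJ; rewrite mem_head.
have -> : label_set (i :: K) x0 = (if x0 i then E i else ~: E i) :&: label_set K x0.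
  apply/setP => r; rewrite !finset.inE /=; congr (_ && _).
  by case: (x0 i); rewrite ?finset.inE; case: (r \in E i).
rewrite mcubeS mcylI (MAlg_isoI (AutMAlgP T)) mulrSr mulrDl mul1r addrC.
apply: (le_trans (MAlg_distI _ _ _ _)); apply: lerD; last first.
  by apply: IH => j jK; apply: KJ; rewrite inE jK orbT.
case: (x0 i); first exact: E_close.
rewrite mcylC coord_msetC (MAlg_isoY (AutMAlgP T)) (MAlg_isoT (AutMAlgP T)).
by apply: (le_trans (MAlg_distY _ _ _ _)); rewrite MAlg_distxx add0r E_close.
Qed.

End labels.

Hypothesis mu_product : product_measure (bernoulli_prob (2^-1 : R)) mu.

Lemma cyl_set1 J (q : (size J).-tuple bool) : uniq J -> cyl J [set q]%SET = cube J (ext q).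
Proof.
move=> uJ; apply/seteqP; split=> x; rewrite /cyl /= finset.inE.
  by move=> /eqP xq; apply/restr_eqP; rewrite restr_ext.
by move=> /restr_eqP; rewrite restr_ext// => ->.
Qed.

Lemma aut_approx T J (delta : R) : uniq J -> 0 < delta ->
  exists F G, [/\ uniq F, forall A : mset X, off F A -> G (cl A) = cl A &
    forall b, MAlg_dist (G (cl (mcyl J b))) (T (cl (mcyl J b))) < delta].
Proof.
move=> uJ delta0.
pose N := #|{: (size J).-tuple bool}|.
(* Each of the [N] cubes over [J] costs [2 |J| eta]: [|J| eta] between [T C_q] and [M], and as much
   between [M] and [G C_q]. The added 1 keeps [D] positive and the final bound strict. *)
pose D : R := N%:R * (2 * ((size J)%:R)) + 1.
have D0 : 0 < D by rewrite ltr_wpDl// !mulr_ge0.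
pose eta := delta / D.
have eta0 : 0 < eta by rewrite divr_gt0.
have [F [uF JF FE]] := cyl_dense_seq [seq T (cl (coord_mset i true)) | i <- J] J eta0.
have /choice[E EP] : forall i, exists b : {set (size F).-tuple bool}, i \in J ->
    MAlg_dist (T (cl (coord_mset i true))) (cl (mcyl F b)) <= eta.
  move=> i; have [iJ|iJ] := boolP (i \in J); last by exists finset.set0.
  by have [|b /ltW bE] := FE (T (cl (coord_mset i true))); [exact: map_f|exists b].
(* [p r] is the actual pattern of [r] on [J], and [l r] the one decoded through [E]: the fibres of
   [p] are the cubes over [J], those of [l] approximate their images under [T]. *)
pose p (r : (size F).-tuple bool) := restr J (ext r).
pose l (r : (size F).-tuple bool) := restr J (fun i => r \in E i).
have [tau tauP] := nested_matching p l.
have [G [Goff Gcyl]] := cube_aut_ex mu_product tau uF.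
exists F, G; split=> //.
have cube1 q : MAlg_dist (G (cl (mcyl J [set q]%SET))) (T (cl (mcyl J [set q]%SET)))
    <= 2 * ((size J)%:R * eta).
  pose M := [set r | l r == q]%SET.
  have MT : MAlg_dist (T (cl (mcyl J [set q]%SET))) (cl (mcyl F M)) <= (size J)%:R * eta.
    have := @label_set_close T J F E eta EP J (ext q) (fun i => id).
    have -> : cl (mcube J (ext q)) = cl (mcyl J [set q]%SET).
      by apply: mclass_eq; rewrite [RHS]cyl_set1.
    congr (MAlg_dist _ (cl (mcyl F _)) <= _); apply/setP => r; rewrite !finset.inE.
    apply/allP/eqP => [h|h i iJ].
      by rewrite -[RHS](restr_ext q uJ); apply/restr_eqP => i /h/eqP.
    by apply/eqP; apply: ((restr_eqP J (fun i => r \in E i) (ext q)).1 _ i iJ); rewrite restr_ext.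
  have GC : cl (mcyl J [set q]%SET) = cl (mcyl F [set r | p r == q]%SET).
    apply: mclass_eq; rewrite -[LHS]/(cyl J _) -[RHS]/(cyl F _).
    have E' x : restr J (ext (restr F x)) = restr J x.
      by apply/restr_eqP => i /JF; exact: ext_restr.
    by apply/seteqP; split=> x; rewrite /cyl /= !finset.inE /p E'.
  (* [G C_q] and [M] are nested and [mu (G C_q) = mu (T C_q)]. *)
  have GM : MAlg_dist (G (cl (mcyl J [set q]%SET))) (cl (mcyl F M)) <= (size J)%:R * eta.
    have -> : MAlg_dist (G (cl (mcyl J [set q]%SET))) (cl (mcyl F M)) =
        `|MAlg_mu (G (cl (mcyl J [set q]%SET))) - MAlg_mu (cl (mcyl F M))|.
      rewrite GC Gcyl MAlg_dist_nested//.
      have sub (b c : {set (size F).-tuple bool}) : b \subset c -> cyl F b `<=` cyl F c.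
        by move=> /fintype.subsetP bc x; exact: bc.
      case: (tauP q) => h; [left|right]; apply: sub; apply/fintype.subsetP => r.
        by move=> /imsetP[r' + ->]; rewrite !finset.inE => /eqP/h ->.
      rewrite finset.inE => /eqP lr; apply/imsetP; exists ((tau^-1)%g r).
        by rewrite finset.inE; apply/eqP/h; rewrite permKV.
      by rewrite permKV.
    rewrite (MAlg_iso_mu (AutMAlgP G)) -(MAlg_iso_mu (AutMAlgP T)).
    exact: le_trans (MAlg_mu_dist _ _) MT.
  apply: (le_trans (MAlg_dist_triangle (cl (mcyl F M)) _ _)).
  by rewrite [X in _ + X <= _]MAlg_dist_sym mulrDl !mul1r lerD.
(* A cylinder over [J] is the union of its cubes, and errors add up under unions. *)
have cubes (s : seq ((size J).-tuple bool)) :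
    MAlg_dist (G (cl (mcyl J [set q in s]%SET))) (T (cl (mcyl J [set q in s]%SET)))
    <= (size s)%:R * (2 * ((size J)%:R * eta)).
  elim: s => [|q s IH].
    rewrite (_ : [set q in [::]]%SET = finset.set0); last first.
      by apply/setP => q; rewrite !finset.inE.
    by rewrite mcyl0 !(MAlg_iso0 (AutMAlgP _)) MAlg_distxx mul0r.
  rewrite set_cons mcylU !(MAlg_isoU (AutMAlgP _)).
  apply: (le_trans (MAlg_distU _ _ _ _)).
  by rewrite /= mulrSr mulrDl mul1r addrC lerD.
move=> b; have := cubes (enum b); rewrite set_enum => /le_lt_trans; apply.
rewrite -cardE; apply: (@le_lt_trans _ _ (N%:R * (2 * ((size J)%:R * eta)))).
  apply: ler_wpM2r; last by rewrite ler_nat max_card.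
  have eta1 : 0 <= eta by exact: ltW.
  by apply: mulr_ge0 => //; apply: mulr_ge0.
have -> : N%:R * (2 * ((size J)%:R * eta)) = (D - 1) * eta by rewrite /D; ring.
by rewrite mulrBl mul1r /eta mulrC divfK ?gt_eqF// ltrBlDr ltrDl.
Qed.

End approximation.

(** * Representations of the automorphism group *)

Lemma cvg_initial (S : choiceType) (T : topologicalType) (f : S -> T)
    (F : set_system S) (s : S) : Filter F ->
  f @ F --> f s -> F --> (s : initial_topology f).
Proof.
move=> FF h A [_ [[B Bop <-] Bfs sBA]].
have FB : F (f @^-1` B) by apply: h; rewrite nbhsE; exists B.
by rewrite nbhs_filterE; apply: filterS FB.
Qed.

Section continuity.
Context d (Y : measurableType d) (R : realType) (Q : probability Y R).
Context (H : hilbertType R).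
Variable pi : AutMAlg Q -> orthogonal_group H.
Hypothesis pi_continuous : continuous pi.
Hypothesis pi1 : pi 1%g = 1%g.

Let small (c : seq (MAlg Q) * R) : set (AutMAlg Q) :=
  [set T | forall a, a \in c.1 -> MAlg_dist (T a) a < c.2].

(** The filter of basic pointwise neighbourhoods of 1, written with [MAlg_dist]. Its convergence to
    1 is checked through the two initial topologies that define the one of [AutMAlg]. *)
Let F : set_system (AutMAlg Q) := filter_from [set c | 0 < c.2] small.

Let F_filter : Filter F.
Proof.
apply: filter_from_filter; first by exists ([::], 1) => /=.
move=> [s d1] [t d2] /= d10 d20; exists (s ++ t, Num.min d1 d2) => /=.
  by rewrite lt_min d10.
move=> T sT; split=> a aT /=.
  by have := sT a; rewrite /= mem_cat aT lt_min => /(_ isT)/andP[].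
by have := sT a; rewrite /= mem_cat aT orbT lt_min => /(_ isT)/andP[].
Qed.

Let F_cvg : F --> (1%g : AutMAlg Q).
Proof.
apply: (@cvg_initial (AutMAlg Q) (Sym (MAlg Q)) set_val) => //.
apply: (@cvg_initial (Sym (MAlg Q)) {ptws MAlg Q -> MAlg Q} (fun f : Sym (MAlg Q) => f)) => //.
  exact: fmap_filter.
have FF : Filter ((fun f : Sym (MAlg Q) => (f : MAlg Q -> MAlg Q)) @ (set_val @ F)).
  by do 2 apply: fmap_filter.
apply: (@pointwise_cvgP (MAlg Q) (MAlg Q) _ id FF).2 => a.
apply/cvg_ballP => e e0.
exists ([:: a], e) => // T /= /(_ a (mem_head _ _)) /= Ta.
rewrite ballEmdist /=; suff : MAlg_dist a (T a) < e by [].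
by rewrite MAlg_dist_sym.
Qed.

Lemma orthogonal_eval_continuous (xi : H) :
  continuous (fun u : orthogonal_group H => u xi).
Proof.
move=> u.
have uF : (fun f : Sym H => (f : H -> H)) @ (set_val @ nbhs u) -->
    (Sym_fun (val u) : {ptws H -> H}).
  have h1 : (set_val : orthogonal_group H -> Sym H) @ nbhs u --> val u.
    exact: (@initial_continuous (orthogonal_group H) (Sym H) set_val u).
  have h2 := @initial_continuous (Sym H) {ptws H -> H} (fun f : Sym H => (f : H -> H)) (val u).
  exact: cvg_trans (cvg_app _ h1) h2.
have FF : Filter ((fun f : Sym H => (f : H -> H)) @ (set_val @ nbhs u)).
  by do 2 apply: fmap_filter.
exact: (@pointwise_cvgP H H _ _ FF).1 uF xi.
Qed.

Lemma continuous_small (xi : H) (e : R) : 0 < e ->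
  exists (s : seq (MAlg Q)) (delta : R), 0 < delta /\ forall T : AutMAlg Q,
    (forall a, a \in s -> MAlg_dist (T a) a < delta) -> `|pi T xi - xi| <= e.
Proof.
move=> e0.
have h : (fun T => pi T xi) @ F --> xi.
  have : (fun T : AutMAlg Q => pi T xi) @ F --> pi 1%g xi.
    have piF : pi @ F --> pi 1%g.
      move=> B /pi_continuous piB; exact: (F_cvg piB).
    move=> B /(orthogonal_eval_continuous (x := pi 1%g)) /piF; exact.
  by rewrite pi1.
have [[s delta] /= delta0 sP] : F ((fun T => pi T xi) @^-1` ball xi e).
  exact: (h _ (nbhsx_ballx xi e e0)).
exists s, delta; split=> // T Ts; rewrite distrC ltW//.
by have := sP T Ts; rewrite -ball_normE.
Qed.

End continuity.

(** * Restriction of a representation to permutations of the coordinates *)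

Section coordinate_rep.
Context (I : choiceType) (R : realType) (H : hilbertType R).
Local Notation X := (product_space I bool).
Variable mu : probability X R.
Local Notation cl := (mclass mu).
Hypothesis mu_product : product_measure (bernoulli_prob (2^-1 : R)) mu.
Hypothesis I_inf : infinite_set [set: I].
Variable rho : AutMAlg mu -> orthogonal_group H.
Hypothesis rhoM : {morph rho : S T / (S * T)%g >-> (S * T)%g}.
Hypothesis rho_small : forall (xi : H) (e : R), 0 < e ->
  exists (s : seq (MAlg mu)) (delta : R), 0 < delta /\ forall T : AutMAlg mu,
    (forall a, a \in s -> MAlg_dist (T a) a < delta) -> `|rho T xi - xi| <= e.
Hypothesis rho_noinv : forall xi : H, (forall T, rho T xi = xi) -> xi = 0.
Implicit Types (F J : seq I) (T G : AutMAlg mu).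

Lemma rho_small_cyl (xi : H) (e : R) : 0 < e ->
  exists J (delta : R), [/\ uniq J, 0 < delta & forall T,
    (forall b, MAlg_dist (T (cl (mcyl J b))) (cl (mcyl J b)) < delta) ->
    `|rho T xi - xi| <= e].
Proof.
move=> e0; have [s [delta [delta0 sP]]] := rho_small xi e0.
(* One third for passing from [T a] to the image of the cylinder ([T] is an isometry), one for the
   displacement of the cylinder, one for returning to [a]. *)
have d3 : 0 < delta / 3 by rewrite divr_gt0.
have [J [uJ _ Js]] := cyl_dense_seq s [::] d3.
exists J, (delta / 3); split=> // T TJ; apply: sP => a /Js[b ab].
have := MAlg_dist_triangle (T (cl (mcyl J b))) (T a) a.
have := MAlg_dist_triangle (cl (mcyl J b)) (T (cl (mcyl J b))) a.
rewrite AutMAlg_dist [MAlg_dist (cl _) a]MAlg_dist_sym; have := TJ b; lra.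
Qed.

Local Notation V := (fun s : Sym I => rho (coord_aut mu_product s)).

Lemma coord_repM : {morph V : s t / (s * t)%g >-> (s * t)%g}.
Proof. by move=> s t; rewrite coord_autM rhoM. Qed.

Lemma coord_aut_cyl (s : Sym I) J b : (forall i, i \in J -> s i = i) ->
  coord_aut mu_product s (cl (mcyl J b)) = cl (mcyl J b).
Proof.
move=> sJ; apply: coord_autE.
have E x : restr J (perm_coord s x) = restr J x.
  by apply/restr_eqP => i iJ; rewrite /perm_coord sJ.
apply/seteqP; split=> x.
  by move=> xb; suff : restr J (perm_coord s x) \in b by []; rewrite E.
by move=> xb; have : restr J (perm_coord s x) \in b := xb; rewrite E.
Qed.

Lemma coord_rep_cont (x : H) (e : R) : 0 < e ->
  exists2 J : set I, finite_set J & forall s, fixes J s -> `|V s x - x| <= e.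
Proof.
move=> e0; have [J [delta [uJ delta0 JP]]] := rho_small_cyl x e0.
exists [set` J]; first exact: finite_seq.
move=> s sJ; apply: JP => b; rewrite coord_aut_cyl// MAlg_distxx//.
Qed.

(* Mautner's phenomenon: conjugating by permutations moves F off any finite set. *)
Lemma coord_invariant_off (xi : H) F G :
  (forall s, V s xi = xi) -> (forall A : mset X, off F A -> G (cl A) = cl A) ->
  rho G xi = xi.
Proof.
move=> xi_inv GF; apply/eqP; rewrite -subr_eq0 -normr_le0; apply/ler_addgt0Pr => e e0.
rewrite add0r; have [J [delta [uJ delta0 JP]]] := rho_small_cyl xi e0.
have [x _ []|s _ sF] := @move_off I I_inf [set` J] set0 [set` F] (finite_seq _) (finite_set0 _) (finite_seq _).
set S := coord_aut mu_product s.
have -> : rho G xi - xi = rho S (rho (S^-1 * G * S)%g xi - xi).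
  rewrite orthB -orthM -rhoM !mulgA mulgV mul1g rhoM orthM !xi_inv//.
rewrite orth_norm; apply: JP => b.
suff -> : (S^-1 * G * S : AutMAlg mu)%g (cl (mcyl J b)) = cl (mcyl J b) by rewrite MAlg_distxx.
rewrite !AutMAlgM.
pose B := mset_of (measurable_preimage (@measurable_perm_coord _ s) (measurable_cyl b)).
have SB : S (cl (mcyl J b)) = cl B by exact: coord_autE.
rewrite SB GF -?SB ?AutMAlgK// => x y xy xB.
have E : restr J (perm_coord s y) = restr J (perm_coord s x).
  apply/restr_eqP => i iJ; rewrite /perm_coord xy//.
  by apply/negP; exact: sF.
by suff : restr J (perm_coord s y) \in b by []; rewrite E.
Qed.

Lemma coord_rep_noinv (xi : H) : (forall s, V s xi = xi) -> xi = 0.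
Proof.
move=> xi_inv; apply: rho_noinv => T.
apply/eqP; rewrite -subr_eq0 -normr_le0; apply/ler_addgt0Pr => e e0.
rewrite add0r; have [J [delta [uJ delta0 JP]]] := rho_small_cyl xi e0.
(* Approximating [T^-1] makes [T * G] almost the identity on cylinders over [J]; as [G] fixes [xi],
   [rho T xi] equals [rho (T * G) xi]. *)
have [F [G [uF GF GT]]] := aut_approx mu_product (T^-1)%g uJ delta0.
rewrite -{1}(coord_invariant_off xi_inv GF) -orthM -rhoM; apply: JP => b.
by rewrite AutMAlgM -(AutMAlg_dist T^-1%g) AutMAlgK.
Qed.

End coordinate_rep.

(** * Free action of translations on finite sets of coordinates *)

Section translations.
Variable G : groupType.
Hypothesis torsion_free : forall (x : G) n, (x ^+ n.+1)%g = 1%g -> x = 1%g.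

Definition translation (g : G) (p : nat * G) : nat * G := (p.1, (g * p.2)%g).

Lemma translation_bij g : bijective (translation g).
Proof.
exists (translation g^-1%g) => -[n h]; rewrite /translation /=.
  by rewrite mulKg.
by rewrite mulVKg.
Qed.

Definition Sym_translation g : Sym (nat * G)%type := Sym_of (translation_bij g).

Lemma Sym_translationM : {morph Sym_translation : g h / (g * h)%g >-> (g * h)%g}.
Proof. by move=> g h; apply: SymP => -[n k]; rewrite SymM !Sym_ofE /translation /= mulgA. Qed.

(** A set preserved by [g] contains the orbits of its points under the powers of [g], which are
    infinite; an element of finite order could permute a finite set cyclically. *)
Lemma translation_free g (S : set (nat * G)) : g != 1%g -> finite_set S -> S !=set0 ->
  Sym_translation g @` S <> S.
Proof.
move=> g1 Sf [[n h] Sh] gS.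
have iterE k : iter k (translation g) (n, h) = (n, (g ^+ k * h)%g).
  elim: k => [|k IH]; first by rewrite expg0 mul1g.
  by rewrite iterS IH /translation /= expgS mulgA.
have inS k : S (n, (g ^+ k * h)%g).
  rewrite -iterE; elim: k => //= k IH; rewrite -gS.
  by exists (iter k (translation g) (n, h)).
have inj : injective (fun k => (n, (g ^+ k * h)%g)).
  have lt k m : (k < m)%N -> (g ^+ k * h)%g <> (g ^+ m * h)%g.
    move=> km /mulIg; rewrite -(subnKC km) addSnnS expgnDr -[LHS]mulg1 => /mulgI/esym/torsion_free.
    by move=> g1'; rewrite g1' eqxx in g1.
  move=> k m [km]; have [km'|mk|//] := ltngtP k m.
    by case: (lt _ _ km' km).
  by case: (lt _ _ mk (esym km)).
apply: infinite_nat.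
rewrite (_ : [set: nat] = (fun k => (n, (g ^+ k * h)%g)) @^-1` S); last first.
  by apply/seteqP; split=> // k _; exact: inS.
by apply: finite_preimage => // k m _ _; exact: inj.
Qed.

End translations.

(** * Transport along the isomorphism, and the Bernoulli shift *)

Section transport.
Context d1 d2 (X : measurableType d1) (Y : measurableType d2) (R : realType).
Context (P : probability X R) (Q : probability Y R).
Variables (Phi : MAlg P -> MAlg Q) (Psi : MAlg Q -> MAlg P).
Hypotheses (Phi_iso : MAlg_iso Phi) (PhiK : cancel Phi Psi) (PsiK : cancel Psi Phi).

Lemma transport_ex (T : AutMAlg P) : exists U : AutMAlg Q, forall y, U y = Phi (T (Psi y)).
Proof.
have iso : MAlg_iso (Phi \o (T : MAlg P -> MAlg P) \o Psi).
  apply: MAlg_iso_comp; last exact: MAlg_iso_inv PhiK PsiK.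
  by apply: MAlg_iso_comp => //; exact: AutMAlgP.
by exists (SigSub (mem_set (iso : is_AutMAlg (Sym_of (MAlg_iso_bij iso))))).
Qed.

Definition transport (T : AutMAlg P) : AutMAlg Q := projT1 (cid (transport_ex T)).

Lemma transportE T y : transport T y = Phi (T (Psi y)).
Proof. exact: (projT2 (cid (transport_ex T))). Qed.

Lemma transportM : {morph transport : T U / (T * U)%g >-> (T * U)%g}.
Proof.
by move=> T U; apply: AutMAlg_ext => y; rewrite AutMAlgM !transportE PhiK AutMAlgM.
Qed.

Lemma transport_inj : injective transport.
Proof.
move=> T U TU; apply: AutMAlg_ext => x; apply: (can_inj PhiK).
by rewrite -[x]PhiK -!transportE TU.
Qed.

End transport.

Lemma transport_surj d1 d2 (X : measurableType d1) (Y : measurableType d2) (R : realType)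
    (P : probability X R) (Q : probability Y R) (Phi : MAlg P -> MAlg Q) (Psi : MAlg Q -> MAlg P)
    (Phi_iso : MAlg_iso Phi) (PhiK : cancel Phi Psi) (PsiK : cancel Psi Phi) (U : AutMAlg Q) :
  exists T, transport Phi_iso PhiK PsiK T = U.
Proof.
have [T TE] := transport_ex (MAlg_iso_inv Phi_iso PhiK PsiK) PsiK PhiK U.
by exists T; apply: AutMAlg_ext => y; rewrite transportE TE !PsiK.
Qed.

Lemma coord_aut_inj (I : choiceType) (R : realType)
    (mu : probability (product_space I bool) R)
    (mu_product : product_measure (bernoulli_prob (2^-1 : R)) mu) :
  injective (coord_aut mu_product).
Proof.
move=> s t st; apply: SymP => i; apply/eqP; apply: contrapT => /negP sti.
have sE : coord_aut mu_product s (mclass mu (coord_mset i true)) = mclass mu (coord_mset (s i) true).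
  exact: coord_autE.
have tE : coord_aut mu_product t (mclass mu (coord_mset i true)) = mclass mu (coord_mset (t i) true).
  exact: coord_autE.
have : mclass mu (coord_mset (s i) true) = mclass mu (coord_mset (t i) true).
  by rewrite -sE -tE st.
move=> /mclassP mu0.
(* The cube where coordinate [s i] is true and [t i] false has measure 1/4 and lies in the symmetric
   difference. *)
have := @mu_cube _ _ _ mu_product [:: s i; t i] (fun j => j == s i).
rewrite big_cons big_seq1 => /(_ _)/esym E.
have : ((2^-1)%:E * (2^-1)%:E <= 0 :> \bar R)%E.
  rewrite E /= ?inE ?andbT// -mu0; apply: le_measure; rewrite ?inE.
  - exact: measurable_cube.
  - exact: measurable_setY.
  - move=> x xst; have xs : x (s i) = true by rewrite xst ?mem_head// eqxx.
    have xt : x (t i) = false.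
      by rewrite xst ?inE ?eqxx ?orbT// eq_sym; apply/negbTE.
    by left; split => //; suff : ~ (x (t i) = true) by []; rewrite xt.
by rewrite -EFinM lee_fin leNgt mulr_gt0 ?invr_gt0 ?ltr0n.
Qed.

Lemma infinite_nat_prod (G : groupType) : infinite_set [set: (nat * G)%type].
Proof.
move=> fin; apply: infinite_nat.
rewrite (_ : [set: nat] = (fun n => (n, 1%g : G)) @^-1` setT)//.
by apply: finite_preimage => // m n _ _ [].
Qed.

Section shift.
Context (R : realType) (mu : probability (product_space (nat * F2) bool) R).
Hypothesis mu_product : product_measure (bernoulli_prob (2^-1 : R)) mu.

Definition shift_aut (g : F2) : AutMAlg mu := coord_aut mu_product (Sym_translation g).

(** The image under [bshift g] is the preimage under [bshift g^-1], which is composition with the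
    translation by [g] itself. *)
Lemma shift_autE g A : shift_aut g (mclass mu A) = mclass mu (bshift_mset g A).
Proof.
apply: coord_autE; rewrite -[LHS]/(bshift g @` A) bshift_imageE.
by apply/seteqP; split=> x; rewrite /bshift /= invgK.
Qed.

Lemma shift_autM : {morph shift_aut : g h / (g * h)%g >-> (g * h)%g}.
Proof. by move=> g h; rewrite /shift_aut Sym_translationM coord_autM. Qed.

Lemma shift_aut_inj : injective shift_aut.
Proof.
move=> g h /coord_aut_inj gh.
have : Sym_translation g (0%N, 1%g) = Sym_translation h (0%N, 1%g) by rewrite gh.
by rewrite !Sym_ofE /translation /= !mulg1 => -[].
Qed.

End shift.

Theorem mainTheorem1 (R : realType)
    (mu : probability (product_space (nat * F2) bool) R)
    (mu_product : product_measure (bernoulli_prob (2^-1 : R)) mu)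
    (Phi : MAlg mu -> MAlg (@lebesgue01 R)) (Phi_iso : MAlg_iso Phi)
    (T1 T2 : AutMAlg (@lebesgue01 R))
    (T1_a : corresponds_to_shift Phi F2a T1)
    (T2_b : corresponds_to_shift Phi F2b T2)
    (H : hilbertType R) (H_neq0 : exists xi : H, xi != 0)
    (pi : {multiplicative AutMAlg (@lebesgue01 R) -> orthogonal_group H})
    (pi_continuous : continuous pi)
    (pi_no_invariant : ~ exists xi : H, invariant_vector pi xi) :
  freely_generate T1 T2 /\
  is_multiple_of (fun g : subgroup_gen [set T1; T2] => pi (val g))
    (@regular_rep R (subgroup_gen [set T1; T2])).
Proof.
have [Psi PhiK PsiK] := MAlg_iso_bij Phi_iso.
pose c := transport Phi_iso PhiK PsiK.
pose theta g := c (shift_aut mu_product g).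
have thetaM : {morph theta : g h / (g * h)%g >-> (g * h)%g}.
  by move=> g h; rewrite /theta shift_autM /c transportM.
have theta_inj : injective theta by move=> g h /transport_inj/shift_aut_inj.
have thetaP g T : corresponds_to_shift Phi g T -> theta g = T.
  move=> Tg; apply: AutMAlg_ext => y; rewrite -[y]PsiK; have [A ->] := mclass_surj (Psi y).
  by rewrite Tg /theta /c transportE PhiK shift_autE.
have theta1 : theta 1%g = 1%g by apply: (@mulgI _ (theta 1%g)); rewrite -thetaM !mulg1.
have thetaV g : theta g^-1%g = (theta g)^-1%g.
  by apply: (@mulgI _ (theta g)); rewrite -thetaM !mulgV theta1.
split.
  pose theta' : {multiplicative F2 -> AutMAlg (@lebesgue01 R)} :=
    HB.pack theta (isMultiplicative.Build _ _ theta thetaM).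
  by exists theta'; split; [exact: thetaP|exact: thetaP|].
pose S := [set T1; T2].
(* The image of [theta] is a subgroup containing [T1] and [T2]. The preimages are picked one by one;
   [w] is multiplicative because [theta] is injective. *)
have /choice[w wE] : forall g : subgroup_gen S, exists w, theta w = val g.
  move=> g; have gS : smallest subgroup S (val g) := set_mem (valP g).
  suff [w _ <-] : [set theta w | w in [set: F2]] (val g) by exists w.
  apply: gS; split.
    split=> [|_ _ [u _ <-] [v _ <-]|_ [u _ <-]].
    - by exists 1%g.
    - by exists (u * v)%g.
    - by exists u^-1%g.
  by move=> _ [->|->]; [exists F2a|exists F2b] => //; exact: thetaP.
pose rho T : orthogonal_group H := pi (c T).
have rhoM : {morph rho : T U / (T * U)%g >-> (T * U)%g}.
  by move=> T U; rewrite /rho /c transportM gmulfM.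
have rho_small (xi : H) (e : R) : 0 < e ->
    exists (s : seq (MAlg mu)) (delta : R), 0 < delta /\ forall T : AutMAlg mu,
    (forall a, a \in s -> MAlg_dist (T a) a < delta) -> `|rho T xi - xi| <= e.
  move=> e0; have [s [delta [delta0 sP]]] := continuous_small pi_continuous (rep1 (@gmulfM _ _ pi)) xi e0.
  (* [Phi] is an isometry, so displacements of the classes in [s] are those of their images under
     [Psi]. *)
  exists (map Psi s), delta; split=> // T TP; apply: sP => a /(map_f Psi)/TP.
  rewrite /c transportE -{4}[a]PsiK.
  have -> // : MAlg_dist (Phi (T (Psi a))) (Phi (Psi a)) = MAlg_dist (T (Psi a)) (Psi a).
  exact: MAlg_iso_dist Phi_iso _ _.
have rho_noinv (xi : H) : (forall T, rho T xi = xi) -> xi = 0.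
  move=> xi_inv; apply/eqP; apply: contrapT => /negP xi0; apply: pi_no_invariant.
  exists xi; split=> // U; have [T <-] := transport_surj Phi_iso PhiK PsiK U.
  exact: xi_inv.
apply: (@symmetric_rep_multiple R H _ (@infinite_nat_prod F2)
  (fun s => rho (coord_aut mu_product s)) (coord_repM mu_product rhoM)
  (coord_rep_cont mu_product rho_small)
  (coord_rep_noinv (@infinite_nat_prod F2) rhoM rho_small rho_noinv)
  _ (fun g => Sym_translation (w g))).
- move=> g h; rewrite -Sym_translationM; congr Sym_translation; apply: theta_inj.
  by rewrite thetaM !wE.
- move=> g A g1; apply: translation_free; first exact: free_group_torsion_free.
  apply: contra g1 => /eqP w1; apply/eqP/val_inj.
  by rewrite -wE w1 theta1.
- by move=> g; rewrite -wE.
Qed.
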